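(* Let $\mathcal{F}$ be a family of finite posets closed under disjoint unions and under taking convex subposets, equipped with a system of sets of isomorphisms $\mathrm{M}(P_1,P_2)$ ($P_1,P_2\in\mathcal{F}$) as in the context. Let $\mathcal{C}_{\mathcal{F}}$ be the incidence category of $\mathcal{F}$, and let $\mathcal{P}(\mathcal{F})=\{J_P : P\in\mathcal{F}\}$ be the family of lattices of order ideals of posets in $\mathcal{F}$, with $J_P\sim J_Q$ whenever there exists $f\in\mathrm{M}(P,Q)$. Then the Ringel-Hall algebra $\mathrm{H}_{\mathcal{C}_{\mathcal{F}}}$ of the category $\mathcal{C}_{\mathcal{F}}$ is isomorphic, as a Hopf algebra, to the incidence Hopf algebra $\mathrm{H}_{\mathcal{P}(\mathcal{F}),\sim}$ of the family $\mathcal{P}(\mathcal{F})$. These are graded connected Hopf algebras, graded by the order of the poset (the delta function of the class of $X_P$ has degree $|P|$), and isomorphic to the universal enveloping algebra $U(\mathfrak{n}_{\mathcal{F}})$, where $\mathfrak{n}_{\mathcal{F}}$ denotes the Lie algebra of primitive elements.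
   Context: **Posets.** An order ideal of a poset $P$ is a subset $L\subset P$ such that $y\in L$ and $x\le y$ in $P$ imply $x\in L$. A subposet $Q\subset P$ is convex if $x\le z\le y$ with $x,y\in Q$, $z\in P$ implies $z\in Q$; equivalently $Q=L\setminus I$ for order ideals $I\subset L$ of $P$. $J_P$ denotes the set of order ideals of $P$ ordered by inclusion; it is a distributive lattice under $\cup$ and $\cap$. $P_1+P_2$ denotes the disjoint union of posets (elements of different summands are incomparable). One has $J_{P_1+P_2}\cong J_{P_1}\times J_{P_2}$, and for $I\subset L$ in $J_P$ the interval $[I,L]\subset J_P$ is naturally isomorphic to $J_{L\setminus I}$. **The data.** $\mathcal{F}$ is a family of finite posets closed under disjoint unions and under taking convex subposets. For each $P_1,P_2\in\mathcal{F}$ a set $\mathrm{M}(P_1,P_2)$ of maps $P_1\to P_2$ is given such that: 1. every $f\in \mathrm{M}(P_1,P_2)$ is a poset isomorphism; 2. $\mathrm{M}(P,P)$ contains the identity map; 3. $f\in \mathrm{M}(P_1,P_2)$ implies $f^{-1}\in \mathrm{M}(P_2,P_1)$; 4. $f\in \mathrm{M}(P_1,P_2)$ and $g\in \mathrm{M}(P_2,P_3)$ imply $g\circ f\in \mathrm{M}(P_1,P_3)$; 5. $f\in \mathrm{M}(P_1,P_2)$ and $g\in \mathrm{M}(Q_1,Q_2)$ imply $f\cup g\in \mathrm{M}(P_1+Q_1,P_2+Q_2)$, where $f\cup g$ is the induced map on disjoint unions. **The incidence category $\mathcal{C}_{\mathcal{F}}$.** Objects are symbols $X_P$, one for each $P\in\mathcal{F}$.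 Morphisms are $$\mathrm{Hom}(X_{P_1},X_{P_2})=\{(I_1,I_2,f): I_i\in J_{P_i},\ f\in \mathrm{M}(P_1\setminus I_1,I_2)\}.$$ The composite of $(I_1,I_2,f):X_{P_1}\to X_{P_2}$ followed by $(I_2',I_3',g):X_{P_2}\to X_{P_3}$ is $(K_1,K_3,h)$ with $K_1=I_1\cup f^{-1}(I_2\cap I_2')$, $K_3=g(I_2\setminus I_2')$, and $h=g\circ f:P_1\setminus K_1\to K_3$ the composite of the restrictions $P_1\setminus K_1\to I_2\setminus I_2'$ of $f$ and $I_2\setminus I_2'\to K_3$ of $g$, which is taken to lie in $\mathrm{M}(P_1\setminus K_1,K_3)$ by property 4. Set $X_P\oplus X_Q:=X_{P+Q}$. The subobjects of $X_P$ are exactly the $X_I$, $I\in J_P$, embedded by $(\emptyset,I,\mathrm{id})$, and the quotient is $X_P/X_I=X_{P\setminus I}$. $\mathrm{Iso}(\mathcal{C}_{\mathcal{F}})$ is the collection of isomorphism classes of objects, and $[X_P]$ is the class of $X_P$. **Ringel-Hall algebra.** $\mathrm{H}_{\mathcal{C}_{\mathcal{F}}}$ is the $\mathbb{Q}$-vector space of finitely supported functions $f:\mathrm{Iso}(\mathcal{C}_{\mathcal{F}})\to\mathbb{Q}$, with product and coproduct $$ (f\star g)(M)=\sum_{A\subset M} f(A)\,g(M/A),\qquad \Delta(f)(M,N)=f(M\oplus N),$$ the sum being over subobjects $A$ of $M$; that is, $(f\star g)([X_P])=\sum_{I\in J_P}f([X_I])\,g([X_{P\setminus I}])$ and $\Delta(f)([X_P],[X_Q])=f([X_{P+Q}])$.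 **Incidence Hopf algebra.** An interval is a poset with a unique minimal element $0_P$ and a unique maximal element $1_P$. Let $\mathcal{P}$ be a non-empty family of finite intervals, closed under taking intervals $[x,y]$ and under direct products, with an equivalence relation $\sim$ that is a Hopf relation, meaning: - whenever $P\sim Q$ there is a bijection $\phi:P\to Q$ with $[0_P,x]\sim[0_Q,\phi(x)]$ and $[x,1_P]\sim[\phi(x),1_Q]$ for all $x\in P$; - $P\sim Q$ implies $P\times R\sim Q\times R$ and $R\times P\sim R\times Q$ for all $R\in\mathcal{P}$; - $P\times Q\sim Q\times P\sim P$ if $P,Q\in\mathcal{P}$ and $|Q|=1$. The incidence Hopf algebra $\mathrm{H}_{\mathcal{P},\sim}$ is the $\mathbb{Q}$-vector space of finitely supported functions $f:\mathcal{P}/{\sim}\to\mathbb{Q}$ with $$(f\bullet g)([P])=\sum_{x\in P}f([0_P,x])\,g([x,1_P]),\qquad \Delta(f)([M],[N])=f([M\times N]).$$ For $\mathcal{P}=\mathcal{P}(\mathcal{F})$ with $J_P\sim J_Q$ whenever there exists $f\in\mathrm{M}(P,Q)$, and using $[I,L]\cong J_{L\setminus I}$ and $J_{P+Q}\cong J_P\times J_Q$, these become $$(f\bullet g)([J_P])=\sum_{I\in J_P}f([J_I])\,g([J_{P\setminus I}]),\qquad \Delta(f)([J_P],[J_Q])=f([J_{P+Q}]).$$ A Hopf algebra $A$ over a field $k$ is connected if it possesses a $\mathbb{Z}_{\ge 0}$-grading such that $A_0=k$.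
   Formalization: Added: for all A, B in F only finitely many classes [X_P] have a subobject ≅ X_A with quotient ≅ X_B (exactly that the product keeps finite support; the axioms do not imply it). F is non-empty, and disjoint unions are formed from disjoint copies identified with P, Q by maps in M. *)

(* Defs.v *)
From HB Require Import structures.
From mathcomp Require Import all_boot all_order all_algebra.
From mathcomp Require Import finmap boolp.
From mathcomp.multinomials Require Import monalg.

Set Implicit Arguments.
Unset Strict Implicit.
Unset Printing Implicit Defensive.

Import GRing.Theory.
Local Open Scope quotient_scope.
Local Open Scope ring_scope.

(* The tensor product of V and W is the quotient of the syntactic linear
   combinations of pure tensors by the least congruence imposing the axioms
   of a vector space and the bilinearity of pure tensors. *)

Section Tensor.

Variables V W : lmodType rat.

Inductive tterm : Type :=
| TPure of V & W
| TZero
| TAdd of tterm & tterm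
| TScale of rat & tterm.

Inductive teq : tterm -> tterm -> Prop :=
| teq_refl s : teq s s
| teq_sym s t : teq s t -> teq t s
| teq_trans s t u : teq s t -> teq t u -> teq s u
| teq_add s s' t t' : teq s s' -> teq t t' -> teq (TAdd s t) (TAdd s' t')
| teq_scale a s s' : teq s s' -> teq (TScale a s) (TScale a s')
| teq_addA s t u : teq (TAdd s (TAdd t u)) (TAdd (TAdd s t) u)
| teq_addC s t : teq (TAdd s t) (TAdd t s)
| teq_add0 s : teq (TAdd TZero s) s
| teq_addN s : teq (TAdd (TScale (-1) s) s) TZero
| teq_scaleA a b s : teq (TScale a (TScale b s)) (TScale (a * b) s)
| teq_scale1 s : teq (TScale 1 s) s
| teq_scaleDr a s t : teq (TScale a (TAdd s t)) (TAdd (TScale a s) (TScale a t))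
| teq_scaleDl a b s : teq (TScale (a + b) s) (TAdd (TScale a s) (TScale b s))
| teq_pureDl v v' w : teq (TPure (v + v') w) (TAdd (TPure v w) (TPure v' w))
| teq_pureDr v w w' : teq (TPure v (w + w')) (TAdd (TPure v w) (TPure v w'))
| teq_pureZl a v w : teq (TPure (a *: v) w) (TScale a (TPure v w))
| teq_pureZr a v w : teq (TPure v (a *: w)) (TScale a (TPure v w)).

HB.instance Definition _ := gen_eqMixin tterm.
HB.instance Definition _ := gen_choiceMixin tterm.

Definition teqb (s t : tterm) : bool := `[< teq s t >].

Lemma teqb_refl : reflexive teqb.
Proof. by move=> s; apply/asboolP; exact: teq_refl. Qed.

Lemma teqb_sym : symmetric teqb.
Proof. by move=> s t; apply/asboolP/asboolP => /teq_sym. Qed.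

Lemma teqb_trans : transitive teqb.
Proof.
by move=> t s u /asboolP st /asboolP tu; apply/asboolP; exact: teq_trans st tu.
Qed.

Canonical teqb_equiv := EquivRel teqb teqb_refl teqb_sym teqb_trans.

Definition tensor := {eq_quot teqb}.
HB.instance Definition _ := Choice.on tensor.
HB.instance Definition _ := EqQuotient.on tensor.

Lemma tensor_eqP (s t : tterm) :
  reflect (\pi_tensor s = \pi_tensor t) `[< teq s t >].
Proof. by apply: (iffP idP) => [h|/eqmodP//]; apply/eqmodP. Qed.

Lemma tensor_eq (s t : tterm) : teq s t -> \pi_tensor s = \pi_tensor t.
Proof. by move=> h; apply/tensor_eqP/asboolP. Qed.

Lemma tensor_reprK (s : tterm) : teq (repr (\pi_tensor s)) s.
Proof. by apply/asboolP/tensor_eqP; rewrite reprK. Qed.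

Definition tens (v : V) (w : W) : tensor := \pi_tensor (TPure v w).

Definition tensor_add (x y : tensor) : tensor :=
  \pi_tensor (TAdd (repr x) (repr y)).
Definition tensor_scale (a : rat) (x : tensor) : tensor :=
  \pi_tensor (TScale a (repr x)).
Definition tensor_zero : tensor := \pi_tensor TZero.
Definition tensor_opp (x : tensor) : tensor := tensor_scale (-1) x.

Lemma pi_add s t :
  tensor_add (\pi_tensor s) (\pi_tensor t) = \pi_tensor (TAdd s t).
Proof. by apply: tensor_eq; apply: teq_add; exact: tensor_reprK. Qed.

Lemma pi_scale a s : tensor_scale a (\pi_tensor s) = \pi_tensor (TScale a s).
Proof. by apply: tensor_eq; apply: teq_scale; exact: tensor_reprK. Qed.

Lemma tensor_addA : associative tensor_add.
Proof.
by elim/quotW=> s; elim/quotW=> t; elim/quotW=> u; rewrite (pi_add t u) (pi_add s t) !pi_add;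
  apply: tensor_eq; exact: teq_addA.
Qed.

Lemma tensor_addC : commutative tensor_add.
Proof.
by elim/quotW=> s; elim/quotW=> t; rewrite !pi_add; apply: tensor_eq; exact: teq_addC.
Qed.

Lemma tensor_add0 : left_id tensor_zero tensor_add.
Proof. by elim/quotW=> s; rewrite pi_add; apply: tensor_eq; exact: teq_add0. Qed.

Lemma tensor_addN : left_inverse tensor_zero tensor_opp tensor_add.
Proof.
by elim/quotW=> s; rewrite /tensor_opp (pi_scale _ s) pi_add;
  apply: tensor_eq; exact: teq_addN.
Qed.

HB.instance Definition _ :=
  GRing.isZmodule.Build tensor tensor_addA tensor_addC tensor_add0 tensor_addN.

Lemma tensor_scaleA a b (x : tensor) :
  tensor_scale a (tensor_scale b x) = tensor_scale (a * b) x.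
Proof. by elim/quotW: x => s; rewrite (pi_scale b s) !pi_scale; apply: tensor_eq; exact: teq_scaleA. Qed.

Lemma tensor_scale1 : left_id 1 tensor_scale.
Proof. by elim/quotW=> s; rewrite pi_scale; apply: tensor_eq; exact: teq_scale1. Qed.

Lemma tensor_scaleDr : right_distributive tensor_scale +%R.
Proof.
by move=> a; elim/quotW=> s; elim/quotW=> t;
  rewrite /GRing.add /= (pi_add s t) (pi_scale a s) (pi_scale a t) pi_scale pi_add; apply: tensor_eq; exact: teq_scaleDr.
Qed.

Lemma tensor_scaleDl (x : tensor) : {morph tensor_scale^~ x : a b / a + b}.
Proof.
move=> a b; elim/quotW: x => s; rewrite !pi_scale.
by rewrite [RHS]pi_add; apply: tensor_eq; exact: teq_scaleDl.
Qed.

HB.instance Definition _ := GRing.Zmodule_isLmodule.Build rat tensor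
  tensor_scaleA tensor_scale1 tensor_scaleDr tensor_scaleDl.

(* [tlift b] is the linear map induced by [b]; it is meaningful only when [b]
   is bilinear. *)

Section Lift.

Variable X : lmodType rat.

Fixpoint teval (b : V -> W -> X) (s : tterm) : X :=
  match s with
  | TPure v w => b v w
  | TZero => 0
  | TAdd s t => teval b s + teval b t
  | TScale a s => a *: teval b s
  end.

Definition tlift (b : V -> W -> X) (x : tensor) : X := teval b (repr x).

Definition bilinear_map (b : V -> W -> X) : Prop :=
  (forall v, linear (b v)) /\ (forall w, linear (b^~ w)).

Lemma teval_eq b s t : bilinear_map b -> teq s t -> teval b s = teval b t.
Proof.
move=> [br bl].
have rD v w w' : b v (w + w') = b v w + b v w'.
  by have := br v 1 w w'; rewrite !scale1r.
have lD v v' w : b (v + v') w = b v w + b v' w.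
  by have := bl w 1 v v'; rewrite !scale1r.
have r0 v : b v 0 = 0 by apply: (addrI (b v 0)); rewrite -rD !addr0.
have l0 w : b 0 w = 0 by apply: (addrI (b 0 w)); rewrite -lD !addr0.
have rZ a v w : b v (a *: w) = a *: b v w.
  by have := br v a w 0; rewrite r0 !addr0.
have lZ a v w : b (a *: v) w = a *: b v w.
  by have := bl w a v 0; rewrite l0 !addr0.
elim=> //=.
- by move=> *; congruence.
- by move=> ? ? ? ? _ -> _ ->.
- by move=> ? ? ? _ ->.
- by move=> *; rewrite addrA.
- by move=> *; rewrite addrC.
- by move=> *; rewrite add0r.
- by move=> *; rewrite scaleN1r addNr.
- by move=> *; rewrite scalerA.
- by move=> *; rewrite scale1r.
- by move=> *; rewrite scalerDr.
- by move=> *; rewrite scalerDl.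
Qed.

Lemma tlift_tens b v w : bilinear_map b -> tlift b (tens v w) = b v w.
Proof. by move=> bb; rewrite /tlift (teval_eq bb (tensor_reprK _)). Qed.

Lemma tlift_linear b : bilinear_map b -> linear (tlift b).
Proof.
move=> bb a; elim/quotW=> s; elim/quotW=> t.
rewrite /GRing.scale /GRing.add /= pi_scale pi_add.
by rewrite /tlift !(teval_eq bb (tensor_reprK _)).
Qed.

End Lift.

Lemma tensDl v v' w : tens (v + v') w = tens v w + tens v' w.
Proof. by rewrite [RHS]pi_add; apply: tensor_eq; exact: teq_pureDl. Qed.

Lemma tensDr v w w' : tens v (w + w') = tens v w + tens v w'.
Proof. by rewrite [RHS]pi_add; apply: tensor_eq; exact: teq_pureDr. Qed.

Lemma tensZl a v w : tens (a *: v) w = a *: tens v w.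
Proof. by rewrite [RHS]pi_scale; apply: tensor_eq; exact: teq_pureZl. Qed.

Lemma tensZr a v w : tens v (a *: w) = a *: tens v w.
Proof. by rewrite [RHS]pi_scale; apply: tensor_eq; exact: teq_pureZr. Qed.

End Tensor.

Definition tassoc (V : lmodType rat) (x : tensor (tensor V V) V) :
    tensor V (tensor V V) :=
  tlift (fun t w => tlift (fun u v => tens u (tens v w)) t) x.

Definition tmul (V : lmodType rat) (m : V -> V -> V) (x y : tensor V V) :
    tensor V V :=
  tlift (fun a b => tlift (fun c d => tens (m a c) (m b d)) y) x.

Record hopf_algebra (V : lmodType rat) := HopfAlgebra {
  hmul : V -> V -> V;
  hone : V;
  comul : {linear V -> tensor V V};
  counit : {scalar V};
  antipode : {linear V -> V};
  hmul_bilinear : bilinear_map hmul;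
  hmulA : associative hmul;
  hmul1l : left_id hone hmul;
  hmul1r : right_id hone hmul;
  comulA : forall x,
    tassoc (tlift (fun a b => tens (comul a) b) (comul x)) =
    tlift (fun a b => tens a (comul b)) (comul x);
  counitl : forall x, tlift (fun a b => counit a *: b) (comul x) = x;
  counitr : forall x, tlift (fun a b => counit b *: a) (comul x) = x;
  comulM : forall x y, comul (hmul x y) = tmul hmul (comul x) (comul y);
  comul1 : comul hone = tens hone hone;
  counitM : forall x y, counit (hmul x y) = counit x * counit y;
  counit1 : counit hone = 1;
  antipodel : forall x,
    tlift (fun a b => hmul (antipode a) b) (comul x) = counit x *: hone;
  antipoder : forall x,
    tlift (fun a b => hmul a (antipode b)) (comul x) = counit x *: hone
}.

Definition hopf_isomorphic (V W : lmodType rat)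
    (A : hopf_algebra V) (B : hopf_algebra W) : Prop :=
  exists phi : {linear V -> W},
    [/\ bijective phi,
        (forall x y, phi (hmul A x y) = hmul B (phi x) (phi y)),
        phi (hone A) = hone B,
        (forall x, comul B (phi x) =
                   tlift (fun a b => tens (phi a) (phi b)) (comul A x)) &
        (forall x, counit B (phi x) = counit A x) /\
        (forall x, antipode B (phi x) = phi (antipode A x))].

(* [G n] is the homogeneous component of degree [n]. *)
Definition graded_hopf (V : lmodType rat) (A : hopf_algebra V)
    (G : nat -> V -> Prop) : Prop :=
  [/\ (forall n, G n 0 /\ forall (a : rat) x y, G n x -> G n y -> G n (a *: x + y)),
      (forall x, exists N (c : nat -> V),
         (forall n, G n (c n)) /\ x = \sum_(n < N) c n),
      (forall N (c : nat -> V), (forall n, G n (c n)) ->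
         \sum_(n < N) c n = 0 -> forall n, (n < N)%N -> c n = 0) &
      [/\ G 0%N (hone A),
      (forall m n x y, G m x -> G n y -> G (m + n)%N (hmul A x y)),
      (forall n x, G n x -> exists s : seq (V * V),
         comul A x = \sum_(p <- s) tens p.1 p.2 /\
         forall p, p \in s -> exists i j,
           [/\ (i + j)%N = n, G i p.1 & G j p.2]),
      (forall n x, G n x -> n <> 0%N -> counit A x = 0) &
      (forall n x, G n x -> G n (antipode A x))]].

Definition connected_grading (V : lmodType rat) (A : hopf_algebra V)
    (G : nat -> V -> Prop) : Prop :=
  graded_hopf A G /\ forall x, G 0%N x <-> exists a : rat, x = a *: hone A.

Record lie_algebra := LieAlgebra {
  lie_car :> lmodType rat;
  lie_bracket : lie_car -> lie_car -> lie_car;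
  lie_bilinear : bilinear_map lie_bracket;
  lie_alternating : forall x, lie_bracket x x = 0;
  lie_jacobi : forall x y z,
    lie_bracket x (lie_bracket y z) + lie_bracket y (lie_bracket z x) +
    lie_bracket z (lie_bracket x y) = 0
}.

(* The universal enveloping algebra is the unital associative algebra
   generated by the vector space [L] subject to the relations
   [x * y - y * x = [x, y]], as a quotient of syntactic expressions. *)

Section Enveloping.

Variable L : lie_algebra.

Inductive uterm : Type :=
| UGen of L
| UOne
| UZero
| UAdd of uterm & uterm
| UScale of rat & uterm
| UMul of uterm & uterm.

Inductive ueq : uterm -> uterm -> Prop :=
| ueq_refl s : ueq s s
| ueq_sym s t : ueq s t -> ueq t s
| ueq_trans s t u : ueq s t -> ueq t u -> ueq s u
| ueq_add s s' t t' : ueq s s' -> ueq t t' -> ueq (UAdd s t) (UAdd s' t')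
| ueq_scale a s s' : ueq s s' -> ueq (UScale a s) (UScale a s')
| ueq_mul s s' t t' : ueq s s' -> ueq t t' -> ueq (UMul s t) (UMul s' t')
| ueq_addA s t u : ueq (UAdd s (UAdd t u)) (UAdd (UAdd s t) u)
| ueq_addC s t : ueq (UAdd s t) (UAdd t s)
| ueq_add0 s : ueq (UAdd UZero s) s
| ueq_addN s : ueq (UAdd (UScale (-1) s) s) UZero
| ueq_scaleA a b s : ueq (UScale a (UScale b s)) (UScale (a * b) s)
| ueq_scale1 s : ueq (UScale 1 s) s
| ueq_scaleDr a s t : ueq (UScale a (UAdd s t)) (UAdd (UScale a s) (UScale a t))
| ueq_scaleDl a b s : ueq (UScale (a + b) s) (UAdd (UScale a s) (UScale b s))
| ueq_mulA s t u : ueq (UMul s (UMul t u)) (UMul (UMul s t) u)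
| ueq_mul1l s : ueq (UMul UOne s) s
| ueq_mul1r s : ueq (UMul s UOne) s
| ueq_mulDl s t u : ueq (UMul (UAdd s t) u) (UAdd (UMul s u) (UMul t u))
| ueq_mulDr s t u : ueq (UMul s (UAdd t u)) (UAdd (UMul s t) (UMul s u))
| ueq_scaleAl a s t : ueq (UMul (UScale a s) t) (UScale a (UMul s t))
| ueq_scaleAr a s t : ueq (UMul s (UScale a t)) (UScale a (UMul s t))
| ueq_genD x y : ueq (UGen (x + y)) (UAdd (UGen x) (UGen y))
| ueq_genZ a x : ueq (UGen (a *: x)) (UScale a (UGen x))
| ueq_bracket x y :
    ueq (UGen (lie_bracket x y))
        (UAdd (UMul (UGen x) (UGen y)) (UScale (-1) (UMul (UGen y) (UGen x)))).

HB.instance Definition _ := gen_eqMixin uterm.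
HB.instance Definition _ := gen_choiceMixin uterm.

Definition ueqb (s t : uterm) : bool := `[< ueq s t >].

Lemma ueqb_refl : reflexive ueqb.
Proof. by move=> s; apply/asboolP; exact: ueq_refl. Qed.

Lemma ueqb_sym : symmetric ueqb.
Proof. by move=> s t; apply/asboolP/asboolP => /ueq_sym. Qed.

Lemma ueqb_trans : transitive ueqb.
Proof.
by move=> t s u /asboolP st /asboolP tu; apply/asboolP; exact: ueq_trans st tu.
Qed.

Canonical ueqb_equiv := EquivRel ueqb ueqb_refl ueqb_sym ueqb_trans.

Definition env := {eq_quot ueqb}.
HB.instance Definition _ := Choice.on env.
HB.instance Definition _ := EqQuotient.on env.

Lemma env_eqP (s t : uterm) :
  reflect (\pi_env s = \pi_env t) `[< ueq s t >].
Proof. by apply: (iffP idP) => [h|/eqmodP//]; apply/eqmodP. Qed.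

Lemma env_eq (s t : uterm) : ueq s t -> \pi_env s = \pi_env t.
Proof. by move=> h; apply/env_eqP/asboolP. Qed.

Lemma env_reprK (s : uterm) : ueq (repr (\pi_env s)) s.
Proof. by apply/asboolP/env_eqP; rewrite reprK. Qed.

Definition env_gen (x : L) : env := \pi_env (UGen x).
Definition env_one : env := \pi_env UOne.
Definition env_zero : env := \pi_env UZero.
Definition env_add (x y : env) : env := \pi_env (UAdd (repr x) (repr y)).
Definition env_mul (x y : env) : env := \pi_env (UMul (repr x) (repr y)).
Definition env_scale (a : rat) (x : env) : env := \pi_env (UScale a (repr x)).
Definition env_opp (x : env) : env := env_scale (-1) x.

Lemma pi_env_add s t : env_add (\pi_env s) (\pi_env t) = \pi_env (UAdd s t).
Proof. by apply: env_eq; apply: ueq_add; exact: env_reprK. Qed.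

Lemma pi_env_mul s t : env_mul (\pi_env s) (\pi_env t) = \pi_env (UMul s t).
Proof. by apply: env_eq; apply: ueq_mul; exact: env_reprK. Qed.

Lemma pi_env_scale a s : env_scale a (\pi_env s) = \pi_env (UScale a s).
Proof. by apply: env_eq; apply: ueq_scale; exact: env_reprK. Qed.

Lemma env_addA : associative env_add.
Proof.
by elim/quotW=> s; elim/quotW=> t; elim/quotW=> u; rewrite (pi_env_add t u) (pi_env_add s t) !pi_env_add;
  apply: env_eq; exact: ueq_addA.
Qed.

Lemma env_addC : commutative env_add.
Proof.
by elim/quotW=> s; elim/quotW=> t; rewrite !pi_env_add; apply: env_eq; exact: ueq_addC.
Qed.

Lemma env_add0 : left_id env_zero env_add.
Proof. by elim/quotW=> s; rewrite pi_env_add; apply: env_eq; exact: ueq_add0. Qed.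

Lemma env_addN : left_inverse env_zero env_opp env_add.
Proof.
by elim/quotW=> s; rewrite /env_opp (pi_env_scale _ s) pi_env_add;
  apply: env_eq; exact: ueq_addN.
Qed.

HB.instance Definition _ :=
  GRing.isZmodule.Build env env_addA env_addC env_add0 env_addN.

Lemma env_scaleA a b (x : env) :
  env_scale a (env_scale b x) = env_scale (a * b) x.
Proof. by elim/quotW: x => s; rewrite (pi_env_scale b s) !pi_env_scale; apply: env_eq; exact: ueq_scaleA. Qed.

Lemma env_scale1 : left_id 1 env_scale.
Proof. by elim/quotW=> s; rewrite pi_env_scale; apply: env_eq; exact: ueq_scale1. Qed.

Lemma env_scaleDr : right_distributive env_scale +%R.
Proof.
by move=> a; elim/quotW=> s; elim/quotW=> t;
  rewrite /GRing.add /= (pi_env_add s t) (pi_env_scale a s) (pi_env_scale a t) pi_env_scale pi_env_add;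
  apply: env_eq; exact: ueq_scaleDr.
Qed.

Lemma env_scaleDl (x : env) : {morph env_scale^~ x : a b / a + b}.
Proof.
move=> a b; elim/quotW: x => s; rewrite !pi_env_scale.
by rewrite [RHS]pi_env_add; apply: env_eq; exact: ueq_scaleDl.
Qed.

HB.instance Definition _ := GRing.Zmodule_isLmodule.Build rat env
  env_scaleA env_scale1 env_scaleDr env_scaleDl.

(* The Hopf algebra structure of the enveloping algebra: the elements of [L]
   are primitive, which determines the coproduct. *)
Definition enveloping_hopf (E : hopf_algebra env) : Prop :=
  [/\ (forall x y, hmul E x y = env_mul x y),
      hone E = env_one &
      forall x : L, comul E (env_gen x) =
        tens (env_gen x) env_one + tens env_one (env_gen x)].

End Enveloping.

Section Primitive.

Variables (V : lmodType rat) (A : hopf_algebra V).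

Definition primitive : {pred V} :=
  fun x => comul A x == tens x (hone A) + tens (hone A) x.

Lemma primitiveP x :
  reflect (comul A x = tens x (hone A) + tens (hone A) x) (x \in primitive).
Proof. exact: eqP. Qed.

Lemma primitive_submod : submod_closed primitive.
Proof.
split=> [|a x y /primitiveP hx /primitiveP hy]; apply/primitiveP.
  rewrite linear0 -(scale0r (hone A)) tensZl tensZr !scale0r addr0 //.
by rewrite linearP hx hy !tensDl !tensDr !tensZl !tensZr scalerDr addrACA.
Qed.

HB.instance Definition _ :=
  GRing.isSubmodClosed.Build rat V primitive primitive_submod.

Record prim := Prim { prim_val :> V; prim_valP : prim_val \in primitive }.
HB.instance Definition _ := [isSub for prim_val].
HB.instance Definition _ := [Choice of prim by <:].
HB.instance Definition _ := [SubChoice_isSubLmodule of prim by <:].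

Let mDl x y z : hmul A (x + y) z = hmul A x z + hmul A y z.
Proof. by have := (hmul_bilinear A).2 z 1 x y; rewrite !scale1r. Qed.
Let mDr x y z : hmul A x (y + z) = hmul A x y + hmul A x z.
Proof. by have := (hmul_bilinear A).1 x 1 y z; rewrite !scale1r. Qed.
Let m0l x : hmul A 0 x = 0.
Proof. by apply: (addrI (hmul A 0 x)); rewrite -mDl !addr0. Qed.
Let m0r x : hmul A x 0 = 0.
Proof. by apply: (addrI (hmul A x 0)); rewrite -mDr !addr0. Qed.
Let mZl a x y : hmul A (a *: x) y = a *: hmul A x y.
Proof. by have := (hmul_bilinear A).2 y a x 0; rewrite m0l !addr0. Qed.
Let mZr a x y : hmul A x (a *: y) = a *: hmul A x y.
Proof. by have := (hmul_bilinear A).1 x a y 0; rewrite m0r !addr0. Qed.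

Let inner_bilinear a b :
  bilinear_map (fun c d => tens (hmul A a c) (hmul A b d)).
Proof.
by split=> [v|v] t x y; rewrite (mDr, mDl) mZr ?tensDl ?tensDr ?tensZl ?tensZr.
Qed.

Lemma tmulDr x y z :
  tmul (hmul A) x (y + z) = tmul (hmul A) x y + tmul (hmul A) x z.
Proof.
rewrite /tmul /tlift; elim: (repr x) => [v w||s IHs t IHt|a s IHs] /=.
- have := tlift_linear (inner_bilinear v w) 1 y z.
  by rewrite !scale1r.
- by rewrite addr0.
- by rewrite IHs IHt addrACA.
- by rewrite IHs scalerDr.
Qed.

Let outer_bilinear y : bilinear_map
  (fun a b => tlift (fun c d => tens (hmul A a c) (hmul A b d)) y).
Proof.
split=> [v|v] t x z; rewrite /tlift.
- elim: (repr y) => [c d||s IHs u IHu|a s IHs] /=.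
  + by rewrite mDl mZl tensDr tensZr.
  + by rewrite scaler0 addr0.
  + by rewrite IHs IHu scalerDr addrACA.
  + by rewrite IHs scalerDr !scalerA mulrC.
- elim: (repr y) => [c d||s IHs u IHu|a s IHs] /=.
  + by rewrite mDl mZl tensDl tensZl.
  + by rewrite scaler0 addr0.
  + by rewrite IHs IHu scalerDr addrACA.
  + by rewrite IHs scalerDr !scalerA mulrC.
Qed.

Lemma tmulDl x y z :
  tmul (hmul A) (x + y) z = tmul (hmul A) x z + tmul (hmul A) y z.
Proof.
by have := tlift_linear (outer_bilinear z) 1 x y; rewrite !scale1r.
Qed.

Lemma tmul_tens a b c d :
  tmul (hmul A) (tens a b) (tens c d) = tens (hmul A a c) (hmul A b d).
Proof. by rewrite /tmul !tlift_tens. Qed.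

Definition commutator (x y : V) : V := hmul A x y - hmul A y x.

Lemma commutator_primitive x y :
  x \in primitive -> y \in primitive -> commutator x y \in primitive.
Proof.
move=> /primitiveP hx /primitiveP hy; apply/primitiveP.
rewrite /commutator linearB !comulM hx hy !tmulDl !tmulDr !tmul_tens.
rewrite !hmul1l !hmul1r -!scaleN1r !tensDl !tensDr !tensZl !tensZr !scaleN1r.
set a := tens (hmul A x y) _; set b := tens (hmul A y x) _.
set c := tens (hone A) (hmul A x y); set d := tens (hone A) (hmul A y x).
set e := tens x y; set f := tens y x.
rewrite (AC (2*2) ((2*3)*(1*4)))/= [X in _ - X](AC (2*2) ((3*2)*(1*4)))/=.
by rewrite [in LHS]opprD [LHS]addrACA subrr add0r [in LHS]opprD addrACA.
Qed.

Definition prim_bracket (x y : prim) : prim :=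
  Prim (commutator_primitive (prim_valP x) (prim_valP y)).

Let mNl x y : hmul A (- x) y = - hmul A x y.
Proof. by rewrite -scaleN1r mZl scaleN1r. Qed.
Let mNr x y : hmul A x (- y) = - hmul A x y.
Proof. by rewrite -scaleN1r mZr scaleN1r. Qed.

Lemma prim_bracket_bilinear : bilinear_map prim_bracket.
Proof.
split=> v a x y; apply/val_inj => /=; rewrite /commutator mDl mDr mZl mZr;
  by rewrite scalerBr opprD addrACA.
Qed.

Lemma prim_bracket_alternating x : prim_bracket x x = 0.
Proof. by apply/val_inj => /=; rewrite /commutator subrr. Qed.

Lemma prim_bracket_jacobi x y z :
  prim_bracket x (prim_bracket y z) + prim_bracket y (prim_bracket z x) +
  prim_bracket z (prim_bracket x y) = 0.
Proof.
apply/val_inj => /=; rewrite /commutator !mDl !mDr !mNl !mNr !hmulA !opprB.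
by rewrite (AC ((2*2)*(2*2)*(2*2))
  ((1*12)*(7*2)*(3*10)*(5*4)*(11*6)*(9*8)))/= !subrr !addr0.
Qed.

Definition primitive_lie : lie_algebra :=
  LieAlgebra prim_bracket_bilinear prim_bracket_alternating prim_bracket_jacobi.

End Primitive.

Definition is_enveloping_of_primitives (V : lmodType rat)
    (A : hopf_algebra V) : Prop :=
  exists E : hopf_algebra (env (primitive_lie A)),
    enveloping_hopf E /\ hopf_isomorphic A E.

Definition classes (T : Type) (R : T -> T -> Prop) : choiceType :=
  {C : T -> Prop | `[< exists x, C = R x >]}.

Lemma classes_subproof (T : Type) (R : T -> T -> Prop) (x : T) :
  `[< exists y, R x = R y >].
Proof. by apply/asboolP; exists x. Qed.

Definition class_of (T : Type) (R : T -> T -> Prop) (x : T) : classes R :=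
  exist _ (R x) (classes_subproof R x).

(* The identification of a tensor of finitely supported functions with a
   function of two variables, [f (x) g] being [(a, b) |-> f a * g b]. *)
Definition tcoeff (K : choiceType)
    (x : tensor {malg rat[K]} {malg rat[K]}) (a b : K) : rat :=
  tlift (fun f g => f@_a * g@_b : rat^o) x.

(* A finite poset is a finite subset of an ambient type together with the
   graph of its order, so that equality of posets is equality of their
   elements and relations, and nested subposets are literally subposets. *)

Local Open Scope fset_scope.
Local Open Scope fmap_scope.

Record fposet (U : choiceType) := FPoset {
  pcar : {fset U};
  prel : {fset U * U};
  prel_dom : forall x y, (x, y) \in prel -> x \in pcar /\ y \in pcar;
  prel_refl : forall x, x \in pcar -> (x, x) \in prel;
  prel_anti : forall x y, (x, y) \in prel -> (y, x) \in prel -> x = y;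
  prel_trans : forall x y z,
    (x, y) \in prel -> (y, z) \in prel -> (x, z) \in prel
}.

Definition ple (U : choiceType) (P : fposet U) (x y : U) : bool :=
  (x, y) \in prel P.

Section MkPoset.

Variables (U : choiceType) (A : {fset U}) (r : rel U).
Hypothesis r_refl : forall x, x \in A -> r x x.
Hypothesis r_anti : {in A &, forall x y, r x y -> r y x -> x = y}.
Hypothesis r_trans : {in A & &, forall x y z, r x y -> r y z -> r x z}.

Let R : {fset U * U} := [fset p in A `*` A | r p.1 p.2].

Let inR x y : ((x, y) \in R) = [&& x \in A, y \in A & r x y].
Proof. by rewrite !inE /= andbA. Qed.

Lemma mk_dom x y : (x, y) \in R -> x \in A /\ y \in A.
Proof. by rewrite inR => /and3P[]. Qed.

Lemma mk_refl x : x \in A -> (x, x) \in R.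
Proof. by move=> xA; rewrite inR xA r_refl. Qed.

Lemma mk_anti x y : (x, y) \in R -> (y, x) \in R -> x = y.
Proof.
by rewrite !inR => /and3P[xA yA xy] /and3P[_ _ yx]; exact: r_anti.
Qed.

Lemma mk_trans x y z : (x, y) \in R -> (y, z) \in R -> (x, z) \in R.
Proof.
rewrite !inR => /and3P[xA yA xy] /and3P[_ zA yz].
by rewrite xA zA; exact: r_trans yz.
Qed.

Definition mk_fposet : fposet U := FPoset mk_dom mk_refl mk_anti mk_trans.

End MkPoset.

Section Posets.

Variable U : choiceType.
Implicit Types (P Q S : fposet U) (A I : {fset U}).

Lemma psub_refl P A x : x \in pcar P `&` A -> ple P x x.
Proof. by rewrite inE => /andP[xP _]; exact: prel_refl. Qed.

Lemma psub_anti P A :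
  {in pcar P `&` A &, forall x y, ple P x y -> ple P y x -> x = y}.
Proof. by move=> x y _ _; exact: prel_anti. Qed.

Lemma psub_trans P A :
  {in pcar P `&` A & &, forall x y z, ple P x y -> ple P y z -> ple P x z}.
Proof. by move=> x y z _ _ _; exact: prel_trans. Qed.

(* The subposet of [P] on [pcar P `&` A]. *)
Definition psub P A : fposet U :=
  mk_fposet (@psub_refl P A) (@psub_anti P A) (@psub_trans P A).

Definition convex P A : Prop :=
  A `<=` pcar P /\
  forall x y z, x \in A -> y \in A -> ple P x z -> ple P z y -> z \in A.

Definition order_ideal P I : bool :=
  (I `<=` pcar P) && [forall x : pcar P, forall y : pcar P,
    (val y \in I) && ple P (val x) (val y) ==> (val x \in I)].

Definition ideals P : {fset {fset U}} :=
  [fset I in fpowerset (pcar P) | order_ideal P I].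

Lemma ideals_refl P I : I \in ideals P -> I `<=` I.
Proof. by []. Qed.

Lemma ideals_anti P :
  {in ideals P &, forall I L, I `<=` L -> L `<=` I -> I = L}.
Proof. by move=> I L _ _ IL LI; apply/eqP; rewrite eqEfsubset IL. Qed.

Lemma ideals_trans P :
  {in ideals P & &, forall I L K, I `<=` L -> L `<=` K -> I `<=` K}.
Proof. by move=> I L K _ _ _; exact: fsubset_trans. Qed.

Definition ideal_lattice P : fposet {fset U} :=
  mk_fposet (@ideals_refl P) (@ideals_anti P) (@ideals_trans P).

Definition is_disjoint_union P Q S : Prop :=
  [/\ [disjoint pcar P & pcar Q],
      pcar S = pcar P `|` pcar Q & prel S = prel P `|` prel Q].

End Posets.

Definition poset_isomorphic (U W : choiceType) (P : fposet U) (Q : fposet W) :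
    Prop :=
  exists phi : U -> W,
    [/\ {in pcar P &, injective phi},
        [fset phi x | x in pcar P] = pcar Q &
        {in pcar P &, forall x y, ple Q (phi x) (phi y) = ple P x y}].

Section PosetProduct.

Variables (U W : choiceType) (P : fposet U) (Q : fposet W).

Let r (p q : U * W) : bool := ple P p.1 q.1 && ple Q p.2 q.2.

Lemma pprod_refl p : p \in pcar P `*` pcar Q -> r p p.
Proof. by rewrite inE => /andP[p1 p2]; apply/andP; split; exact: prel_refl. Qed.

Lemma pprod_anti :
  {in pcar P `*` pcar Q &, forall p q, r p q -> r q p -> p = q}.
Proof.
move=> [a b] [c d] _ _ /andP[/= ac bd] /andP[/= ca db].
by rewrite (prel_anti ac ca) (prel_anti bd db).
Qed.

Lemma pprod_trans :
  {in pcar P `*` pcar Q & &, forall p q s, r p q -> r q s -> r p s}.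
Proof.
move=> p q s _ _ _ /andP[pq1 pq2] /andP[qs1 qs2]; apply/andP; split.
  exact: prel_trans pq1 qs1.
exact: prel_trans pq2 qs2.
Qed.

Definition pprod : fposet (U * W)%type :=
  mk_fposet pprod_refl pprod_anti pprod_trans.

End PosetProduct.

Section Maps.

Variable U : choiceType.
Implicit Types (P Q : fposet U) (f g : {fmap U -> U}).

(* Total application, meaningful only on the domain. *)
Definition fapp f (x : U) : U := odflt x f.[? x].

Definition fmid (A : {fset U}) : {fmap U -> U} := [fmap x : A => val x].

(* The composite of [f] followed by [g], when [codomf f] is included in
   [domf g]. *)
Definition fmcomp g f : {fmap U -> U} := [fmap x : domf f => fapp g (f x)].

Definition fm_poset_iso P Q f : Prop :=
  [/\ domf f = pcar P, codomf f = pcar Q,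
      {in pcar P &, injective (fapp f)} &
      {in pcar P &, forall x y, ple Q (fapp f x) (fapp f y) = ple P x y}].

Definition is_inverse f g : Prop :=
  [/\ domf g = codomf f, fmcomp g f = fmid (domf f) &
      fmcomp f g = fmid (domf g)].

Record mor := Mor {
  mor_ker : {fset U};
  mor_im : {fset U};
  mor_fun : {fmap U -> U}
}.

Definition is_mor (M : fposet U -> fposet U -> {fmap U -> U} -> Prop)
    P Q (m : mor) : Prop :=
  [/\ mor_ker m \in ideals P, mor_im m \in ideals Q &
      M (psub P (pcar P `\` mor_ker m)) (psub Q (mor_im m)) (mor_fun m)].

Definition mor_id P : mor := Mor fset0 (pcar P) (fmid (pcar P)).

(* The composite of [m] followed by [n]. *)
Definition mor_comp (m n : mor) : mor :=
  let K1 := mor_ker m `|`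
    [fset x in domf (mor_fun m) |
       fapp (mor_fun m) x \in mor_im m `&` mor_ker n] in
  let K3 := [fset fapp (mor_fun n) y | y in mor_im m `\` mor_ker n] in
  Mor K1 K3 (fmcomp (mor_fun n) (mor_fun m).[\ K1]).

End Maps.

(* [inc_sum]: the disjoint union P + Q is formed inside the ambient type from
   disjoint copies of P and Q, identified with P and Q by maps of M; thus the
   associativity, commutativity and unit isomorphisms of + belong to M.
   [inc_comp]: composites of morphisms of the incidence category, which
   involve restrictions of maps of M, have their underlying map in M. *)
Record incidence_data (U : choiceType) := IncidenceData {
  inc_fam : fposet U -> Prop;
  inc_map : fposet U -> fposet U -> {fmap U -> U} -> Prop;
  inc_nonempty : exists P, inc_fam P;
  inc_convex : forall P A, inc_fam P -> convex P A -> inc_fam (psub P A);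
  inc_sum : forall P Q, inc_fam P -> inc_fam Q -> exists P' Q' S,
    [/\ [/\ inc_fam P', inc_fam Q' & inc_fam S],
        exists f, inc_map P P' f,
        exists g, inc_map Q Q' g &
        is_disjoint_union P' Q' S];
  inc_iso : forall P Q f, inc_fam P -> inc_fam Q ->
    inc_map P Q f -> fm_poset_iso P Q f;
  inc_id : forall P, inc_fam P -> inc_map P P (fmid (pcar P));
  inc_inv : forall P Q f g, inc_fam P -> inc_fam Q ->
    inc_map P Q f -> is_inverse f g -> inc_map Q P g;
  inc_trans : forall P Q S f g, inc_fam P -> inc_fam Q -> inc_fam S ->
    inc_map P Q f -> inc_map Q S g -> inc_map P S (fmcomp g f);
  inc_union : forall P1 Q1 S1 P2 Q2 S2 f g,
    [/\ inc_fam P1, inc_fam Q1 & inc_fam S1] ->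
    [/\ inc_fam P2, inc_fam Q2 & inc_fam S2] ->
    is_disjoint_union P1 Q1 S1 -> is_disjoint_union P2 Q2 S2 ->
    inc_map P1 P2 f -> inc_map Q1 Q2 g -> inc_map S1 S2 (f + g)%fmap;
  inc_comp : forall P1 P2 P3 m n,
    inc_fam P1 -> inc_fam P2 -> inc_fam P3 ->
    is_mor inc_map P1 P2 m -> is_mor inc_map P2 P3 n ->
    let mn := mor_comp m n in
    inc_map (psub P1 (pcar P1 `\` mor_ker mn)) (psub P3 (mor_im mn))
            (mor_fun mn)
}.

Section IncidenceCategory.

Variables (U : choiceType) (D : incidence_data U).

Record obj := Obj { obj_poset :> fposet U; obj_inc : inc_fam D obj_poset }.

Definition Hom (X Y : obj) (m : mor U) : Prop := is_mor (inc_map D) X Y m.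

Definition obj_iso (X Y : obj) : Prop :=
  exists m n, [/\ Hom X Y m, Hom Y X n,
    mor_comp m n = mor_id X & mor_comp n m = mor_id Y].

Definition iso_class := classes obj_iso.

Definition map_equiv (P Q : obj) : Prop := exists f, inc_map D P Q f.

Definition is_sum (P Q S : obj) : Prop :=
  exists P' Q' : obj,
    [/\ map_equiv P P', map_equiv Q Q' & is_disjoint_union P' Q' S].

Lemma sum_exists (P Q : obj) : exists S, is_sum P Q S.
Proof.
have [P' [Q' [S [[hP' hQ' hS] eP eQ hu]]]] := inc_sum (obj_inc P) (obj_inc Q).
by exists (Obj hS), (Obj hP'), (Obj hQ').
Qed.

Definition obj_sum (P Q : obj) : obj := projT1 (cid (sum_exists P Q)).

(* The subposet of [P] on [A]; the default value [P] is used only when [A] is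
   not convex. *)
Definition obj_sub (P : obj) (A : {fset U}) : obj :=
  match pselect (convex P A) with
  | left h => Obj (inc_convex (obj_inc P) h)
  | right _ => P
  end.

(* For any A and B, only finitely many classes of X_P have a subobject
   isomorphic to X_A with quotient isomorphic to X_B. This says exactly that
   the product of finitely supported functions is finitely supported; it fails
   for instance when M remembers infinitely many colours on the edges of the
   posets but none on their elements. *)
Definition finitary : Prop :=
  forall A B : obj, exists (n : nat) (Q : 'I_n -> obj),
    forall (P : obj) (I : {fset U}), I \in ideals P ->
      obj_iso (obj_sub P I) A -> obj_iso (obj_sub P (pcar P `\` I)) B ->
      exists i, obj_iso P (Q i).

Definition is_ringel_hall (H : hopf_algebra {malg rat[iso_class]}) : Prop :=
  (forall (f g : {malg rat[iso_class]}) (P : obj),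
     (hmul H f g)@_(class_of obj_iso P) =
     \sum_(I <- ideals P)
        f@_(class_of obj_iso (obj_sub P I)) *
        g@_(class_of obj_iso (obj_sub P (pcar P `\` I)))) /\
  (forall (f : {malg rat[iso_class]}) (P Q : obj),
     tcoeff (comul H f) (class_of obj_iso P) (class_of obj_iso Q) =
     f@_(class_of obj_iso (obj_sum P Q))).

End IncidenceCategory.

(* A family of intervals is indexed by [fam_index]; it is closed under
   subintervals and products up to isomorphism, [fam_itv i x y] being the
   index of the member isomorphic to the interval [x, y] of the member [i]
   (meaningful only for [x <= y]) and [fam_prod i j] that of the member
   isomorphic to the product. *)
Record interval_family (W : choiceType) := IntervalFamily {
  fam_index : Type;
  fam_poset : fam_index -> fposet W;
  fam_bot : fam_index -> W;
  fam_top : fam_index -> W;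
  fam_itv : fam_index -> W -> W -> fam_index;
  fam_prod : fam_index -> fam_index -> fam_index
}.

Section IncidenceHopf.

Variables (W : choiceType) (F : interval_family W).

Definition unique_minimal (P : fposet W) (z : W) : Prop :=
  forall m, (m \in pcar P /\ forall x, ple P x m -> x = m) <-> m = z.

Definition unique_maximal (P : fposet W) (z : W) : Prop :=
  forall m, (m \in pcar P /\ forall x, ple P m x -> x = m) <-> m = z.

Definition is_interval_family : Prop :=
  [/\ inhabited (fam_index F),
      (forall i : fam_index F, unique_minimal (fam_poset i) (fam_bot i) /\
                               unique_maximal (fam_poset i) (fam_top i)),
      (forall (i : fam_index F) x y, ple (fam_poset i) x y ->
         poset_isomorphic (fam_poset (fam_itv i x y))
           (psub (fam_poset i)
              [fset z in pcar (fam_poset i) |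
                 ple (fam_poset i) x z && ple (fam_poset i) z y])) &
      (forall i j : fam_index F,
         poset_isomorphic (fam_poset (fam_prod i j))
           (pprod (fam_poset i) (fam_poset j)))].

Variable R : fam_index F -> fam_index F -> Prop.

Definition is_hopf_relation : Prop :=
  [/\ [/\ (forall i, R i i), (forall i j, R i j -> R j i) &
          (forall i j k, R i j -> R j k -> R i k)],
      (forall i j, R i j -> exists phi : W -> W,
         [/\ {in pcar (fam_poset i) &, injective phi},
             [fset phi x | x in pcar (fam_poset i)] = pcar (fam_poset j) &
             forall x, x \in pcar (fam_poset i) ->
               R (fam_itv i (fam_bot i) x) (fam_itv j (fam_bot j) (phi x)) /\
               R (fam_itv i x (fam_top i)) (fam_itv j (phi x) (fam_top j))]),
      (forall i j k, R i j -> R (fam_prod i k) (fam_prod j k) /\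
                              R (fam_prod k i) (fam_prod k j)) &
      (forall i j, #|` pcar (fam_poset j)| = 1%N ->
         R (fam_prod i j) (fam_prod j i) /\ R (fam_prod j i) i)].

Definition is_incidence_hopf (H : hopf_algebra {malg rat[classes R]}) : Prop :=
  (forall (f g : {malg rat[classes R]}) (i : fam_index F),
     (hmul H f g)@_(class_of R i) =
     \sum_(x <- pcar (fam_poset i))
        f@_(class_of R (fam_itv i (fam_bot i) x)) *
        g@_(class_of R (fam_itv i x (fam_top i)))) /\
  (forall (f : {malg rat[classes R]}) (i j : fam_index F),
     tcoeff (comul H f) (class_of R i) (class_of R j) =
     f@_(class_of R (fam_prod i j))).

End IncidenceHopf.

(* The family of the lattices J_P, indexed by P (which J_P determines); the interval [I, L] is naturally isomorphic
   to the lattice of ideals of L \ I. *)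
Definition ideal_lattices (U : choiceType) (D : incidence_data U) :
    interval_family {fset U} :=
  {| fam_index := obj D;
     fam_poset := fun P => ideal_lattice P;
     fam_bot := fun _ => fset0;
     fam_top := fun P => pcar P;
     fam_itv := fun P I L => obj_sub P (L `\` I);
     fam_prod := @obj_sum U D |}.

Definition lattice_equiv (U : choiceType) (D : incidence_data U) :
    fam_index (ideal_lattices D) -> fam_index (ideal_lattices D) -> Prop :=
  @map_equiv U D.

(* Functions supported on the classes of posets with [n] elements. *)
Definition order_component (U : choiceType) (D : incidence_data U)
    (R : obj D -> obj D -> Prop) (n : nat) (f : {malg rat[classes R]}) : Prop :=
  forall P : obj D, f@_(class_of R P) <> 0 -> #|` pcar P| = n.

(* Main.v *)
From HB Require Import structures.
From mathcomp Require Import all_boot all_order all_algebra.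
From mathcomp Require Import finmap boolp.
From mathcomp.multinomials Require Import monalg.
Require Import Defs.

(** Two objects of the incidence category are isomorphic exactly when some map
    of M joins their posets ([obj_isoE]): an isomorphism has empty kernel and
    full image. So the Ringel-Hall algebra and the incidence Hopf algebra are
    algebras of functions on the same set K of classes. The product of the
    first sums over the ideals I of P, through the pair (I, P minus I); that of
    the second over the elements I of the lattice of ideals, through the
    intervals below and above I, which are the lattices of ideals of I and of
    P minus I. The coproducts agree as well, and the isomorphism is the
    identity.

    What the Hopf algebra needs is collected in the structure [hall_monoid]: K
    is a commutative monoid under disjoint union, graded by the number of
    elements, and carries for each k the finite list of pairs (class of
    subobject, class of quotient). That the maps of M restrict to ideals and to
    their complements follows from the composition of morphisms with inclusions
    and projections ([map_equiv_lift]), and makes the list depend on the class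
    only. Associativity of the product counts chains of two ideals in two ways
    ([pc_subA]); compatibility with the coproduct says that an ideal of a
    disjoint union is a union of ideals of the parts ([pc_subD]). A tensor is
    determined by its coefficients ([tcoeff_inj]), so that the identities in
    the tensor square can be checked on functions of two classes. The antipode
    exists since convolution equations can be solved by recursion on the degree
    ([conv_solve]).

    Being graded, connected and cocommutative over the rationals, the Hopf
    algebra H is the enveloping algebra U of its primitive elements. The proof
    constructs the inverse of the canonical map pi from U to H. Let E be the
    Euler derivation, which multiplies an element of degree n by n, and let D,
    the Dynkin operator, be the solution of id * D = E for the convolution
    product. Commutativity of K makes the values of D primitive
    ([dynkin_primitive]). So a linear map psi from H to U can be defined by
    recursion on the degree from psi(1) = 1 and psi o E = psi * D, with D read
    as a map to U; since the identity of H satisfies the same recursion, pi o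
    psi = id ([hall_to_envK]). For x primitive and homogeneous of degree d, right
    multiplication by x is a coderivation of H, whence
    D(y x) = [D(y), x] + d eps(y) x, with eps the counit ([dynkin_mul]), and then
    psi(y x) = psi(y) x by induction on the degree of y. As U is generated by
    the primitive elements, psi(pi(u)) = psi(1) u = u ([env_to_hallK]). No basis
    of U is needed, and its Hopf structure is the one transported along pi. *)

Set Implicit Arguments.
Unset Strict Implicit.
Unset Printing Implicit Defensive.

Import Order.TTheory GRing.Theory Num.Theory.
Local Open Scope quotient_scope.
Local Open Scope ring_scope.

(** * Linear algebra over the rationals *)

Section LinearMaps.

Variables (V W : lmodType rat) (f : V -> W).
Hypothesis lf : linear f.

Lemma lin0 : f 0 = 0.
Proof.
by have := lf (-1) 0 0; rewrite !scaleN1r !addNr.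
Qed.

Lemma linD x y : f (x + y) = f x + f y.
Proof. by have := lf 1 x y; rewrite !scale1r. Qed.

Lemma linZ a x : f (a *: x) = a *: f x.
Proof. by have := lf a x 0; rewrite !addr0 lin0 addr0. Qed.

Lemma lin_sum (I : Type) (s : seq I) (P : pred I) (F : I -> V) :
  f (\sum_(i <- s | P i) F i) = \sum_(i <- s | P i) f (F i).
Proof. exact: (big_morph f linD lin0). Qed.

End LinearMaps.

Lemma lin_comp (V W X : lmodType rat) (g : W -> X) (f : V -> W) :
  linear g -> linear f -> linear (g \o f).
Proof. by move=> lg lf a x y /=; rewrite lf lg. Qed.

Lemma lin_id (V : lmodType rat) : linear (@id V).
Proof. by []. Qed.

Lemma lin_add (V W : lmodType rat) (f g : V -> W) :
  linear f -> linear g -> linear (fun x => f x + g x).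
Proof. by move=> lf lg a x y; rewrite lf lg scalerDr addrACA. Qed.

Lemma lin_bigsum (V W : lmodType rat) (I : Type) (s : seq I) (F : I -> V -> W) :
  (forall i, linear (F i)) -> linear (fun x => \sum_(i <- s) F i x).
Proof.
move=> lF a x y; rewrite scaler_sumr -big_split /=.
by apply: eq_bigr => i _; rewrite lF.
Qed.

Lemma lin_mulr (V : lmodType rat) (f : V -> rat^o) (c : rat) :
  linear f -> linear (fun x => f x * c : rat^o).
Proof. by move=> lf a x y; rewrite lf [LHS]mulrDl -scalerAl. Qed.

Lemma lin_mull (V : lmodType rat) (f : V -> rat^o) (c : rat) :
  linear f -> linear (fun x => c * f x : rat^o).
Proof. by move=> lf a x y; rewrite lf [LHS]mulrDr; congr (_ + _); exact: mulrCA. Qed.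

Section FreeModule.

Variable K : choiceType.
Implicit Types (f g : {malg rat[K]}) (k : K).

Lemma malg_basis f : f = \sum_(k <- msupp f) f@_k *: << k >>.
Proof.
rewrite {1}[f]monalgE; apply: eq_bigr => k _.
by apply/malgP => l; rewrite mcoeffZ !mcoeffU mulr_natr.
Qed.

Lemma mcoeff_linear k : linear (fun f => f@_k : rat^o).
Proof. by move=> a f g; rewrite mcoeffD mcoeffZ. Qed.

Lemma malg_ext (M : lmodType rat) (u v : {malg rat[K]} -> M) :
  linear u -> linear v -> (forall k, u << k >> = v << k >>) -> u =1 v.
Proof.
move=> lu lv uv f; rewrite [f]malg_basis (lin_sum lu) (lin_sum lv).
by apply: eq_bigr => k _; rewrite (linZ lu) (linZ lv) uv.
Qed.

Variables (M : lmodType rat) (phi : K -> M).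

Definition linext f : M := \sum_(k <- msupp f) f@_k *: phi k.

Lemma linextEw (d : {fset K}) f : (msupp f `<=` d)%fset ->
  linext f = \sum_(k <- d) f@_k *: phi k.
Proof.
move=> fd; rewrite /linext (big_fset_incl _ fd) // => k _.
by rewrite -mcoeff_eq0 => /eqP->; rewrite scale0r.
Qed.

Lemma linext_is_linear : linear linext.
Proof.
move=> a f g; pose d := (msupp f `|` msupp g `|` msupp (a *: f + g))%fset.
rewrite !(@linextEw d); try by apply/fsubsetP => k kd; rewrite !inE kd ?orbT.
rewrite scaler_sumr -big_split /=; apply: eq_bigr => k _.
by rewrite mcoeffD mcoeffZ scalerDl scalerA.
Qed.

HB.instance Definition _ :=
  GRing.isLinear.Build rat {malg rat[K]} M _ linext linext_is_linear.

Lemma linextU k : linext << k >> = phi k.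
Proof.
by rewrite (linextEw (@msuppU_le _ _ k 1)) big_seq_fset1 mcoeffUU scale1r.
Qed.

End FreeModule.

(** * Tensor products *)

Section TensorMaps.

Lemma tensor_ext (V W X : lmodType rat) (u v : tensor V W -> X) :
  linear u -> linear v -> (forall x y, u (tens x y) = v (tens x y)) -> u =1 v.
Proof.
move=> lu lv uv; elim/quotW; elim=> [x y||s IHs t IHt|a s IHs].
- exact: uv.
- exact: etrans (lin0 lu) (esym (lin0 lv)).
- have E : \pi_(tensor V W) s + \pi_(tensor V W) t = \pi_(tensor V W) (TAdd s t).
    exact: (pi_add s t).
  by rewrite -E (linD lu) (linD lv) IHs IHt.
- have E : a *: \pi_(tensor V W) s = \pi_(tensor V W) (TScale a s).
    exact: (pi_scale a s).
  by rewrite -E (linZ lu) (linZ lv) IHs.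
Qed.

Lemma tens_bilinear (V W : lmodType rat) : bilinear_map (@tens V W).
Proof.
by split=> [v|w] a x y; rewrite (tensDl, tensDr) (tensZl, tensZr).
Qed.

Lemma bilin_comp (V W V' W' X : lmodType rat) (b : V' -> W' -> X)
    (f : V -> V') (g : W -> W') :
  bilinear_map b -> linear f -> linear g ->
  bilinear_map (fun x y => b (f x) (g y)).
Proof.
by move=> [br bl] lf lg; split=> [v|w] a x y; rewrite (lf, lg) (br, bl).
Qed.

Lemma bilin_post (V W X Y : lmodType rat) (b : V -> W -> X) (h : X -> Y) :
  bilinear_map b -> linear h -> bilinear_map (fun x y => h (b x y)).
Proof. by move=> [br bl] lh; split=> [v|w] a x y; rewrite (br, bl) lh. Qed.

Lemma tlift_sum (V W X : lmodType rat) (b : V -> W -> X) (I : Type)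
    (s : seq I) (P : pred I) (u : I -> V) (v : I -> W) : bilinear_map b ->
  tlift b (\sum_(i <- s | P i) tens (u i) (v i)) =
  \sum_(i <- s | P i) b (u i) (v i).
Proof.
move=> bb; rewrite (lin_sum (tlift_linear bb)).
by apply: eq_bigr => i _; rewrite tlift_tens.
Qed.

Lemma tens_suml (V W : lmodType rat) (I : Type) (s : seq I) (P : pred I)
    (u : I -> V) (w : W) :
  tens (\sum_(i <- s | P i) u i) w = \sum_(i <- s | P i) tens (u i) w.
Proof. exact: (lin_sum ((tens_bilinear V W).2 w)). Qed.

Lemma tens_sumr (V W : lmodType rat) (I : Type) (s : seq I) (P : pred I)
    (v : V) (u : I -> W) :
  tens v (\sum_(i <- s | P i) u i) = \sum_(i <- s | P i) tens v (u i).
Proof. exact: (lin_sum ((tens_bilinear V W).1 v)). Qed.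

Definition tmap (V W V' W' : lmodType rat) (f : V -> V') (g : W -> W') :
  tensor V W -> tensor V' W' := tlift (fun x y => tens (f x) (g y)).

Section Tmap.

Variables (V W V' W' X : lmodType rat) (f : V -> V') (g : W -> W').
Hypotheses (lf : linear f) (lg : linear g).

Lemma tmap_linear : linear (tmap f g).
Proof. exact/tlift_linear/(bilin_comp (tens_bilinear _ _)). Qed.

Lemma tmap_tens x y : tmap f g (tens x y) = tens (f x) (g y).
Proof. exact/tlift_tens/(bilin_comp (tens_bilinear _ _)). Qed.

Lemma tlift_tmap (b : V' -> W' -> X) (t : tensor V W) : bilinear_map b ->
  tlift b (tmap f g t) = tlift (fun x y => b (f x) (g y)) t.
Proof.
move=> bb; move: t; apply: tensor_ext => [||x y].
- exact: (lin_comp (tlift_linear bb) tmap_linear).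
- exact/tlift_linear/(bilin_comp bb).
- by rewrite tmap_tens !tlift_tens //; exact: bilin_comp.
Qed.

End Tmap.

Lemma tlift_post (V W X Y : lmodType rat) (b : V -> W -> X) (h : X -> Y)
    (t : tensor V W) : bilinear_map b -> linear h ->
  h (tlift b t) = tlift (fun x y => h (b x y)) t.
Proof.
move=> bb lh; move: t; apply: tensor_ext => [||x y].
- exact: (lin_comp lh (tlift_linear bb)).
- exact/tlift_linear/bilin_post.
- by rewrite !tlift_tens //; exact: bilin_post.
Qed.

Lemma eq_tlift (V W X : lmodType rat) (b c : V -> W -> X) (t : tensor V W) :
  (forall x y, b x y = c x y) -> tlift b t = tlift c t.
Proof.
by move=> bc; congr tlift; apply/funext => x; apply/funext => y; exact: bc.
Qed.

Section Tmul.

Variables (V : lmodType rat) (m : V -> V -> V).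
Hypothesis mm : bilinear_map m.

Let inner a b : bilinear_map (fun c d => tens (m a c) (m b d)).
Proof. exact: (bilin_comp (tens_bilinear _ _) (mm.1 a) (mm.1 b)). Qed.

Let outer y : bilinear_map
  (fun a b => tlift (fun c d => tens (m a c) (m b d)) y).
Proof.
split=> v; move: y.
- move=> y a x z; move: y; apply: tensor_ext => [||c d].
  + exact/tlift_linear/inner.
  + apply: lin_add; last exact/tlift_linear/inner.
    by move=> e s t; rewrite (tlift_linear (inner _ _)) scalerDr !scalerA mulrC.
  + rewrite !tlift_tens //.
    by rewrite (bilin_comp (tens_bilinear _ _) (mm.2 c) (mm.2 d)).1.
- move=> y a x z; move: y; apply: tensor_ext => [||c d].
  + exact/tlift_linear/inner.
  + apply: lin_add; last exact/tlift_linear/inner.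
    by move=> e s t; rewrite (tlift_linear (inner _ _)) scalerDr !scalerA mulrC.
  + rewrite !tlift_tens //.
    by rewrite (bilin_comp (tens_bilinear _ _) (mm.2 c) (mm.2 d)).2.
Qed.

Lemma tmul_bilinear : bilinear_map (tmul m).
Proof.
split=> [v|w]; last exact/tlift_linear/outer.
move: v => v a x y; move: v; apply: tensor_ext => [||c d].
- exact/tlift_linear/outer.
- apply: lin_add; last exact/tlift_linear/outer.
  by move=> e s t; rewrite /tmul (tlift_linear (outer _)) scalerDr !scalerA mulrC.
- by rewrite /tmul !tlift_tens // (tlift_linear (inner c d)).
Qed.

Lemma tmul_pure a b c d :
  tmul m (tens a b) (tens c d) = tens (m a c) (m b d).
Proof. by rewrite /tmul !tlift_tens. Qed.

End Tmul.

Lemma tassoc_inner (V : lmodType rat) (w : V) :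
  bilinear_map (fun u v : V => tens u (tens v w)).
Proof.
exact: (bilin_comp (tens_bilinear _ _) (@lin_id V) ((tens_bilinear V V).2 w)).
Qed.

Lemma tassoc_bilinear (V : lmodType rat) :
  bilinear_map (fun (t : tensor V V) (w : V) =>
    tlift (fun u v => tens u (tens v w)) t).
Proof.
split=> [v|w]; last exact/tlift_linear/tassoc_inner.
move=> a x y; move: v; apply: tensor_ext => [||c d].
- exact/tlift_linear/tassoc_inner.
- apply: lin_add; last exact/tlift_linear/tassoc_inner.
  move=> e s t; rewrite (tlift_linear (tassoc_inner _)) scalerDr !scalerA.
  by rewrite mulrC.
- rewrite !tlift_tens; try exact: tassoc_inner.
  by rewrite !(tensDr, tensZr).
Qed.

Lemma tassoc_linear (V : lmodType rat) : linear (@tassoc V).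
Proof. exact/tlift_linear/tassoc_bilinear. Qed.

Lemma tassoc_tens (V : lmodType rat) (u v w : V) :
  tassoc (tens (tens u v) w) = tens u (tens v w).
Proof.
rewrite /tassoc tlift_tens; last exact: tassoc_bilinear.
by rewrite tlift_tens //; exact: tassoc_inner.
Qed.

Lemma tassoc_tmap (V W : lmodType rat) (f : V -> W)
    (t : tensor (tensor V V) V) : linear f ->
  tassoc (tmap (tmap f f) f t) = tmap f (tmap f f) (tassoc t).
Proof.
move=> lf; have lff := tmap_linear lf lf.
move: t; apply: tensor_ext => [||s w].
- exact: (lin_comp (@tassoc_linear W) (tmap_linear lff lf)).
- exact: (lin_comp (tmap_linear lf lff) (@tassoc_linear V)).
- rewrite tmap_tens //; move: s; apply: tensor_ext => [||u v].
  + apply: (lin_comp (@tassoc_linear W)).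
    exact: (lin_comp ((tens_bilinear _ _).2 _) lff).
  + apply: (lin_comp (tmap_linear lf lff)).
    exact: (lin_comp (@tassoc_linear V) ((tens_bilinear _ _).2 _)).
  + by rewrite tassoc_tens !tmap_tens // tassoc_tens.
Qed.

Lemma tmul_tmap (V W : lmodType rat) (m : V -> V -> V) (m' : W -> W -> W)
    (f : V -> W) (s t : tensor V V) :
  bilinear_map m -> bilinear_map m' -> linear f ->
  (forall x y, f (m x y) = m' (f x) (f y)) ->
  tmap f f (tmul m s t) = tmul m' (tmap f f s) (tmap f f t).
Proof.
move=> bm bm' lf fM; have lff := tmap_linear lf lf.
move: s; apply: tensor_ext => [||a b].
- exact: (lin_comp lff ((tmul_bilinear bm).2 t)).
- exact: (lin_comp ((tmul_bilinear bm').2 _) lff).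
move: t; apply: tensor_ext => [||c d].
- exact: (lin_comp lff ((tmul_bilinear bm).1 _)).
- exact: (lin_comp ((tmul_bilinear bm').1 _) lff).
by rewrite !(tmul_pure, tmap_tens) // !fM.
Qed.

End TensorMaps.

Section HopfTransport.

Variables (V W : lmodType rat) (A : hopf_algebra V).
Variables (phi : {linear V -> W}) (psi : {linear W -> V}).
Hypotheses (phiK : cancel phi psi) (psiK : cancel psi phi).

Let lphi : linear phi. Proof. exact: linearP. Qed.
Let lpsi : linear psi. Proof. exact: linearP. Qed.
Let lff := tmap_linear lphi lphi.

Let m x y := phi (hmul A (psi x) (psi y)).
Let co x := tmap phi phi (comul A (psi x)).
Let eps x : rat := counit A (psi x).
Let S x := phi (antipode A (psi x)).

Let co_lin : linear co.
Proof.
move=> a x y; rewrite /co linearP linearP.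
exact: lff.
Qed.
Let eps_lin : scalar eps.
Proof. by move=> a x y; rewrite /eps !linearP. Qed.
Let S_lin : linear S.
Proof. by move=> a x y; rewrite /S !linearP. Qed.

HB.instance Definition _ := GRing.isLinear.Build rat W (tensor W W) _ co co_lin.
HB.instance Definition _ := GRing.isLinear.Build rat W rat _ eps eps_lin.
HB.instance Definition _ := GRing.isLinear.Build rat W W _ S S_lin.

Let mb : bilinear_map m.
Proof. exact: (bilin_post (bilin_comp (hmul_bilinear A) lpsi lpsi) lphi). Qed.

Let ab : bilinear_map (hmul A) := hmul_bilinear A.
Let tb := @tens_bilinear.
Let al : linear (antipode A). Proof. exact: linearP. Qed.
Let cl : linear (comul A). Proof. exact: linearP. Qed.
Let el : scalar (counit A). Proof. exact: linearP. Qed.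

(** This gives the enveloping algebra its Hopf structure, without a basis of the
    enveloping algebra. *)
Definition hopf_transport : hopf_algebra W.
Proof.
refine (@HopfAlgebra W m (phi (hone A)) co eps S mb _ _ _ _ _ _ _ _ _ _ _ _).
- by move=> x y z; rewrite /m !phiK hmulA.
- by move=> x; rewrite /m phiK hmul1l psiK.
- by move=> x; rewrite /m phiK hmul1r psiK.
- move=> x /=; have -> : co x = tmap phi phi (comul A (psi x)) by [].
  rewrite tlift_tmap //; last exact: (bilin_comp (tb _ _) co_lin (@lin_id _)).
  rewrite tlift_tmap //; last exact: (bilin_comp (tb _ _) (@lin_id _) co_lin).
  have E1 : bilinear_map (fun a b : V => tens (comul A a) b).
    exact: (bilin_comp (tb _ _) cl (@lin_id _)).
  have E2 : bilinear_map (fun a b : V => tens a (comul A b)).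
    exact: (bilin_comp (tb _ _) (@lin_id _) cl).
  transitivity (tassoc (tmap (tmap phi phi) phi
    (tlift (fun a b => tens (comul A a) b) (comul A (psi x))))).
    congr tassoc; rewrite (tlift_post _ E1 (tmap_linear lff lphi)).
    by apply: eq_tlift => a b; rewrite tmap_tens // /co phiK.
  rewrite tassoc_tmap // comulA (tlift_post _ E2 (tmap_linear lphi lff)).
  by apply: eq_tlift => a b; rewrite tmap_tens // /co phiK.
- move=> x /=; rewrite /co.
  have E a b : counit A (psi (phi a)) *: phi b = phi (counit A a *: b).
    by rewrite phiK linearZ.
  have B : bilinear_map (fun a b : V => counit A a *: b).
    split=> v a y z; first by rewrite scalerDr !scalerA mulrC.
    by rewrite el scalerDl scalerA.
  rewrite /eps tlift_tmap //; first under eq_tlift do rewrite E.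
    by rewrite -(tlift_post _ B lphi) counitl psiK.
  split=> v a y z; first by rewrite scalerDr !scalerA mulrC.
  by rewrite lpsi el scalerDl scalerA.
- move=> x /=; rewrite /co.
  have E a b : counit A (psi (phi b)) *: phi a = phi (counit A b *: a).
    by rewrite phiK linearZ.
  have B : bilinear_map (fun a b : V => counit A b *: a).
    split=> v a y z; last by rewrite scalerDr !scalerA mulrC.
    by rewrite el scalerDl scalerA.
  rewrite /eps tlift_tmap //; first under eq_tlift do rewrite E.
    by rewrite -(tlift_post _ B lphi) counitr psiK.
  split=> v a y z; last by rewrite scalerDr !scalerA mulrC.
  by rewrite lpsi el scalerDl scalerA.
- move=> x y /=; rewrite /co {1}/m phiK comulM.
  by apply: tmul_tmap => // a b; rewrite /m !phiK.
- by rewrite /= /co phiK comul1 tmap_tens.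
- by move=> x y /=; rewrite /eps /m phiK counitM.
- by rewrite /= /eps phiK counit1.
- move=> x /=; rewrite /co tlift_tmap //; last exact: (bilin_comp mb S_lin).
  have E a b : m (S (phi a)) (phi b) = phi (hmul A (antipode A a) b).
    by rewrite /m /S !phiK.
  under eq_tlift do rewrite E.
  rewrite -(tlift_post _ (bilin_comp ab al (@lin_id _)) lphi).
  by rewrite antipodel linearZ.
- move=> x /=; rewrite /co tlift_tmap //; last exact: (bilin_comp mb (@lin_id _)).
  have E a b : m (phi a) (S (phi b)) = phi (hmul A a (antipode A b)).
    by rewrite /m /S !phiK.
  under eq_tlift do rewrite E.
  rewrite -(tlift_post _ (bilin_comp ab (@lin_id _) al) lphi).
  by rewrite antipoder linearZ.
Defined.

Lemma hopf_transport_iso : hopf_isomorphic A hopf_transport.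
Proof.
exists phi; split=> [|x y||x|] /=; first by exists psi.
- by rewrite /m !phiK.
- by [].
- by rewrite /co phiK.
- by split=> x; rewrite /eps /S /= phiK.
Qed.

End HopfTransport.

Section TensorCoefficients.

Variable K : choiceType.
Let H := {malg rat[K]}.

Lemma tcoeff_bilinear a b :
  bilinear_map (fun f g : H => f@_a * g@_b : rat^o).
Proof.
by split=> [v|w]; [apply: lin_mull | apply: lin_mulr]; exact: mcoeff_linear.
Qed.

Lemma tcoeff_linear a b : linear (fun t : tensor H H => tcoeff t a b : rat^o).
Proof. exact/tlift_linear/tcoeff_bilinear. Qed.

Lemma tcoeff_tens (f g : H) a b : tcoeff (tens f g) a b = f@_a * g@_b.
Proof. exact/(tlift_tens (X := rat^o))/tcoeff_bilinear. Qed.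

Let pairing (f g : H) : {malg rat[(K * K)%type]} :=
  linext (fun a => linext (fun b => << (a, b) >>) g) f.

Let pairing_bilinear : bilinear_map pairing.
Proof.
split=> [v|w]; last exact: linext_is_linear.
move=> a x y; move: v; apply: malg_ext => [||k]; first exact: linext_is_linear.
  apply: lin_add; last exact: linext_is_linear.
  by move=> e s t; rewrite /pairing linearP scalerDr !scalerA mulrC.
by rewrite /pairing !linextU linearP.
Qed.

(** Taking the coefficients is a linear map to the functions of pairs. It has a
    left inverse, which sends the basis vector of a pair to the pure tensor of
    the two basis vectors. *)
Lemma tcoeff_inj (s t : tensor H H) :
  (forall a b, tcoeff s a b = tcoeff t a b) -> s = t.
Proof.
pose to := tlift pairing; have lto : linear to by exact: tlift_linear.
pose from := linext (fun p : K * K => tens (<< p.1 >> : H) (<< p.2 >> : H)).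
have toK : from \o to =1 id.
  apply: tensor_ext => [||f g]; [|exact: lin_id|].
    exact: (lin_comp (linext_is_linear _) lto).
  rewrite /= /to tlift_tens //.
  move: f; apply: malg_ext => [||a].
  - exact: (lin_comp (linext_is_linear _) (pairing_bilinear.2 g)).
  - exact: (tens_bilinear _ _).2.
  move: g; apply: malg_ext => [||b].
  - exact: (lin_comp (linext_is_linear _) (pairing_bilinear.1 _)).
  - exact: (tens_bilinear _ _).1.
  by rewrite /pairing !linextU /from linextU.
have toE u a b : (to u)@_(a, b) = tcoeff u a b.
  move: u; apply: (tensor_ext (X := rat^o)) => [||f g].
  - exact: (lin_comp (mcoeff_linear (a, b)) lto).
  - exact: tcoeff_linear.
  rewrite tcoeff_tens /to tlift_tens //.
  move: f; apply: (malg_ext (M := rat^o)) => [||k].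
  - exact: (lin_comp (mcoeff_linear (a, b)) (pairing_bilinear.2 g)).
  - exact/lin_mulr/mcoeff_linear.
  move: g; apply: (malg_ext (M := rat^o)) => [||l].
  - exact: (lin_comp (mcoeff_linear (a, b)) (pairing_bilinear.1 _)).
  - exact/lin_mull/mcoeff_linear.
  by rewrite /pairing !linextU !mcoeffU xpair_eqE -natrM mulnb.
move=> st; rewrite -[s]toK -[t]toK /=; congr from.
by apply/malgP => -[a b]; rewrite !toE.
Qed.

End TensorCoefficients.

(** * Hall algebras of graded commutative monoids *)

(** The elements are the isomorphism classes of the objects of a category,
    [hadd] is induced by the direct sum, and [hsub k] lists the pairs
    (class of A, class of M / A) for A running through the subobjects of an
    object M of class k. Identities between such lists hold up to reordering;
    they are expressed by sums of arbitrary test functions [F]. *)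
Record hall_monoid := HallMonoid {
  hcls :> choiceType;
  hadd : hcls -> hcls -> hcls;
  hzero : hcls;
  hdeg : hcls -> nat;
  hsub : hcls -> seq (hcls * hcls);
  haddA : associative hadd;
  haddC : commutative hadd;
  hadd0 : left_id hzero hadd;
  hdegD : forall a b, hdeg (hadd a b) = (hdeg a + hdeg b)%N;
  hdeg_eq0 : forall a, hdeg a = 0%N -> a = hzero;
  hsub_deg : forall k p, p \in hsub k -> (hdeg p.1 + hdeg p.2)%N = hdeg k;
  hsub_fin : forall a b, exists s : seq hcls,
    forall k, (a, b) \in hsub k -> k \in s;
  hsubA : forall k (F : hcls -> hcls -> hcls -> rat),
    \sum_(p <- hsub k) \sum_(q <- hsub p.1) F q.1 q.2 p.2 =
    \sum_(p <- hsub k) \sum_(q <- hsub p.2) F p.1 q.1 q.2;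
  hsub0l : forall k (F : hcls -> rat),
    \sum_(p <- hsub k | p.1 == hzero) F p.2 = F k;
  hsub0r : forall k (F : hcls -> rat),
    \sum_(p <- hsub k | p.2 == hzero) F p.1 = F k;
  hsubD : forall k l (F : hcls -> hcls -> rat),
    \sum_(p <- hsub (hadd k l)) F p.1 p.2 =
    \sum_(p <- hsub k) \sum_(q <- hsub l) F (hadd p.1 q.1) (hadd p.2 q.2)
}.

Section Decompositions.

Variable K : hall_monoid.
Implicit Types a b k : K.

Lemma hdeg0 : hdeg (hzero K) = 0%N.
Proof.
have := hdegD (hzero K) (hzero K); rewrite hadd0 => /eqP.
by rewrite -{1}[hdeg _]addn0 eqn_add2l eq_sym => /eqP.
Qed.

Lemma haddr0 : right_id (hzero K) (@hadd K).
Proof. by move=> a; rewrite haddC hadd0. Qed.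

Lemma hsub_zero k : (hzero K, k) \in hsub k.
Proof.
apply: contraT => /negP nk; have := hsub0l k (fun a => (a == k)%:R).
rewrite eqxx big1_seq => [/eqP|[a b] /= /andP[/eqP -> abk]].
  by rewrite eq_sym oner_eq0.
by case: eqP => // bk; rewrite bk in abk.
Qed.

Lemma hsub_full k : (k, hzero K) \in hsub k.
Proof.
apply: contraT => /negP nk; have := hsub0r k (fun a => (a == k)%:R).
rewrite eqxx big1_seq => [/eqP|[a b] /= /andP[/eqP -> abk]].
  by rewrite eq_sym oner_eq0.
by case: eqP => // bk; rewrite bk in abk.
Qed.

(** The summand [a] of [a + b] is a subobject whose quotient is [b]; this is
    where the finiteness of the decompositions comes from. *)
Lemma hsub_add a b : (a, b) \in hsub (hadd a b).
Proof.
apply: contraT => /negP nk.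
have := hsubD a b (fun x y => ((x, y) == (a, b))%:R).
rewrite big1_seq => [|[x y] /= xyk]; last first.
  by case: eqP => // -[xa yb]; rewrite xa yb in xyk.
move/esym => /eqP; rewrite psumr_eq0 => [/allP/(_ _ (hsub_full a))/= |p _].
  rewrite psumr_eq0 => [/allP/(_ _ (hsub_zero b))/= |p _]; last exact: ler0n.
  by rewrite haddr0 hadd0 eqxx oner_eq0.
by apply: sumr_ge0 => q _; exact: ler0n.
Qed.

Definition decomps k : seq (K * K) :=
  undup [seq p <- hsub k | hadd p.1 p.2 == k].

Lemma dec_uniq k : uniq (decomps k). Proof. exact: undup_uniq. Qed.

Lemma mem_dec k p : (p \in decomps k) = (hadd p.1 p.2 == k).
Proof.
rewrite mem_undup mem_filter andb_idr // => /eqP <-.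
by case: p => a b; exact: hsub_add.
Qed.

Lemma dec_deg k p : p \in decomps k -> (hdeg p.1 + hdeg p.2)%N = hdeg k.
Proof. by rewrite mem_dec => /eqP <-; rewrite hdegD. Qed.

Lemma dec_ltr k p : p \in decomps k -> p.1 != hzero K -> (hdeg p.2 < hdeg k)%N.
Proof.
move=> /dec_deg <- p0; rewrite -[X in (X < _)%N]add0n ltn_add2r lt0n.
by apply: contra p0 => /eqP/hdeg_eq0 ->.
Qed.

Lemma dec_ltl k p : p \in decomps k -> p.2 != hzero K -> (hdeg p.1 < hdeg k)%N.
Proof.
move=> /dec_deg <- p0; rewrite -[X in (X < _)%N]addn0 ltn_add2l lt0n.
by apply: contra p0 => /eqP/hdeg_eq0 ->.
Qed.

Section Sums.

Variable M : zmodType.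

Lemma decC k (F : K -> K -> M) :
  \sum_(p <- decomps k) F p.1 p.2 = \sum_(p <- decomps k) F p.2 p.1.
Proof.
rewrite -(big_map (fun p => (p.2, p.1)) xpredT (fun p => F p.1 p.2)) /=.
apply/perm_big/uniq_perm; rewrite ?map_inj_uniq ?dec_uniq //.
  by move=> [a b] [c d] /= [-> ->].
move=> [a b]; apply/idP/mapP => [|[[c d]]].
  by rewrite mem_dec haddC /= => ab; exists (b, a); rewrite ?mem_dec.
by rewrite !mem_dec haddC /= => h [-> ->].
Qed.

Lemma decA k (F : K -> K -> K -> M) :
  \sum_(p <- decomps k) \sum_(q <- decomps p.1) F q.1 q.2 p.2 =
  \sum_(p <- decomps k) \sum_(q <- decomps p.2) F p.1 q.1 q.2.
Proof.
pose l (p q : K * K) := (q.1, q.2, p.2); pose r (p q : K * K) := (p.1, q.1, q.2).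
pose G (t : K * K * K) := F t.1.1 t.1.2 t.2.
rewrite -(big_allpairs_dep (h := l) (F := G)) -(big_allpairs_dep (h := r) (F := G)).
apply/perm_big/uniq_perm.
- apply: allpairs_uniq_dep => [|p _|t t']; try exact: dec_uniq.
  move=> /allpairsPdep[p [q [_ hq ->]]] /allpairsPdep[p' [q' [_ hq' ->]]] /=.
  move=> [e1 e2 e3]; move: hq hq'; rewrite !mem_dec.
  case: p q p' q' e1 e2 e3 => [? ?] [? ?] [? ?] [? ?] /= -> -> ->.
  by move=> /eqP <- /eqP <-.
- apply: allpairs_uniq_dep => [|p _|t t']; try exact: dec_uniq.
  move=> /allpairsPdep[p [q [_ hq ->]]] /allpairsPdep[p' [q' [_ hq' ->]]] /=.
  move=> [e1 e2 e3]; move: hq hq'; rewrite !mem_dec.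
  case: p q p' q' e1 e2 e3 => [? ?] [? ?] [? ?] [? ?] /= -> -> ->.
  by move=> /eqP <- /eqP <-.
- move=> [[a b] c]; apply/allpairsPdep/allpairsPdep => -[p [q]].
  + rewrite !mem_dec => -[/eqP hp /eqP hq [-> -> ->]].
    by exists (q.1, hadd q.2 p.2), (q.2, p.2); rewrite !mem_dec /= haddA hq hp.
  + rewrite !mem_dec => -[/eqP hp /eqP hq [-> -> ->]].
    by exists (hadd p.1 q.1, q.2), (p.1, q.1); rewrite !mem_dec /= -haddA hq hp.
Qed.

Lemma dec0l k (F : K -> K -> M) :
  \sum_(p <- decomps k | p.1 == hzero K) F p.1 p.2 = F (hzero K) k.
Proof.
rewrite big_mkcond (bigD1_seq (hzero K, k)) ?dec_uniq ?mem_dec ?hadd0 //=.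
rewrite eqxx big1_seq ?addr0 // => -[a b] /= /andP[+ +].
have [->|//] := eqVneq a (hzero K); rewrite mem_dec /= hadd0 => nk /eqP bk.
by rewrite bk eqxx in nk.
Qed.

Lemma dec0r k (F : K -> K -> M) :
  \sum_(p <- decomps k | p.2 == hzero K) F p.1 p.2 = F k (hzero K).
Proof.
rewrite big_mkcond (decC k (fun a b => if b == hzero K then F a b else 0)) /=.
by rewrite -big_mkcond (dec0l k (fun a b => F b a)).
Qed.

End Sums.

(** Once the step has been iterated more often than the degree of an element,
    further iterations do not change the value at that element. *)
Lemma deg_rec (T : Type) (t0 : T) (step : (K -> T) -> K -> T) :
  (forall X X' k, (forall b, (hdeg b < hdeg k)%N -> X b = X' b) ->
     step X k = step X' k) ->
  exists X : K -> T, forall k, X k = step X k.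
Proof.
move=> stepE.
pose X := fix X n := if n is m.+1 then step (X m) else fun _ : K => t0.
have XE : forall m n k, (hdeg k < m)%N -> (hdeg k < n)%N -> X m k = X n k.
  elim=> // m IH [|n] k //= km kn; apply: stepE => b bk.
  by apply: IH; [exact: leq_trans bk km | exact: leq_trans bk kn].
exists (fun k => X (hdeg k).+1 k) => k.
by apply: (stepE (X (hdeg k))) => b bk; exact: XE bk (ltnSn _).
Qed.

Section Convolution.

Variables (M : zmodType) (act : K -> M -> M).
Hypothesis act0 : forall x, act (hzero K) x = x.

Let dec_split k (X : K -> M) : \sum_(p <- decomps k) act p.1 (X p.2) =
  X k + \sum_(p <- decomps k | p.1 != hzero K) act p.1 (X p.2).
Proof.
rewrite (bigID (fun p => p.1 == hzero K)) /=; congr (_ + _).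
by rewrite (dec0l k (fun a b => act a (X b))) act0.
Qed.

(** Elements of positive degree only perturb the identity by terms of
    lower degree, so that a convolution equation can be solved for its second
    factor by recursion on the degree, and in only one way. *)
Lemma conv_solve (Y : K -> M) : exists X : K -> M,
  forall k, \sum_(p <- decomps k) act p.1 (X p.2) = Y k.
Proof.
have [|X XE] := @deg_rec M 0 (fun X k => Y k -
    \sum_(p <- decomps k | p.1 != hzero K) act p.1 (X p.2)).
  move=> X X' k XX'; congr (_ - _); rewrite big_seq_cond [RHS]big_seq_cond.
  by apply: eq_bigr => p /andP[pk p0]; rewrite XX' // dec_ltr.
by exists X => k; rewrite dec_split [X k]XE addrNK.
Qed.

Lemma conv_inj (X X' : K -> M) :
  (forall k, \sum_(p <- decomps k) act p.1 (X p.2) =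
             \sum_(p <- decomps k) act p.1 (X' p.2)) -> X =1 X'.
Proof.
move=> XX' k; have [n] := ubnP (hdeg k); elim: n k => // n IH k kn.
have := XX' k; rewrite !dec_split; set s := (X in _ + X = _).
have -> : s = \sum_(p <- decomps k | p.1 != hzero K) act p.1 (X' p.2).
  rewrite /s big_seq_cond [RHS]big_seq_cond.
  apply: eq_bigr => p /andP[pk p0]; rewrite IH //.
  exact: leq_trans (dec_ltr pk p0) kn.
by move/addIr.
Qed.

End Convolution.

End Decompositions.

(** * The Hopf algebra of finitely supported functions *)

Definition hall (K : hall_monoid) := {malg rat[K]}.
HB.instance Definition _ (K : hall_monoid) :=
  GRing.Lmodule.copy (hall K) {malg rat[K]}.

Section HallRing.

Variable K : hall_monoid.
Implicit Types (f g h : hall K) (k : K).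

Let candidates (f g : hall K) : {fset K} :=
  [fset k in flatten [seq projT1 (cid (hsub_fin a b)) |
     a <- msupp f, b <- msupp g]]%fset.

(** Only finitely many classes have a subobject in the support of [f] with
    quotient in the support of [g], so that the product has finite support. *)
Definition hall_mul f g : hall K :=
  [malg k in candidates f g => \sum_(p <- hsub k) f@_p.1 * g@_p.2].

Lemma hall_mulE f g k :
  (hall_mul f g)@_k = \sum_(p <- hsub k) f@_p.1 * g@_p.2.
Proof.
rewrite mcoeffE; case: ifP => // /negP nk.
rewrite big1_seq // => -[a b] /= abk.
have [fa|/mcoeff_outdom ->] := boolP (a \in msupp f); last by rewrite mul0r.
have [gb|/mcoeff_outdom ->] := boolP (b \in msupp g); last by rewrite mulr0.
case: nk; rewrite inE; apply/flattenP.
exists (projT1 (cid (hsub_fin a b))); first exact: allpairs_f.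
by case: cid => s /= hs; exact: hs.
Qed.

Definition hall_one : hall K := << hzero K >>.

Lemma hall_mulA : associative hall_mul.
Proof.
move=> f g h; apply/malgP => k; rewrite !hall_mulE.
under eq_bigr do rewrite hall_mulE mulr_sumr.
under [RHS]eq_bigr do rewrite hall_mulE mulr_suml.
rewrite (hsubA k (fun a b c => f@_a * g@_b * h@_c)).
by apply: eq_bigr => p _; apply: eq_bigr => q _; rewrite mulrA.
Qed.

Lemma hall_mul1l : left_id hall_one hall_mul.
Proof.
move=> f; apply/malgP => k; rewrite hall_mulE -[RHS](hsub0l k (fun a => f@_a)).
rewrite [RHS]big_mkcond; apply: eq_bigr => p _.
by rewrite mcoeffU eq_sym; case: eqP => _; rewrite ?mul1r ?mul0r.
Qed.

Lemma hall_mul1r : right_id hall_one hall_mul.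
Proof.
move=> f; apply/malgP => k; rewrite hall_mulE -[RHS](hsub0r k (fun a => f@_a)).
rewrite [RHS]big_mkcond; apply: eq_bigr => p _.
by rewrite mcoeffU eq_sym; case: eqP => _; rewrite ?mulr1 ?mulr0.
Qed.

Lemma hall_mulDl : left_distributive hall_mul +%R.
Proof.
move=> f g h; apply/malgP => k; rewrite mcoeffD !hall_mulE -big_split /=.
by apply: eq_bigr => p _; rewrite mcoeffD mulrDl.
Qed.

Lemma hall_mulDr : right_distributive hall_mul +%R.
Proof.
move=> f g h; apply/malgP => k; rewrite mcoeffD !hall_mulE -big_split /=.
by apply: eq_bigr => p _; rewrite mcoeffD mulrDr.
Qed.

Lemma hall_oner_neq0 : hall_one != 0.
Proof. by rewrite monalgU_eq0 oner_eq0. Qed.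

HB.instance Definition _ := GRing.Zmodule_isNzRing.Build (hall K)
  hall_mulA hall_mul1l hall_mul1r hall_mulDl hall_mulDr hall_oner_neq0.

Lemma hall_scaleAl (a : rat) f g : a *: (f * g) = (a *: f) * g.
Proof.
apply/malgP => k; rewrite mcoeffZ !hall_mulE mulr_sumr.
by apply: eq_bigr => p _; rewrite mcoeffZ mulrA.
Qed.

HB.instance Definition _ :=
  GRing.Lmodule_isLalgebra.Build rat (hall K) hall_scaleAl.

Lemma hall_scaleAr (a : rat) f g : a *: (f * g) = f * (a *: g).
Proof.
apply/malgP => k; rewrite mcoeffZ !hall_mulE mulr_sumr.
by apply: eq_bigr => p _; rewrite mcoeffZ mulrCA.
Qed.

HB.instance Definition _ :=
  GRing.Lalgebra_isAlgebra.Build rat (hall K) hall_scaleAr.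

Lemma hall_bilinear : bilinear_map (fun f g => f * g).
Proof.
split=> v a x y; first by rewrite mulrDr scalerAr.
by rewrite mulrDl scalerAl.
Qed.

End HallRing.

Section HallHopf.

Variable K : hall_monoid.
Local Notation H := (hall K).
Local Notation e := (hzero K).
Implicit Types (f g h : H) (a b k : K).

Definition delta k : H := << k >>.

Lemma delta0 : delta e = 1. Proof. by []. Qed.

Definition hall_comul : {linear H -> tensor H H} :=
  linext (fun k => \sum_(p <- decomps k) tens (delta p.1) (delta p.2)).

Lemma hall_comulU k :
  hall_comul (delta k) = \sum_(p <- decomps k) tens (delta p.1) (delta p.2).
Proof. exact: linextU. Qed.

Lemma hall_comulE f a b : tcoeff (hall_comul f) a b = f@_(hadd a b).
Proof.
move: f; apply: (malg_ext (M := rat^o)) => [||k].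
- exact: (lin_comp (tcoeff_linear a b) (linearP hall_comul)).
- exact: mcoeff_linear.
rewrite -/(delta k) hall_comulU (lin_sum (tcoeff_linear a b)).
under eq_bigr do rewrite tcoeff_tens !mcoeffU -natrM mulnb.
rewrite mcoeffU; have [->|nk] := eqVneq k (hadd a b).
  rewrite (bigD1_seq (a, b)) ?dec_uniq ?mem_dec ?eqxx //= addrC big1 ?add0r //.
  by move=> [c d]; rewrite xpair_eqE /= => /negPf ->.
rewrite big1_seq // => -[c d]; rewrite mem_dec /= => /eqP cd.
by case: eqP => //= ca; case: eqP => //= db; rewrite -cd ca db eqxx in nk.
Qed.

Lemma tmul_coeff (s t : tensor H H) a b :
  tcoeff (tmul (fun f g => f * g) s t) a b =
  \sum_(p <- hsub a) \sum_(q <- hsub b) tcoeff s p.1 q.1 * tcoeff t p.2 q.2.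
Proof.
have tb := tmul_bilinear (@hall_bilinear K).
move: s; apply: (tensor_ext (X := rat^o)) => [||f f'].
- exact: (lin_comp (tcoeff_linear a b) (tb.2 t)).
- apply: lin_bigsum => p; apply: lin_bigsum => q.
  exact/lin_mulr/tcoeff_linear.
move: t; apply: (tensor_ext (X := rat^o)) => [||g g'].
- exact: (lin_comp (tcoeff_linear a b) (tb.1 _)).
- apply: lin_bigsum => p; apply: lin_bigsum => q.
  exact/lin_mull/tcoeff_linear.
rewrite (tmul_pure (@hall_bilinear K)) tcoeff_tens !hall_mulE mulr_suml.
apply: eq_bigr => p _; rewrite mulr_sumr; apply: eq_bigr => q _.
by rewrite !tcoeff_tens mulrACA.
Qed.

Lemma hall_comulM f g :
  hall_comul (f * g) = tmul (fun f g => f * g) (hall_comul f) (hall_comul g).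
Proof.
apply: tcoeff_inj => a b; rewrite tmul_coeff hall_comulE hall_mulE.
rewrite (hsubD a b (fun x y => f@_x * g@_y)).
by apply: eq_bigr => p _; apply: eq_bigr => q _; rewrite !hall_comulE.
Qed.

Definition hall_counit f : rat := f@_e.

Lemma hall_counit_linear : scalar hall_counit.
Proof. exact: mcoeff_linear. Qed.
HB.instance Definition _ :=
  GRing.isLinear.Build rat H rat _ hall_counit hall_counit_linear.

Lemma hall_counitU k : hall_counit (delta k) = (k == e)%:R.
Proof. exact: mcoeffU. Qed.

Let antipode_exists :
  exists X : K -> H, forall k, \sum_(p <- decomps k) delta p.1 * X p.2 = (k == e)%:R.
Proof.
by apply: (conv_solve (act := fun a x => delta a * x)) => x; rewrite mul1r.
Qed.

Definition hall_antipode : {linear H -> H} := linext (projT1 (cid antipode_exists)).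

Lemma hall_antipoder k :
  \sum_(p <- decomps k) delta p.1 * hall_antipode (delta p.2) = (k == e)%:R.
Proof.
have SE a : hall_antipode (delta a) = projT1 (cid antipode_exists) a.
  exact: linextU.
by under eq_bigr do rewrite SE; case: cid => X /=.
Qed.

(** A right convolution inverse of the identity is also a left inverse,
    because the identity can be cancelled on the left. *)
Lemma hall_antipodel k :
  \sum_(p <- decomps k) hall_antipode (delta p.1) * delta p.2 = (k == e)%:R.
Proof.
move: k; apply: (@conv_inj K H (fun a x => delta a * x)) => [x|k].
  exact: mul1r.
transitivity (delta k).
  under eq_bigr do rewrite mulr_sumr.
  rewrite -(decA k (fun a b c => delta a * (hall_antipode (delta b) * delta c))).
  under eq_bigr => p _.
    under eq_bigr do rewrite mulrA.
    by rewrite -mulr_suml hall_antipoder; over.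
  rewrite -[RHS](dec0l k (fun a b => delta b)) [RHS]big_mkcond.
  by apply: eq_bigr => p _; case: eqP; rewrite ?mul1r ?mul0r.
rewrite -[LHS](dec0r k (fun a b => delta a)) [LHS]big_mkcond.
by apply: eq_bigr => p _; case: eqP; rewrite ?mulr1 ?mulr0.
Qed.

Let tb := @tens_bilinear.
Let Cl : linear hall_comul. Proof. exact: linearP. Qed.
Let Sl : linear hall_antipode. Proof. exact: linearP. Qed.

Lemma hall_comulA f :
  tassoc (tlift (fun a b : H => tens (hall_comul a) b) (hall_comul f)) =
  tlift (fun a b : H => tens a (hall_comul b)) (hall_comul f).
Proof.
have B1 : bilinear_map (fun a b : H => tens (hall_comul a) b).
  exact: (bilin_comp (tb _ _) Cl (@lin_id _)).
have B2 : bilinear_map (fun a b : H => tens a (hall_comul b)).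
  exact: (bilin_comp (tb _ _) (@lin_id _) Cl).
move: f; apply: malg_ext => [||k].
- exact: (lin_comp (@tassoc_linear H) (lin_comp (tlift_linear B1) Cl)).
- exact: (lin_comp (tlift_linear B2) Cl).
rewrite -/(delta k) hall_comulU !tlift_sum // (lin_sum (@tassoc_linear H)).
under eq_bigr => p _.
  rewrite hall_comulU tens_suml (lin_sum (@tassoc_linear H)).
  by under eq_bigr do rewrite tassoc_tens; over.
rewrite (decA k (fun a b c => tens (delta a) (tens (delta b) (delta c)))).
by apply: eq_bigr => p _; rewrite hall_comulU tens_sumr.
Qed.

Let counitl_bilinear :
  bilinear_map (fun a b : H => hall_counit a *: b).
Proof.
split=> v a x y; first by rewrite scalerDr !scalerA mulrC.
by rewrite hall_counit_linear scalerDl scalerA.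
Qed.

Let counitr_bilinear :
  bilinear_map (fun a b : H => hall_counit b *: a).
Proof.
split=> v a x y; last by rewrite scalerDr !scalerA mulrC.
by rewrite hall_counit_linear scalerDl scalerA.
Qed.

Lemma hall_counitl f :
  tlift (fun a b : H => hall_counit a *: b) (hall_comul f) = f.
Proof.
move: f; apply: malg_ext => [||k]; last 1 first.
- rewrite -/(delta k) hall_comulU tlift_sum //.
  rewrite -[RHS](dec0l k (fun a b => delta b)) [RHS]big_mkcond.
  apply: eq_bigr => p _; rewrite hall_counitU.
  by case: eqP; rewrite ?scale1r ?scale0r.
- exact: (lin_comp (tlift_linear counitl_bilinear) Cl).
- exact: lin_id.
Qed.

Lemma hall_counitr f :
  tlift (fun a b : H => hall_counit b *: a) (hall_comul f) = f.
Proof.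
move: f; apply: malg_ext => [||k]; last 1 first.
- rewrite -/(delta k) hall_comulU tlift_sum //.
  rewrite -[RHS](dec0r k (fun a b => delta a)) [RHS]big_mkcond.
  apply: eq_bigr => p _; rewrite hall_counitU.
  by case: eqP; rewrite ?scale1r ?scale0r.
- exact: (lin_comp (tlift_linear counitr_bilinear) Cl).
- exact: lin_id.
Qed.

Let mb := @hall_bilinear K.

Let counit1_linear : linear (fun f : H => hall_counit f *: (1 : H)).
Proof. by move=> a x y; rewrite hall_counit_linear scalerDl scalerA. Qed.

Lemma hall_antipode_left f :
  tlift (fun a b : H => hall_antipode a * b) (hall_comul f) =
  hall_counit f *: 1.
Proof.
have B := bilin_comp mb Sl (@lin_id H).
move: f; apply: malg_ext => [||k]; last 1 first.
- rewrite -/(delta k) hall_comulU tlift_sum // hall_antipodel hall_counitU.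
  by case: eqP; rewrite ?scale1r ?scale0r.
- exact: (lin_comp (tlift_linear B) Cl).
- exact: counit1_linear.
Qed.

Lemma hall_antipode_right f :
  tlift (fun a b : H => a * hall_antipode b) (hall_comul f) =
  hall_counit f *: 1.
Proof.
have B := bilin_comp mb (@lin_id H) Sl.
move: f; apply: malg_ext => [||k]; last 1 first.
- rewrite -/(delta k) hall_comulU tlift_sum // hall_antipoder hall_counitU.
  by case: eqP; rewrite ?scale1r ?scale0r.
- exact: (lin_comp (tlift_linear B) Cl).
- exact: counit1_linear.
Qed.

Lemma dec_zero : decomps e = [:: (e, e)].
Proof.
apply: perm_small_eq => //; apply: uniq_perm; rewrite ?dec_uniq //.
move=> [a b]; rewrite mem_dec inE /=; apply/eqP/eqP => [ab|[-> ->]]; last first.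
  exact: hadd0.
have := congr1 (@hdeg K) ab; rewrite hdegD hdeg0 => /eqP.
by rewrite addn_eq0 => /andP[/eqP/hdeg_eq0 -> /eqP/hdeg_eq0 ->].
Qed.

Lemma hall_comul1 : hall_comul 1 = tens 1 1.
Proof. by rewrite -delta0 hall_comulU dec_zero big_seq1. Qed.

Lemma sum_hsub_zero : forall F : K -> K -> rat,
  \sum_(p <- hsub e) F p.1 p.2 = F e e.
Proof.
move=> F; rewrite -[RHS](hsub0l e (F e)) [RHS]big_mkcond.
rewrite big_seq [RHS]big_seq; apply: eq_bigr => p /hsub_deg.
rewrite hdeg0 => /eqP; rewrite addn_eq0 => /andP[/eqP/hdeg_eq0 -> _].
by rewrite eqxx.
Qed.

Lemma hall_counitM f g : hall_counit (f * g) = hall_counit f * hall_counit g.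
Proof.
by rewrite /hall_counit hall_mulE (sum_hsub_zero (fun a b => f@_a * g@_b)).
Qed.

Lemma hall_counit1 : hall_counit 1 = 1.
Proof. by rewrite -delta0 hall_counitU eqxx. Qed.

Definition hall_hopf : hopf_algebra H :=
  @HopfAlgebra H (fun f g => f * g) 1 hall_comul hall_counit hall_antipode mb
    (@mulrA H) (@mul1r H) (@mulr1 H) hall_comulA hall_counitl hall_counitr
    hall_comulM hall_comul1 hall_counitM hall_counit1
    hall_antipode_left hall_antipode_right.

End HallHopf.

(** * The grading *)

Section HallGrading.

Variable K : hall_monoid.
Local Notation H := (hall K).
Local Notation e := (hzero K).
Implicit Types (f g : H) (a b k : K).

Definition hall_component n f : Prop := forall k, f@_k <> 0 -> hdeg k = n.
Local Notation G := hall_component.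

Lemma hall_component_submod n :
  G n 0 /\ forall (a : rat) f g, G n f -> G n g -> G n (a *: f + g).
Proof.
split=> [k|a f g Gf Gg k]; first by rewrite mcoeff0.
rewrite mcoeffD mcoeffZ.
have [f0|f0 _] := eqVneq f@_k 0; last exact/Gf/eqP.
by rewrite f0 mulr0 add0r; exact: Gg.
Qed.

Lemma hall_component_sum n (I : eqType) (s : seq I) (P : pred I) (F : I -> H) :
  (forall i, i \in s -> P i -> G n (F i)) -> G n (\sum_(i <- s | P i) F i).
Proof.
move=> GF; rewrite big_seq_cond.
apply: (big_ind (G n)) => [|f g Gf Gg|i /andP[]]; last exact: GF.
  exact: (hall_component_submod n).1.
by rewrite -[f]scale1r; exact: (hall_component_submod n).2.
Qed.

Lemma hall_componentZ n (a : rat) f : G n f -> G n (a *: f).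
Proof.
move=> Gf; rewrite -[_ *: _]addr0.
by apply: (hall_component_submod n).2 => //; exact: (hall_component_submod n).1.
Qed.

Lemma delta_component k : G (hdeg k) (delta k).
Proof. by move=> l; rewrite mcoeffU; case: eqP => // ->. Qed.

Lemma hall_component_mul m n f g : G m f -> G n g -> G (m + n) (f * g).
Proof.
move=> Gf Gg k; rewrite hall_mulE => s0; apply: contra_notP s0 => kmn.
rewrite big1_seq // => p /hsub_deg kp.
have [->|/eqP/Gf fp] := eqVneq f@_p.1 0; first by rewrite mul0r.
have [->|/eqP/Gg gp] := eqVneq g@_p.2 0; first by rewrite mulr0.
by case: kmn; rewrite -kp fp gp.
Qed.

Lemma hall_component0 f : G 0 f <-> exists a : rat, f = a *: 1.
Proof.
split=> [Gf|[a ->]]; last first.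
  by apply: hall_componentZ; rewrite -(hdeg0 K); exact: delta_component.
exists f@_e; apply/malgP => k; rewrite mcoeffZ -delta0 mcoeffU.
have [<-|ke] := eqVneq e k; first by rewrite mulr1.
rewrite mulr0; apply: contraNeq ke => fk.
by rewrite eq_sym; apply/eqP/hdeg_eq0/Gf/eqP.
Qed.

Lemma hall_component_counit n f : G n f -> n <> 0%N -> hall_counit f = 0.
Proof.
move=> Gf n0; apply: contra_notP n0 => /eqP fe.
by rewrite -(Gf e) ?hdeg0 //; exact/eqP.
Qed.

Lemma hall_component_antipode n f : G n f -> G n (hall_antipode K f).
Proof.
have SG k : G (hdeg k) (hall_antipode K (delta k)).
  have [m] := ubnP (hdeg k); elim: m k => // m IH k km.
  have := hall_antipoder k; rewrite (bigID (fun p => p.1 == e)) /=.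
  rewrite (dec0l k (fun a b => delta a * hall_antipode K (delta b))) mul1r.
  move/(canRL (addrK _)) => ->; rewrite addrC -scaleN1r.
  apply: (hall_component_submod _).2.
    rewrite big_seq_cond; apply: hall_component_sum => p _ /andP[pk p0].
    rewrite -(dec_deg pk); apply: hall_component_mul; first exact: delta_component.
    by apply: IH; exact: leq_trans (dec_ltr pk p0) km.
  case: eqP => [->|_]; first exact: delta_component.
  exact: (hall_component_submod _).1.
move=> Gf; rewrite [f]malg_basis linear_sum; apply: hall_component_sum => k kf _.
rewrite linearZ; apply: hall_componentZ; rewrite -(Gf k); first exact: SG.
by apply/eqP; rewrite mcoeff_neq0.
Qed.

Lemma hall_component_decomposition f : exists N (c : nat -> H),
  (forall n, G n (c n)) /\ f = \sum_(n < N) c n.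
Proof.
pose c n : H := [malg k in msupp f => if hdeg k == n then f@_k else 0].
have cE n k : (c n)@_k = if hdeg k == n then f@_k else 0.
  rewrite mcoeffE; case: ifPn => // /mcoeff_outdom ->.
  by rewrite if_same.
pose N := (\max_(k <- msupp f) hdeg k).+1.
exists N, c; split=> [n k|]; first by rewrite cE; case: eqP.
apply/malgP => k; rewrite raddf_sum /=; under eq_bigr do rewrite cE.
have [kf|/mcoeff_outdom f0] := boolP (k \in msupp f); last first.
  by rewrite big1 // => i _; rewrite f0 if_same.
have kN : (hdeg k < N)%N by rewrite ltnS (big_rem k) //= leq_maxl.
rewrite (bigD1 (Ordinal kN)) //= eqxx big1 ?addr0 // => i ik.
by case: eqP => // ki; case/eqP: ik; apply/val_inj.
Qed.

Lemma hall_component_independent N (c : nat -> H) :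
  (forall n, G n (c n)) -> \sum_(n < N) c n = 0 ->
  forall n, (n < N)%N -> c n = 0.
Proof.
move=> Gc s0 n nN; apply/malgP => k; rewrite mcoeff0.
have [kn|] := eqVneq (hdeg k) n; last first.
  by apply: contra_neqP => /Gc.
have := congr1 (mcoeff k) s0; rewrite raddf_sum /= mcoeff0 => <-.
rewrite (bigD1 (Ordinal nN)) //= big1 ?addr0 // => i.
by apply: contra_neqP => /Gc ki; apply/val_inj; rewrite /= -ki.
Qed.

Lemma hall_component_comul n f : G n f -> exists s : seq (H * H),
  hall_comul K f = \sum_(p <- s) tens p.1 p.2 /\
  forall p, p \in s -> exists i j, [/\ (i + j)%N = n, G i p.1 & G j p.2].
Proof.
move=> Gf.
exists [seq (f@_k *: delta p.1, delta p.2) | k <- msupp f, p <- decomps k]; split.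
  rewrite big_allpairs_dep /= {1}[f]malg_basis linear_sum.
  apply: eq_bigr => k _; rewrite linearZ /= hall_comulU scaler_sumr.
  by apply: eq_bigr => p _; rewrite tensZl.
move=> _ /allpairsPdep[k [p [kf pk ->]]] /=.
exists (hdeg p.1), (hdeg p.2); split; last exact: delta_component.
  by rewrite (dec_deg pk) (Gf k) //; apply/eqP; rewrite mcoeff_neq0.
exact/hall_componentZ/delta_component.
Qed.

Lemma hall_connected_grading : connected_grading (hall_hopf K) hall_component.
Proof.
split; last exact: hall_component0.
split.
- exact: hall_component_submod.
- exact: hall_component_decomposition.
- exact: hall_component_independent.
split.
- by rewrite -(hdeg0 K); exact: delta_component.
- exact: hall_component_mul.
- exact: hall_component_comul.
- exact: hall_component_counit.
- exact: hall_component_antipode.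
Qed.

End HallGrading.

(** * Enveloping algebras *)

Section EnvelopingRing.

Variable L : lie_algebra.
Local Notation U := (env L).

Lemma env_mulA : associative (@env_mul L).
Proof.
elim/quotW=> s; elim/quotW=> t; elim/quotW=> u.
by rewrite (pi_env_mul t u) (pi_env_mul s t) !pi_env_mul; exact/env_eq/ueq_mulA.
Qed.

Lemma env_mul1l : left_id (@env_one L) (@env_mul L).
Proof. by elim/quotW=> s; rewrite pi_env_mul; exact/env_eq/ueq_mul1l. Qed.

Lemma env_mul1r : right_id (@env_one L) (@env_mul L).
Proof. by elim/quotW=> s; rewrite pi_env_mul; exact/env_eq/ueq_mul1r. Qed.

Lemma env_piD (s t : uterm L) :
  \pi_(env L) (UAdd s t) = \pi_(env L) s + \pi_(env L) t.
Proof. exact/esym/(pi_env_add s t). Qed.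

Lemma env_piZ a (s : uterm L) : \pi_(env L) (UScale a s) = a *: \pi_(env L) s.
Proof. exact/esym/(pi_env_scale a s). Qed.

Lemma env_mulDl : left_distributive (@env_mul L) +%R.
Proof.
elim/quotW=> s; elim/quotW=> t; elim/quotW=> u.
rewrite -env_piD !pi_env_mul -env_piD; exact/env_eq/ueq_mulDl.
Qed.

Lemma env_mulDr : right_distributive (@env_mul L) +%R.
Proof.
elim/quotW=> s; elim/quotW=> t; elim/quotW=> u.
rewrite -env_piD !pi_env_mul -env_piD; exact/env_eq/ueq_mulDr.
Qed.

HB.instance Definition _ := GRing.Zmodule_isPzRing.Build U
  env_mulA env_mul1l env_mul1r env_mulDl env_mulDr.

Lemma env_piM (s t : uterm L) :
  \pi_(env L) (UMul s t) = \pi_(env L) s * \pi_(env L) t.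
Proof. exact/esym/(pi_env_mul s t). Qed.

Lemma env_mulZl a (x y : U) : (a *: x) * y = a *: (x * y).
Proof.
elim/quotW: x => s; elim/quotW: y => t.
by rewrite -env_piZ -!env_piM -env_piZ; exact/env_eq/ueq_scaleAl.
Qed.

Lemma env_mulZr a (x y : U) : x * (a *: y) = a *: (x * y).
Proof.
elim/quotW: x => s; elim/quotW: y => t.
by rewrite -env_piZ -!env_piM -env_piZ; exact/env_eq/ueq_scaleAr.
Qed.

Lemma env_bilinear : bilinear_map (fun x y : U => x * y).
Proof.
by split=> v a x y; rewrite (mulrDr, mulrDl) (env_mulZr, env_mulZl).
Qed.

Lemma env_gen_linear : linear (@env_gen L).
Proof.
move=> a x y; rewrite /env_gen -env_piZ -env_piD; apply: env_eq.
apply: ueq_trans (ueq_genD _ _) _.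
exact: ueq_add (ueq_genZ _ _) (ueq_refl _).
Qed.

Lemma env_gen_bracket (x y : L) :
  env_gen (lie_bracket x y) = env_gen x * env_gen y - env_gen y * env_gen x.
Proof.
rewrite /env_gen -!env_piM -scaleN1r -env_piZ -env_piD.
exact/env_eq/ueq_bracket.
Qed.

Section Evaluation.

Variables (A : algType rat) (g : L -> A).
Hypothesis lg : linear g.
Hypothesis gB : forall x y, g (lie_bracket x y) = g x * g y - g y * g x.

Fixpoint ueval (s : uterm L) : A :=
  match s with
  | UGen x => g x
  | UOne => 1
  | UZero => 0
  | UAdd s t => ueval s + ueval t
  | UScale a s => a *: ueval s
  | UMul s t => ueval s * ueval t
  end.

Lemma ueval_eq s t : ueq s t -> ueval s = ueval t.
Proof.
elim=> //=.
- by move=> *; congruence.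
- by move=> ? ? ? ? _ -> _ ->.
- by move=> ? ? ? _ ->.
- by move=> ? ? ? ? _ -> _ ->.
- by move=> *; rewrite addrA.
- by move=> *; rewrite addrC.
- by move=> *; rewrite add0r.
- by move=> *; rewrite scaleN1r addNr.
- by move=> *; rewrite scalerA.
- by move=> *; rewrite scale1r.
- by move=> *; rewrite scalerDr.
- by move=> *; rewrite scalerDl.
- by move=> *; rewrite mulrA.
- by move=> *; rewrite mul1r.
- by move=> *; rewrite mulr1.
- by move=> *; rewrite mulrDl.
- by move=> *; rewrite mulrDr.
- by move=> *; rewrite scalerAl.
- by move=> *; rewrite scalerAr.
- by move=> *; rewrite (linD lg).
- by move=> *; rewrite (linZ lg).
- by move=> *; rewrite gB scaleN1r.
Qed.

(** The universal property of the enveloping algebra. *)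
Definition env_lift (x : U) : A := ueval (repr x).

Lemma env_liftE s : env_lift (\pi_(env L) s) = ueval s.
Proof. exact/ueval_eq/env_reprK. Qed.

Lemma env_lift_linear : linear env_lift.
Proof.
move=> a; elim/quotW=> s; elim/quotW=> t.
by rewrite -env_piZ -env_piD !env_liftE.
Qed.

Lemma env_liftM x y : env_lift (x * y) = env_lift x * env_lift y.
Proof.
by elim/quotW: x => s; elim/quotW: y => t; rewrite -env_piM !env_liftE.
Qed.

Lemma env_lift_gen x : env_lift (env_gen x) = g x.
Proof. exact: env_liftE. Qed.

Lemma env_lift1 : env_lift 1 = 1.
Proof. exact: (env_liftE (UOne L)). Qed.

End Evaluation.

End EnvelopingRing.

(** * The Dynkin operator *)

Section MilnorMoore.

Variable K : hall_monoid.
Local Notation H := (hall K).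
Local Notation A := (hall_hopf K).
Local Notation e := (hzero K).
Local Notation L := (primitive_lie A).
Local Notation U := (env L).
Implicit Types (f g : H) (a b c k : K).

Lemma hall_primitiveP f :
  reflect (hall_comul K f = tens f 1 + tens 1 f) (f \in primitive A).
Proof. exact: (@primitiveP _ A f). Qed.

(** A function is primitive when it vanishes at the unit and at all proper
    sums, which is a condition on its support. *)
Lemma primitive_delta f c : f \in primitive A -> f@_c != 0 ->
  delta c \in primitive A.
Proof.
move=> /hall_primitiveP fP fc.
have fE a b : f@_(hadd a b) = f@_a * (e == b)%:R + (e == a)%:R * f@_b.
  rewrite -hall_comulE fP (linD (tcoeff_linear a b)) !tcoeff_tens -delta0.
  by rewrite !mcoeffU.
have fe : f@_e = 0.
  have := fE e e; rewrite hadd0 eqxx mulr1 mul1r => /eqP.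
  by rewrite -subr_eq0 opprD addNKr oppr_eq0 => /eqP.
have ce : c != e by apply: contraNneq fc => ->; rewrite fe.
apply/hall_primitiveP/tcoeff_inj => a b; rewrite hall_comulE.
rewrite (linD (tcoeff_linear a b)) !tcoeff_tens -delta0 !mcoeffU.
have [->|ae] := eqVneq a e.
  by rewrite hadd0 (negPf ce) mul0r add0r mul1r.
have [->|be] := eqVneq b e.
  by rewrite haddr0 mul0r addr0 mulr1.
rewrite mulr0 mul0r addr0.
have [cab|//] := eqVneq c (hadd a b); move: fc.
rewrite cab fE [e == a]eq_sym [e == b]eq_sym.
by rewrite (negPf ae) (negPf be) mulr0 mul0r addr0 eqxx.
Qed.

Lemma primitive_deg c : delta c \in primitive A -> hdeg c != 0%N.
Proof.
move=> cP; apply/eqP => /hdeg_eq0 ce; move: cP => /hall_primitiveP.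
move/(congr1 (fun t => tcoeff t e e)).
rewrite hall_comulE (linD (tcoeff_linear e e)) !tcoeff_tens -delta0 ce hadd0.
by rewrite !mcoeffU eqxx.
Qed.

Definition euler : {linear H -> H} := linext (fun k => (hdeg k)%:R *: delta k).

Lemma eulerU k : euler (delta k) = (hdeg k)%:R *: delta k.
Proof. exact: linextU. Qed.

Lemma euler_component n f : hall_component n f -> euler f = n%:R *: f.
Proof.
move=> fn; rewrite [f]malg_basis linear_sum scaler_sumr big_seq [RHS]big_seq.
apply: eq_bigr => k kf; rewrite linearZ /= eulerU !scalerA mulrC (fn k) //.
by apply/eqP; rewrite mcoeff_neq0.
Qed.

Lemma dynkin_exists : exists D : K -> H,
  forall k, \sum_(p <- decomps k) delta p.1 * D p.2 = (hdeg k)%:R *: delta k.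
Proof.
apply: (conv_solve (act := fun a x => delta a * x)) => x; exact: mul1r.
Qed.

(** The Dynkin operator [D], the convolution product of the antipode and the
    Euler derivation. On a product of homogeneous primitive elements it is, up
    to the degree of the first factor, the left-normed iterated bracket. *)
Definition dynkin : K -> H := projT1 (cid dynkin_exists).

Lemma dynkinE k :
  \sum_(p <- decomps k) delta p.1 * dynkin p.2 = (hdeg k)%:R *: delta k.
Proof. by rewrite /dynkin; case: cid. Qed.

Lemma dynkin0 : dynkin e = 0.
Proof.
by have := dynkinE e; rewrite dec_zero big_seq1 mul1r hdeg0 scale0r.
Qed.

Lemma tmul1l (t : tensor H H) : tmul (fun f g => f * g) (tens 1 1) t = t.
Proof.
move: t; apply: tensor_ext => [||f g].
- exact: (tmul_bilinear (@hall_bilinear K)).1.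
- exact: lin_id.
- by rewrite tmul_pure ?mul1r //; exact: hall_bilinear.
Qed.

Lemma comul_mul_primitive k f : f \in primitive A ->
  hall_comul K (delta k * f) =
  \sum_(p <- decomps k) (tens (delta p.1 * f) (delta p.2) +
                     tens (delta p.1) (delta p.2 * f)).
Proof.
have mb := @hall_bilinear K; have tb := tmul_bilinear mb.
move=> /hall_primitiveP fP; rewrite hall_comulM fP hall_comulU.
rewrite (lin_sum (tb.2 _)); apply: eq_bigr => p _.
by rewrite (linD (tb.1 _)) !tmul_pure // !mulr1.
Qed.

(** The equation defining [dynkin], transferred to the tensor square. It holds
    because the monoid is commutative, that is, the coproduct cocommutative. *)
Lemma tens_conv_dynkin k :
  \sum_(p <- decomps k) tmul (fun f g => f * g) (hall_comul K (delta p.1))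
     (tens (dynkin p.2) 1 + tens 1 (dynkin p.2)) =
  (hdeg k)%:R *: hall_comul K (delta k).
Proof.
have mb := @hall_bilinear K; have tb := tmul_bilinear mb.
transitivity (\sum_(p <- decomps k) \sum_(q <- decomps p.1)
    tens (delta q.1 * dynkin p.2) (delta q.2) +
  \sum_(p <- decomps k) \sum_(q <- decomps p.1)
    tens (delta q.1) (delta q.2 * dynkin p.2)).
  rewrite -big_split; apply: eq_bigr => p _ /=.
  rewrite -big_split hall_comulU (lin_sum (tb.2 _)); apply: eq_bigr => q _ /=.
  by rewrite (linD (tb.1 _)) !tmul_pure // !mulr1.
rewrite (decA k (fun a b c => tens (delta a) (delta b * dynkin c))).
under [X in _ + X]eq_bigr do rewrite -tens_sumr dynkinE.
(* The first factor of a decomposition can be moved past the second one,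
   because the monoid is commutative. *)
under [X in X + _]eq_bigr => p _ do
  rewrite (decC p.1 (fun a b => tens (delta a * dynkin p.2) (delta b))).
rewrite (decA k (fun a b c => tens (delta b * dynkin c) (delta a))).
under [X in X + _]eq_bigr do rewrite -tens_suml dynkinE.
rewrite (decC k (fun a b => tens ((hdeg b)%:R *: delta b) (delta a))).
rewrite -big_split hall_comulU scaler_sumr big_seq [RHS]big_seq.
apply: eq_bigr => p pk /=.
by rewrite tensZl tensZr -scalerDl -natrD (dec_deg pk).
Qed.

(** Applying the coproduct to the equation that defines D shows that the
    coproduct of D is a solution of the equation that the sum of D tensor 1 and
    1 tensor D solves; there is only one solution. *)
Lemma dynkin_primitive k : dynkin k \in primitive A.
Proof.
apply/hall_primitiveP; move: k.
apply: (@conv_inj K (tensor H H)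
  (fun a t => tmul (fun f g => f * g) (hall_comul K (delta a)) t)) => [t|k].
  by rewrite hall_comul1 tmul1l.
rewrite tens_conv_dynkin -linearZ -dynkinE linear_sum.
by apply: eq_bigr => p _; rewrite hall_comulM.
Qed.

Definition dynkin_prim : {linear H -> prim A} :=
  linext (fun k => Prim (dynkin_primitive k)).

Lemma dynkin_primU k : dynkin_prim (delta k) = Prim (dynkin_primitive k).
Proof. exact: linextU. Qed.

Lemma prim_val_linear : linear (@prim_val _ A).
Proof. by []. Qed.

Lemma conv_dynkin f :
  tlift (fun g h : H => g * prim_val (dynkin_prim h)) (hall_comul K f) = euler f.
Proof.
have B : bilinear_map (fun g h : H => g * prim_val (dynkin_prim h) : H).
  apply: (bilin_comp (@hall_bilinear K) (@lin_id H)).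
  exact: (lin_comp prim_val_linear (linearP dynkin_prim)).
move: f; apply: malg_ext => [||k].
- exact: (lin_comp (tlift_linear B) (linearP (hall_comul K))).
- exact: linearP.
rewrite -/(delta k) hall_comulU tlift_sum // eulerU -dynkinE.
by apply: eq_bigr => p _; rewrite dynkin_primU.
Qed.

Section DynkinProduct.

Variables (c : K) (cP : delta c \in primitive A).
Local Notation x := (Prim cP : prim A).

Lemma euler_mul_delta k : euler (delta k * delta c) =
  (hdeg k + hdeg c)%N%:R *: (delta k * delta c).
Proof.
exact/euler_component/hall_component_mul/delta_component/delta_component.
Qed.

(** Right multiplication by a primitive element is a coderivation, hence it can
    be carried through the equation that defines D. *)
Lemma dynkin_mul k : dynkin_prim (delta k * delta c) =
  prim_bracket (dynkin_prim (delta k)) x +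
  (if k == e then (hdeg c)%:R *: x else 0).
Proof.
apply: val_inj; rewrite dynkin_primU.
transitivity (dynkin k * delta c - delta c * dynkin k +
  (if k == e then (hdeg c)%:R *: delta c else 0)); last by case: ifP.
move: k; apply: (@conv_inj K H (fun a y => delta a * y)) => [y|k].
  exact: mul1r.
have B : bilinear_map (fun g h : H => g * prim_val (dynkin_prim h) : H).
  apply: (bilin_comp (@hall_bilinear K) (@lin_id H)).
  exact: (lin_comp prim_val_linear (linearP dynkin_prim)).
pose s := \sum_(p <- decomps k) delta p.1 * delta c * dynkin p.2.
transitivity ((hdeg k + hdeg c)%N%:R *: (delta k * delta c) - s).
  rewrite -euler_mul_delta -conv_dynkin comul_mul_primitive // big_split.
  rewrite (linD (tlift_linear B)) !tlift_sum //.
  rewrite [X in _ = X + _ - s](_ : _ = s); first by rewrite addrAC subrr add0r.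
  by apply: eq_bigr => p _; rewrite dynkin_primU.
under [RHS]eq_bigr do rewrite mulrDr mulrBr !mulrA.
rewrite 2!big_split /= sumrN -mulr_suml dynkinE.
rewrite -/s natrD scalerDl -scalerAl [LHS]addrAC; congr (_ + _).
rewrite [RHS](_ : _ = \sum_(p <- decomps k | p.2 == e)
  delta p.1 * ((hdeg c)%:R *: delta c)).
  by rewrite (dec0r k (fun a b => delta a * _)) scalerAr.
by rewrite [RHS]big_mkcond; apply: eq_bigr => p _; case: ifP; rewrite ?mulr0.
Qed.

End DynkinProduct.

(** * The inverse of the canonical morphism from the enveloping algebra *)

Let prim_val_bracket (x y : L) :
  prim_val (lie_bracket x y) = prim_val x * prim_val y - prim_val y * prim_val x.
Proof. by []. Qed.

Definition env_to_hall : U -> H := env_lift (@prim_val _ A : L -> H).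
Local Notation pi := env_to_hall.

Lemma env_to_hall_linear : linear pi.
Proof.
exact: (@env_lift_linear L H (@prim_val _ A) prim_val_linear prim_val_bracket).
Qed.
HB.instance Definition _ := GRing.isLinear.Build rat U H _ pi env_to_hall_linear.

Lemma env_to_hallM x y : pi (x * y) = pi x * pi y.
Proof. exact: (@env_liftM L H (@prim_val _ A) prim_val_linear prim_val_bracket). Qed.

Lemma env_to_hall_gen (x : L) : pi (env_gen x) = prim_val x.
Proof.
exact: (@env_lift_gen L H (@prim_val _ A) prim_val_linear prim_val_bracket).
Qed.

Lemma env_to_hall1 : pi 1 = 1.
Proof. exact: (@env_lift1 L H (@prim_val _ A) prim_val_linear prim_val_bracket). Qed.

Let dgen (f : H) : U := env_gen (dynkin_prim f : L).

Let dgen_linear : linear dgen.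
Proof. exact: (lin_comp (@env_gen_linear L) (linearP dynkin_prim)). Qed.

Let dgen0 : dgen (delta e) = 0.
Proof.
rewrite /dgen dynkin_primU (_ : Prim _ = 0) ?(lin0 (@env_gen_linear L)) //.
by apply: val_inj; exact: dynkin0.
Qed.

Let section_exists : exists X : K -> U, X e = 1 /\
  forall k, (hdeg k)%:R *: X k = \sum_(p <- decomps k) X p.1 * dgen (delta p.2).
Proof.
have [|X XE] := @deg_rec K U 0 (fun X k => if k == e then 1 else
    (hdeg k)%:R^-1 *: \sum_(p <- decomps k | p.2 != e) X p.1 * dgen (delta p.2)).
  move=> X X' k XX'; case: eqP => // _; congr (_ *: _).
  rewrite big_seq_cond [RHS]big_seq_cond; apply: eq_bigr => p /andP[pk p0].
  by rewrite XX' // dec_ltl.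
exists X; split=> [|k]; first by rewrite XE eqxx.
have [->|ke] := eqVneq k e.
  by rewrite dec_zero big_seq1 dgen0 mulr0 hdeg0 scale0r.
rewrite XE (negPf ke) scalerA mulfV ?scale1r; last first.
  by rewrite pnatr_eq0; apply: contra ke => /eqP/hdeg_eq0 ->.
rewrite big_mkcond; apply: eq_bigr => p _.
by case: eqVneq => //= ->; rewrite dgen0 mulr0.
Qed.

(** The candidate for the inverse of [env_to_hall]: the solution psi with
    psi(1) = 1 of the equation that composes psi with the Euler derivation on
    one side and takes the convolution product of psi and D on the other. The
    identity of the Hall algebra solves this equation too, which is why psi is
    a section. *)
Definition hall_to_env : {linear H -> U} := linext (projT1 (cid section_exists)).
Local Notation psi := hall_to_env.

Let psi1 : psi 1 = 1.
Proof.
rewrite -delta0 [LHS]linextU.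
by case: cid => X [/=].
Qed.

Let psiE k : (hdeg k)%:R *: psi (delta k) =
  \sum_(p <- decomps k) psi (delta p.1) * dgen (delta p.2).
Proof.
have E a : psi (delta a) = projT1 (cid section_exists) a by exact: linextU.
by under eq_bigr do rewrite E; rewrite E; case: cid => X [/=].
Qed.

Let psi_euler f :
  tlift (fun g h : H => psi g * dgen h) (hall_comul K f) = psi (euler f).
Proof.
have B : bilinear_map (fun g h : H => psi g * dgen h).
  exact: (bilin_comp (@env_bilinear L) (linearP psi) dgen_linear).
move: f; apply: malg_ext => [||k].
- exact: (lin_comp (tlift_linear B) (linearP (hall_comul K))).
- exact: (lin_comp (linearP psi) (linearP euler)).
by rewrite -/(delta k) hall_comulU tlift_sum // eulerU linearZ /= psiE.
Qed.

(** By induction on the degree: pi o psi satisfies the recursion that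
    [dynkinE] states for the identity. *)
Lemma hall_to_envK : cancel psi pi.
Proof.
move=> f; move: f; apply: malg_ext => [||k].
- exact: (lin_comp (linearP pi) (linearP psi)).
- exact: lin_id.
rewrite -/(delta k); have [m] := ubnP (hdeg k); elim: m k => // m IH k km.
have [->|ke] := eqVneq k e; first by rewrite delta0 psi1 env_to_hall1.
have k0 : (hdeg k)%:R != 0 :> rat.
  by rewrite pnatr_eq0; apply: contra ke => /eqP/hdeg_eq0 ->.
apply: (scalerI k0); rewrite -linearZ /= psiE linear_sum /= -dynkinE.
rewrite big_seq [RHS]big_seq; apply: eq_bigr => p pk.
have [->|pe] := eqVneq p.2 e; first by rewrite dgen0 mulr0 linear0 dynkin0 mulr0.
rewrite env_to_hallM IH; first by rewrite /dgen env_to_hall_gen dynkin_primU.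
exact: leq_trans (dec_ltl pk pe) km.
Qed.

(** The Euler derivation multiplies the product on the left-hand side by its
    degree, which is positive since a primitive element has no component in
    degree 0; so the recursion for psi applies, and its terms are known by
    [dynkin_mul] and by induction on the degree of [k]. *)
Let psi_mul_delta c (cP : delta c \in primitive A) k :
  psi (delta k * delta c) = psi (delta k) * env_gen (Prim cP : L).
Proof.
have B : bilinear_map (fun g h : H => psi g * dgen h).
  exact: (bilin_comp (@env_bilinear L) (linearP psi) dgen_linear).
have [m] := ubnP (hdeg k); elim: m k => // m IH k km.
have kc0 : (hdeg k + hdeg c)%N%:R != 0 :> rat.
  by rewrite pnatr_eq0 addn_eq0 negb_and (primitive_deg cP) orbT.
apply: (scalerI kc0); rewrite -linearZ -euler_mul_delta -psi_euler.
rewrite comul_mul_primitive // big_split (linD (tlift_linear B)) !tlift_sum //.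
set u := env_gen _.
have dgen_mul a : dgen (delta a * delta c) = dgen (delta a) * u -
    u * dgen (delta a) + (if a == e then (hdeg c)%:R *: u else 0).
  rewrite /dgen (dynkin_mul cP) (linD (@env_gen_linear L)).
  rewrite -[prim_bracket _ _]/(lie_bracket (_ : L) (_ : L)) env_gen_bracket.
  congr (_ + _); case: ifP => _; first exact: (linZ (@env_gen_linear L)).
  exact: (lin0 (@env_gen_linear L)).
under [X in _ + X]eq_bigr do rewrite dgen_mul mulrDr mulrBr !mulrA.
rewrite [X in _ + X]big_split big_split /= sumrN -mulr_suml -psiE.
rewrite [X in X + _](_ : _ = \sum_(p <- decomps k)
    psi (delta p.1) * u * dgen (delta p.2)); last first.
  rewrite big_seq [RHS]big_seq; apply: eq_bigr => p pk.
  have [->|pe] := eqVneq p.2 e; first by rewrite dgen0 !mulr0.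
  by rewrite IH //; exact: leq_trans (dec_ltl pk pe) km.
rewrite addrCA addrA addrNK natrD scalerDl env_mulZl; congr (_ + _).
rewrite [LHS](_ : _ = \sum_(p <- decomps k | p.2 == e)
  psi (delta p.1) * ((hdeg c)%:R *: u)); last first.
  by rewrite [RHS]big_mkcond; apply: eq_bigr => p _; case: ifP; rewrite ?mulr0.
by rewrite (dec0r k (fun a b => psi (delta a) * _)) env_mulZr.
Qed.

Let psi_mul_primitive f (x : L) :
  psi (f * prim_val x) = psi f * env_gen x.
Proof.
pose pdelta c : prim A := insubd (0 : prim A) (delta c).
have xE : x = \sum_(c <- msupp (prim_val x)) (prim_val x)@_c *: pdelta c :> prim A.
  apply: val_inj; rewrite /= {1}[prim_val x]malg_basis.
  rewrite (lin_sum prim_val_linear) big_seq [RHS]big_seq; apply: eq_bigr => c cx.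
  rewrite (linZ prim_val_linear); congr (_ *: _).
  rewrite -[LHS]/(delta c) -[RHS]/(val (pdelta c)) val_insubd.
  by rewrite (primitive_delta (valP (x : prim A))) // mcoeff_neq0.
rewrite {1 2}xE (lin_sum prim_val_linear) (lin_sum (@env_gen_linear L)).
rewrite !mulr_sumr linear_sum; apply: eq_bigr => c _.
rewrite (linZ prim_val_linear) (linZ (@env_gen_linear L)) -scalerAr linearZ.
rewrite env_mulZr; congr (_ *: _).
rewrite /pdelta /insubd; case: insubP => [[y yP] /= _ yc|_]; last first.
  by rewrite (lin0 (@env_gen_linear L)) !mulr0 linear0.
move: yP; rewrite yc => cP; move: f; apply: malg_ext => [||k].
- exact: (lin_comp (linearP psi) ((@hall_bilinear K).2 _)).
- exact: (lin_comp ((@env_bilinear L).2 _) (linearP psi)).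
exact: psi_mul_delta.
Qed.

(** [psi_mul_primitive] makes psi linear over the enveloping algebra acting on
    the right, hence determined on the image of pi by its value at 1. *)
Lemma env_to_hallK : cancel pi psi.
Proof.
have psiM u : forall f, psi (f * pi u) = psi f * u.
  elim/quotW: u; elim=> [x|||s IHs t IHt|a s IHs|s IHs t IHt] f.
  - by rewrite -/(env_gen x) env_to_hall_gen psi_mul_primitive.
  - by rewrite -[\pi _]/(1 : U) env_to_hall1 !mulr1.
  - by rewrite -[\pi _]/(0 : U) linear0 !mulr0 linear0.
  - by rewrite env_piD linearD mulrDr linearD IHs IHt mulrDr.
  - by rewrite env_piZ linearZ -scalerAr linearZ IHs env_mulZr.
  - by rewrite env_piM env_to_hallM !mulrA IHt IHs.
by move=> u; rewrite -[pi u]mul1r psiM psi1 mul1r.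
Qed.

Lemma hall_enveloping : is_enveloping_of_primitives A.
Proof.
exists (hopf_transport A hall_to_envK env_to_hallK); split; last first.
  exact: hopf_transport_iso.
split=> [x y||x] /=.
- by rewrite -env_to_hallM env_to_hallK.
- exact: psi1.
- rewrite env_to_hall_gen.
  have /primitiveP/= -> := valP (x : prim A).
  rewrite (linD (tmap_linear (linearP psi) (linearP psi))).
  rewrite !tmap_tens; try exact: linearP.
  by rewrite psi1 -env_to_hall_gen env_to_hallK.
Qed.

End MilnorMoore.

(** * Subposets and order ideals *)

Local Open Scope fset_scope.
Local Open Scope fmap_scope.

Section Subposets.

Variable U : choiceType.
Implicit Types (P Q S : fposet U) (A B I J L : {fset U}).

Lemma fposet_eq P Q : pcar P = pcar Q -> prel P = prel Q -> P = Q.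
Proof.
case: P Q => [c r h1 h2 h3 h4] [c' r' h1' h2' h3' h4'] /= cc rr.
subst c' r'.
by congr FPoset; exact: Prop_irrelevance.
Qed.

Lemma fposet_eqP P Q : pcar P = pcar Q -> (forall x y, ple P x y = ple Q x y) ->
  P = Q.
Proof.
by move=> cc rr; apply: fposet_eq => //; apply/fsetP => -[x y]; exact: rr.
Qed.

Lemma ple_dom P x y : ple P x y -> x \in pcar P /\ y \in pcar P.
Proof. exact: prel_dom. Qed.

Lemma ple_mk (A : {fset U}) (r : rel U) rr ra rt x y :
  ple (@mk_fposet U A r rr ra rt) x y = [&& x \in A, y \in A & r x y].
Proof. by rewrite /ple !inE /= andbA. Qed.

Lemma ple_psub P A x y : ple (psub P A) x y = [&& x \in A, y \in A & ple P x y].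
Proof.
rewrite ple_mk !inE; apply/and3P/and3P => [[/andP[_ ->] /andP[_ ->] ->]//|].
by move=> [xA yA xy]; have [-> ->] := ple_dom xy; rewrite xA yA.
Qed.

Lemma psub_carE P A : A `<=` pcar P -> pcar (psub P A) = A.
Proof. by move=> AP; exact/fsetIidPr. Qed.

Lemma psub_psub P A B : B `<=` A -> psub (psub P A) B = psub P B.
Proof.
move=> /fsubsetP BA; apply: fposet_eqP => [|x y] /=.
  by apply/fsetP => x; rewrite !inE; case: (boolP (x \in B)) => [/BA ->|_];
    rewrite ?andbT ?andbF.
rewrite !ple_psub; apply/and3P/and3P => [[-> -> /and3P[_ _ ->]]//|[xB yB ->]].
by rewrite xB yB !BA.
Qed.

Lemma psub_id P : psub P (pcar P) = P.
Proof.
apply: fposet_eqP => [|x y]; first exact: psub_carE.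
rewrite ple_psub; apply/and3P/idP => [[]//|xy].
by have [-> ->] := ple_dom xy.
Qed.

Lemma idealP P I : reflect
  (I `<=` pcar P /\ forall x y, y \in I -> ple P x y -> x \in I)
  (I \in ideals P).
Proof.
rewrite !inE /= fpowersetE /order_ideal andbA andbb.
apply: (iffP andP) => [[IP /forallP h]|[IP h]]; split=> //.
  move=> x y yI xy; have [xP yP] := ple_dom xy.
  by have /forallP/(_ [` yP])/implyP := h [` xP]; apply; rewrite /= yI.
apply/forallP => x; apply/forallP => y; apply/implyP => /andP[yI xy].
exact: h xy.
Qed.

Lemma ideal_sub P I : I \in ideals P -> I `<=` pcar P.
Proof. by case/idealP. Qed.

Lemma ideal_le P I x y : I \in ideals P -> y \in I -> ple P x y -> x \in I.
Proof. by case/idealP => _; exact. Qed.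

Lemma ideal0 P : fset0 \in ideals P.
Proof. by apply/idealP; split=> [|x y]; rewrite ?fsub0set ?inE. Qed.

Lemma idealT P : pcar P \in ideals P.
Proof. by apply/idealP; split=> // x y _ /ple_dom[]. Qed.

Lemma idealU P I J : I \in ideals P -> J \in ideals P -> I `|` J \in ideals P.
Proof.
move=> hI hJ; apply/idealP; split.
  by rewrite fsubUset !ideal_sub.
move=> x y; rewrite !inE => /orP[yI|yJ] xy; first by rewrite (ideal_le hI yI xy).
by rewrite (ideal_le hJ yJ xy) orbT.
Qed.

Lemma idealI P I J : I \in ideals P -> J \in ideals P -> I `&` J \in ideals P.
Proof.
move=> hI hJ; apply/idealP; split.
  exact: fsubset_trans (fsubsetIl _ _) (ideal_sub hI).
move=> x y; rewrite !inE => /andP[yI yJ] xy.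
by rewrite (ideal_le hI yI xy) (ideal_le hJ yJ xy).
Qed.

Lemma convexD P I L : L \in ideals P -> I \in ideals P -> convex P (L `\` I).
Proof.
move=> hL hI; split.
  exact: fsubset_trans (fsubsetDl _ _) (ideal_sub hL).
move=> x y z; rewrite !inE => /andP[xI _] /andP[_ yL] xz zy.
rewrite (ideal_le hL yL zy) andbT; apply: contra xI => zI.
exact: ideal_le hI zI xz.
Qed.

Lemma ideal_convex P I : I \in ideals P -> convex P I.
Proof. by move=> hI; rewrite -[I]fsetD0; apply: convexD => //; exact: ideal0. Qed.

Lemma convex_psub P A B : convex P B -> B `<=` A -> convex (psub P A) B.
Proof.
move=> [BP Bc] BA; split; first by rewrite fsubsetI BP BA.
by move=> x y z xB yB; rewrite !ple_psub => /and3P[_ _ +] /and3P[_ _];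
  exact: Bc.
Qed.

(** An ideal of L minus I need not be an ideal of P, but whatever lies below it
    in P and outside of it lies in I. *)
Lemma ideals_interval P I L A : I \in ideals P -> L \in ideals P ->
  I `<=` L ->
  (A \in ideals (psub P (L `\` I))) = (A `<=` L `\` I) && (A `|` I \in ideals P).
Proof.
move=> hI hL IL; have [LP _] := convexD hL hI.
apply/idealP/andP => [[+ Ale]|[AL hAI]]; rewrite ?psub_carE //.
  move=> AL; split=> //; apply/idealP; split.
    by rewrite fsubUset (fsubset_trans AL LP) ideal_sub.
  move=> x y; rewrite !inE => /orP[yA|yI] xy; last first.
    by rewrite (ideal_le hI yI xy) orbT.
  have [//|xI] := boolP (x \in I); rewrite ?orbT //= orbF.
  apply: (Ale x y) => //; have := fsubsetP AL _ yA; rewrite ple_psub !inE xy xI.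
  by move=> /andP[-> yL]; rewrite yL (ideal_le hL yL xy).
split=> // x y yA; rewrite ple_psub !inE => /and3P[/andP[xI _] _ xy].
have : x \in A `|` I by apply: ideal_le hAI _ xy; rewrite !inE yA.
by rewrite !inE (negPf xI) orbF.
Qed.

Lemma ideals_psub P L A : L \in ideals P ->
  (A \in ideals (psub P L)) = (A `<=` L) && (A \in ideals P).
Proof.
move=> hL; rewrite -{1 2}[L]fsetD0 ideals_interval ?ideal0 ?fsub0set //.
by rewrite fsetU0.
Qed.

Lemma disjoint_union_ideal P Q S : is_disjoint_union P Q S ->
  [/\ pcar P \in ideals S, psub S (pcar P) = P & pcar S `\` pcar P = pcar Q].
Proof.
move=> [dPQ cS rS].
have dis x : x \in pcar P -> x \in pcar Q -> False.
  by move=> xP xQ; have /fdisjointP/(_ x xP) := dPQ; rewrite xQ.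
have leS x y : ple S x y = ple P x y || ple Q x y by rewrite /ple rS inE.
split.
- apply/idealP; split=> [|x y yP]; first by rewrite cS fsubsetUl.
  by rewrite leS => /orP[/ple_dom[]//|/ple_dom[_ /(dis _ yP)]].
- apply: fposet_eqP => [|x y]; first by rewrite psub_carE // cS fsubsetUl.
  rewrite ple_psub leS; apply/and3P/idP => [[xP yP /orP[//|]]|xy].
    by move=> /ple_dom[/(dis _ xP)].
  by have [-> ->] := ple_dom xy; rewrite xy.
- rewrite cS; apply/fsetP => x; rewrite !inE.
  by case: (boolP (x \in pcar P)) => //= xP; apply/esym/negP; exact: dis.
Qed.

Lemma disjoint_union_sym P Q S :
  is_disjoint_union P Q S -> is_disjoint_union Q P S.
Proof.
by move=> [dPQ cS rS]; split; rewrite 1?fdisjoint_sym // fsetUC.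
Qed.

(** An ideal is closed downwards, so no relation can join the two ideals. *)
Lemma disjoint_union_split S I : I \in ideals S -> pcar S `\` I \in ideals S ->
  is_disjoint_union (psub S I) (psub S (pcar S `\` I)) S.
Proof.
move=> hI hJ; have [IS JS] := (ideal_sub hI, ideal_sub hJ).
split; rewrite ?psub_carE //.
- by apply/fdisjointP => x; rewrite !inE => ->.
- by apply/fsetP => x; rewrite !inE; case: (boolP (x \in I)) => //= /(fsubsetP IS).
- apply/fsetP => -[x y]; rewrite inE -![_ \in prel _]/(ple _ _ _) !ple_psub.
  apply/idP/orP => [xy|[/and3P[]|/and3P[]]//]; have [xS yS] := ple_dom xy.
  have [yI|yI] := boolP (y \in I).
    by left; rewrite (ideal_le hI yI xy).
  have yJ : y \in pcar S `\` I by rewrite inE yI.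
  by right; rewrite (ideal_le hJ yJ xy) yJ.
Qed.

End Subposets.

(** * Maps of finite posets *)

Section FiniteMaps.

Variable U : choiceType.
Implicit Types (P Q : fposet U) (A I : {fset U}) (f g : {fmap U -> U}).

Definition fimage (f : U -> U) A : {fset U} := [fset f x | x in A].

Lemma fimageP (h : U -> U) A y :
  reflect (exists2 x, x \in A & y = h x) (y \in fimage h A).
Proof. exact: imfsetP. Qed.

Lemma fimage_mem (h : U -> U) A B x : {in B &, injective h} -> A `<=` B ->
  x \in B -> (h x \in fimage h A) = (x \in A).
Proof.
move=> hi /fsubsetP AB xB; apply/fimageP/idP => [[y yA /hi->]//|xA].
  exact: AB.
by exists x.
Qed.

Lemma fimage_inj (h : U -> U) A B C : {in C &, injective h} ->
  A `<=` C -> B `<=` C -> fimage h A = fimage h B -> A = B.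
Proof.
move=> hi AC BC AB; apply/fsetP => x.
have [xC|xC] := boolP (x \in C).
  by rewrite -(fimage_mem hi AC xC) AB (fimage_mem hi BC xC).
rewrite (negPf (contraNN (fsubsetP AC x) xC)).
by rewrite (negPf (contraNN (fsubsetP BC x) xC)).
Qed.

Lemma fimageS (h : U -> U) A B : A `<=` B -> fimage h A `<=` fimage h B.
Proof.
move=> /fsubsetP AB; apply/fsubsetP => y /fimageP[x xA ->].
by apply/fimageP; exists x; rewrite ?AB.
Qed.

Lemma fimageSE (h : U -> U) A B C : {in C &, injective h} ->
  A `<=` C -> B `<=` C -> (fimage h A `<=` fimage h B) = (A `<=` B).
Proof.
move=> hi AC BC; apply/idP/idP => [/fsubsetP AB|]; last exact: fimageS.
apply/fsubsetP => x xA; have xC := fsubsetP AC _ xA.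
by rewrite -(fimage_mem hi BC xC) AB // (fimage_mem hi AC xC).
Qed.

Lemma fmapE (A : {fset U}) (E : A -> U) (x : U) (xA : x \in A) :
  [fmap y : A => E y].[? x] = Some (E [` xA]).
Proof. by rewrite in_fnd ffunE. Qed.

Lemma fmapEn (A : {fset U}) (E : A -> U) (x : U) :
  x \notin A -> [fmap y : A => E y].[? x] = None.
Proof. exact: not_fnd. Qed.

Lemma fapp_fmid A x : fapp (fmid A) x = x.
Proof.
rewrite /fapp; have [xA|xA] := boolP (x \in A); first by rewrite fmapE.
by rewrite fmapEn.
Qed.

Lemma fimage_fmid A B : fimage (fapp (fmid A)) B = B.
Proof.
apply/fsetP => y; apply/fimageP/idP => [[x xB ->]|yB]; first by rewrite fapp_fmid.
by exists y; rewrite ?fapp_fmid.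
Qed.

Lemma fapp_dom f (x : domf f) : fapp f (val x) = f x.
Proof. by rewrite /fapp -Some_fnd. Qed.

Lemma fimage_domf f : fimage (fapp f) (domf f) = codomf f.
Proof.
apply/fsetP => y; apply/fimageP/codomfP => [[x xf ->]|[x fx]].
  by exists x; rewrite /fapp in_fnd.
exists x; last by rewrite /fapp fx.
by case: fndP fx.
Qed.

(** The default value is never reached: every [y] in [codomf f] has a preimage. *)
Definition finverse f : {fmap U -> U} := [fmap y : codomf f =>
  if [pick x : domf f | f x == val y] is Some x then val x else val y].

Lemma finverseP f : {in domf f &, injective (fapp f)} ->
  is_inverse f (finverse f).
Proof.
move=> fi.
have fK (x : domf f) : fapp (finverse f) (f x) = val x.
  have fxc : f x \in codomf f by rewrite mem_codomf; apply/existsP; exists x.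
  rewrite /fapp fmapE /=; case: pickP => [x' /eqP|/(_ x)]; last by rewrite eqxx.
  by rewrite -!fapp_dom; apply: fi; exact: valP.
have codP (y : codomf f) : exists x : domf f, f x = val y.
  by have := valP y; rewrite mem_codomf => /existsP[x /eqP]; exists x.
split=> //; apply/fmapP => x.
- have [xf|xf] := boolP (x \in domf f); last by rewrite !fmapEn.
  by rewrite !fmapE fK.
- have [xf|xf] := boolP (x \in codomf f); last by rewrite !fmapEn.
  rewrite !fmapE /= ffunE /=; have [z fz] := codP [` xf].
  case: pickP => [x' /eqP|/(_ z)]; last by rewrite fz eqxx.
  by rewrite fapp_dom => ->.
Qed.

Lemma iso_image P Q f : fm_poset_iso P Q f ->
  fimage (fapp f) (pcar P) = pcar Q.
Proof. by case=> <- <- _ _; exact: fimage_domf. Qed.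

End FiniteMaps.

Section PosetIsomorphisms.

Variable U : choiceType.
Implicit Types (P Q : fposet U) (A I : {fset U}) (h : U -> U).

Definition poset_iso P Q h :=
  [/\ {in pcar P &, injective h}, fimage h (pcar P) = pcar Q &
      {in pcar P &, forall x y, ple Q (h x) (h y) = ple P x y}].

Lemma ideal_image P Q h I : poset_iso P Q h ->
  I \in ideals P -> fimage h I \in ideals Q.
Proof.
move=> [hi hT hle] hI; apply/idealP; split.
  by rewrite -hT; exact/fimageS/ideal_sub.
move=> x _ /fimageP[y yI ->] xy.
have [] := ple_dom xy; rewrite -hT => /fimageP[z zP xz] _.
rewrite xz hle // in xy; last exact: fsubsetP (ideal_sub hI) _ yI.
by rewrite xz; apply/fimageP; exists z => //; exact: ideal_le hI yI xy.
Qed.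

Lemma ideal_preimage P Q h J : poset_iso P Q h ->
  J \in ideals Q -> exists2 I, I \in ideals P & J = fimage h I.
Proof.
move=> [hi hT hle] hJ; exists [fset x in pcar P | h x \in J].
  apply/idealP; split=> [|x y]; first exact: fset_sub.
  rewrite !inE /= => /andP[yP yJ] xy; have [xP _] := ple_dom xy.
  by rewrite xP; apply: ideal_le hJ yJ _; rewrite hle.
apply/fsetP => y; apply/idP/fimageP => [yJ|[x]]; last first.
  by rewrite !inE => /andP[_ xJ] ->.
have := fsubsetP (ideal_sub hJ) _ yJ; rewrite -hT => /fimageP[x xP yx].
by exists x => //; rewrite !inE xP /= -yx.
Qed.

Lemma fimageD P Q h I : poset_iso P Q h -> I \in ideals P ->
  fimage h (pcar P `\` I) = pcar Q `\` fimage h I.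
Proof.
move=> [hi hT _] /ideal_sub IP; apply/fsetP => y; rewrite inE -hT.
apply/fimageP/andP => [[x]|[yI /fimageP[x xP yx]]].
  rewrite inE => /andP[xI xP] ->; rewrite (fimage_mem hi IP xP) xI; split=> //.
  by apply/fimageP; exists x.
by exists x => //; rewrite inE xP andbT -(fimage_mem hi IP xP) -yx.
Qed.

Lemma poset_iso_of_fm P Q f : fm_poset_iso P Q f -> poset_iso P Q (fapp f).
Proof. by move=> fi; split; [case: fi | exact: iso_image | case: fi]. Qed.

End PosetIsomorphisms.

(** * The incidence category *)

Section Incidence.

Variables (U : choiceType) (D : incidence_data U).
Implicit Types (P Q S : obj D) (A B I J L : {fset U}).

Lemma obj_eq P Q : obj_poset P = obj_poset Q -> P = Q.
Proof.
case: P Q => [P hP] [Q hQ] /= PQ; subst Q.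
by congr Obj; exact: Prop_irrelevance.
Qed.

Lemma obj_subE P A : convex P A -> obj_poset (obj_sub P A) = psub P A.
Proof. by rewrite /obj_sub; case: pselect. Qed.

Lemma obj_sub_car P A : convex P A -> pcar (obj_sub P A) = A.
Proof. by move=> cA; rewrite obj_subE // psub_carE //; case: cA. Qed.

Lemma obj_sub_full P : obj_sub P (pcar P) = P.
Proof.
by apply: obj_eq; rewrite obj_subE ?psub_id //; exact/ideal_convex/idealT.
Qed.

Lemma obj_sub_sub P A B : convex P A -> convex P B -> B `<=` A ->
  obj_sub (obj_sub P A) B = obj_sub P B.
Proof.
move=> cA cB BA; apply: obj_eq.
have cAB : convex (obj_sub P A) B by rewrite obj_subE //; exact: convex_psub.
by rewrite (obj_subE cAB) (obj_subE cA) (obj_subE cB) psub_psub.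
Qed.

Lemma map_equiv_refl P : map_equiv P P.
Proof. by exists (fmid (pcar P)); exact/inc_id/obj_inc. Qed.

Lemma map_equiv_sym P Q : map_equiv P Q -> map_equiv Q P.
Proof.
move=> [f fM]; exists (finverse f); have hP := obj_inc P; have hQ := obj_inc Q.
apply: (inc_inv hP hQ fM); apply: finverseP.
by have [-> _ ? _] := inc_iso hP hQ fM.
Qed.

Lemma map_equiv_trans P Q S : map_equiv P Q -> map_equiv Q S -> map_equiv P S.
Proof.
move=> [f fM] [g gM]; exists (fmcomp g f).
exact: inc_trans (obj_inc P) (obj_inc Q) (obj_inc S) fM gM.
Qed.

(** The restriction of a map of M to an ideal is its composite, in the
    incidence category, with the inclusion of a subobject. *)
Lemma map_restrict_ideal P Q f I : inc_map D P Q f -> I \in ideals P ->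
  exists g, inc_map D (psub P I) (psub Q (fimage (fapp f) I)) g.
Proof.
move=> fM hI; have IP := ideal_sub hI; have hP := obj_inc P; have hQ := obj_inc Q.
have hPI := inc_convex hP (ideal_convex hI).
pose m := Mor fset0 I (fmid I); pose n := Mor fset0 (pcar Q) f.
have mM : is_mor (inc_map D) (psub P I) P m.
  split=> //=; first exact: ideal0.
  rewrite fsetD0 -[pcar P `&` I]/(pcar (psub P I)) psub_id.
  by have := inc_id hPI; rewrite psub_carE.
have nM : is_mor (inc_map D) P Q n.
  split=> /=; [exact: ideal0|exact: idealT|].
  by rewrite fsetD0 !psub_id.
have := inc_comp hPI hP hQ mM nM.
rewrite /= (_ : fset0 `|` _ = fset0); last first.
  by apply/fsetP => x; rewrite !inE /= !andbF.
rewrite fsetD0 -[pcar P `&` I]/(pcar (psub P I)) psub_id.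
rewrite fsetD0 -/(fimage (fapp f) I).
by move=> ?; eexists; eassumption.
Qed.

(** Dually, for the projections onto the quotients. *)
Lemma map_restrict_quotient P Q f I : inc_map D P Q f -> I \in ideals P ->
  exists g, inc_map D (psub P (pcar P `\` I))
                      (psub Q (pcar Q `\` fimage (fapp f) I)) g.
Proof.
move=> fM hI; have IP := ideal_sub hI; have hP := obj_inc P; have hQ := obj_inc Q.
have fi := inc_iso hP hQ fM; have fp := poset_iso_of_fm fi.
pose J := fimage (fapp f) I; have hJ : J \in ideals Q by exact: ideal_image fp hI.
have cQJ := convexD (idealT Q) hJ.
have hQJ := inc_convex hQ cQJ.
pose m := Mor fset0 (pcar Q) f.
pose n := Mor J (pcar Q `\` J) (fmid (pcar Q `\` J)).
have mM : is_mor (inc_map D) P Q m.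
  split=> /=; [exact: ideal0|exact: idealT|].
  by rewrite fsetD0 !psub_id.
have nM : is_mor (inc_map D) Q (psub Q (pcar Q `\` J)) n.
  split=> //=; first by rewrite -{1}(psub_carE cQJ.1); exact: idealT.
  rewrite psub_psub //; have := inc_id hQJ.
  by rewrite psub_carE //; case: cQJ.
have := inc_comp hP hQ hQJ mM nM.
have [fd _ finj _] := fi.
rewrite /= (_ : fset0 `|` _ = I); last first.
  apply/fsetP => x; rewrite !inE /= fd.
  apply/andP/idP => [[xP /andP[_]]|xI]; first by rewrite (fimage_mem finj IP).
  have xP := fsubsetP IP _ xI; rewrite (fimage_mem finj IP) // xI andbT xP.
  by split=> //; case: fp => _ <- _; apply/fimageP; exists x.
rewrite -/(fimage (fapp (fmid (pcar Q `\` J))) (pcar Q `\` J)) fimage_fmid.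
by rewrite psub_psub // => ?; eexists; eassumption.
Qed.

(** All invariants of ideals and of their complements below are transported
    along maps of M by this lemma. *)
Lemma map_equiv_lift P Q : map_equiv P Q -> exists h, poset_iso P Q h /\
  forall I, I \in ideals P ->
    [/\ fimage h I \in ideals Q,
        map_equiv (obj_sub P I) (obj_sub Q (fimage h I)) &
        map_equiv (obj_sub P (pcar P `\` I))
                  (obj_sub Q (pcar Q `\` fimage h I))].
Proof.
move=> [f fM]; have fp := poset_iso_of_fm (inc_iso (obj_inc P) (obj_inc Q) fM).
exists (fapp f); split=> // I hI; have hJ := ideal_image fp hI; split=> //.
  rewrite /map_equiv !obj_subE; try exact: ideal_convex.
  exact: map_restrict_ideal.
rewrite /map_equiv !obj_subE; try exact: (convexD (idealT _)).
exact: map_restrict_quotient.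
Qed.

Lemma map_equiv_card P Q : map_equiv P Q -> #|` pcar P| = #|` pcar Q|.
Proof.
move=> /map_equiv_lift[h [[hi hT _] _]].
by rewrite -hT card_in_imfset.
Qed.

(** The kernel of a composite contains that of its first factor, and its image
    is contained in that of its second factor; so an isomorphism has empty
    kernel and full image, and amounts to a map of M. *)
Lemma obj_isoE : @obj_iso U D = @map_equiv U D.
Proof.
apply/funext => P; apply/funext => Q; apply/propext; split.
  move=> [m [n [[/= _ mI mM] [/= _ nI _] mn nm]]].
  have mK : mor_ker m = fset0.
    apply/eqP; rewrite -fsubset0.
    by have := congr1 (@mor_ker U) mn => /= <-; exact: fsubsetUl.
  rewrite mK fsetD0 psub_id in mM.
  have hm : inc_fam D (psub Q (mor_im m)).
    exact: inc_convex (obj_inc Q) (ideal_convex mI).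
  have fi := poset_iso_of_fm (inc_iso (obj_inc P) hm mM).
  have imQ : mor_im m = pcar Q.
    apply/eqP; rewrite eqEfsubset ideal_sub //=.
    have := congr1 (@mor_im U) nm => /= <-; rewrite mK fsetD0.
    rewrite -/(fimage _ _) -[mor_im m](psub_carE (ideal_sub mI)).
    case: fi => _ <- _; exact/fimageS/ideal_sub.
  by rewrite imQ psub_id in mM; exists (mor_fun m).
move=> [f fM]; have fi := inc_iso (obj_inc P) (obj_inc Q) fM.
have [fd fc finj _] := fi.
have fV : is_inverse f (finverse f) by apply: finverseP; rewrite fd.
have gM := inc_inv (obj_inc P) (obj_inc Q) fM fV.
have gi := inc_iso (obj_inc Q) (obj_inc P) gM.
have [gd fg gf] := fV; rewrite fc in gd; rewrite fd in fg; rewrite gd in gf.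
exists (Mor fset0 (pcar Q) f), (Mor fset0 (pcar P) (finverse f)).
split.
- by split; rewrite /= ?ideal0 ?idealT // fsetD0 !psub_id.
- by split; rewrite /= ?ideal0 ?idealT // fsetD0 !psub_id.
- rewrite /mor_comp /= fsetI0 fsetD0.
  rewrite (_ : fset0 `|` _ = fset0); last by apply/fsetP => x; rewrite !inE andbF.
  by rewrite remf0 fg -/(fimage _ _) (iso_image gi).
- rewrite /mor_comp /= fsetI0 fsetD0.
  rewrite (_ : fset0 `|` _ = fset0); last by apply/fsetP => x; rewrite !inE andbF.
  by rewrite remf0 gf -/(fimage _ _) (iso_image fi).
Qed.

(** * Isomorphism classes of posets *)

Definition pclass := classes (@map_equiv U D).
Definition cls P : pclass := class_of (@map_equiv U D) P.

Lemma clsP P Q : cls P = cls Q <-> map_equiv P Q.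
Proof.
split=> [PQ|PQ].
  have -> : map_equiv P Q = map_equiv Q Q by rewrite -[map_equiv P]/(val (cls P)) PQ.
  exact: map_equiv_refl.
apply: val_inj; apply/funext => S; apply/propext; split.
  exact/map_equiv_trans/map_equiv_sym.
exact: map_equiv_trans.
Qed.

Lemma rep_exists (k : pclass) : exists P, cls P = k.
Proof.
by case: k => C hC; have /asboolP[P CP] := hC; exists P; exact: val_inj.
Qed.

Definition rep (k : pclass) : obj D := projT1 (cid (rep_exists k)).

Lemma repK k : cls (rep k) = k.
Proof. by rewrite /rep; case: cid. Qed.

Lemma rep_equiv P : map_equiv (rep (cls P)) P.
Proof. by apply/clsP; rewrite repK. Qed.

Definition pc_sub (k : pclass) : seq (pclass * pclass) :=
  [seq (cls (obj_sub (rep k) J), cls (obj_sub (rep k) (pcar (rep k) `\` J)))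
    | J <- ideals (rep k)].

Lemma sum_reindex (V : zmodType) (I J : eqType) (s : seq I) (t : seq J)
    (h : I -> J) (F : J -> V) : uniq s -> uniq t -> {in s &, injective h} ->
  (forall i, i \in s -> h i \in t) ->
  (forall j, j \in t -> exists2 i, i \in s & j = h i) ->
  (\sum_(j <- t) F j = \sum_(i <- s) F (h i))%R.
Proof.
move=> us ut hi st ts; rewrite -(big_map h xpredT F); apply/perm_big/uniq_perm.
- exact: ut.
- by rewrite map_inj_in_uniq.
- by move=> j; apply/idP/mapP => [/ts //|[i /st + ->]].
Qed.

Lemma sum_pc_sub (V : zmodType) P (F : pclass -> pclass -> V) :
  (\sum_(p <- pc_sub (cls P)) F p.1 p.2 = \sum_(J <- ideals P)
    F (cls (obj_sub P J)) (cls (obj_sub P (pcar P `\` J))))%R.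
Proof.
rewrite big_map; have [h [hp hI]] := map_equiv_lift (map_equiv_sym (rep_equiv P)).
have [hi _ _] := hp.
set Q := rep (cls P) in hp hI *.
rewrite (sum_reindex (s := ideals P) (t := ideals Q) (h := fimage h))
  ?fset_uniq //.
- rewrite big_seq [RHS]big_seq; apply: eq_bigr => I /hI[_].
  by move=> /clsP -> /clsP ->.
- by move=> I J /ideal_sub IP /ideal_sub JP; exact: fimage_inj hi IP JP.
- by move=> I /hI[].
- by move=> J /(ideal_preimage hp).
Qed.

Lemma mem_pc_sub P a b : (a, b) \in pc_sub (cls P) -> exists I,
  [/\ I \in ideals P, cls (obj_sub P I) = a &
      cls (obj_sub P (pcar P `\` I)) = b].
Proof.
move=> /mapP[I hI [-> ->]].
have [h [hp lift]] := map_equiv_lift (rep_equiv P).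
by have [hJ /clsP -> /clsP ->] := lift _ hI; exists (fimage h I).
Qed.

Definition pc_add (k l : pclass) : pclass := cls (obj_sum (rep k) (rep l)).

Lemma cls_sum P Q S : is_sum P Q S -> cls S = pc_add (cls P) (cls Q).
Proof.
move=> [P' [Q' [PP' QQ' dS]]]; apply/clsP; rewrite /obj_sum.
case: cid => /= T [P1 [Q1 [PP1 QQ1 dT]]].
have [f fM] : map_equiv P' P1.
  apply: map_equiv_trans (map_equiv_sym PP') _.
  exact: map_equiv_trans (map_equiv_sym (rep_equiv P)) PP1.
have [g gM] : map_equiv Q' Q1.
  apply: map_equiv_trans (map_equiv_sym QQ') _.
  exact: map_equiv_trans (map_equiv_sym (rep_equiv Q)) QQ1.
exists (f + g)%fmap.
by apply: inc_union fM gM; first [exact: dS | exact: dT | split; exact: obj_inc].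
Qed.

Lemma cls_obj_sum P Q : cls (obj_sum P Q) = pc_add (cls P) (cls Q).
Proof. by apply: cls_sum; rewrite /obj_sum; case: cid. Qed.

(** The ideals that are disjoint summands. *)
Definition splits P I := (I \in ideals P) && (pcar P `\` I \in ideals P).

Lemma splits_compl P I : splits P I -> splits P (pcar P `\` I).
Proof.
move=> /andP[hI hJ]; rewrite /splits hJ fsetDK //; exact: ideal_sub.
Qed.

Lemma cls_split P I : splits P I ->
  cls P = pc_add (cls (obj_sub P I)) (cls (obj_sub P (pcar P `\` I))).
Proof.
move=> /andP[hI hJ]; apply: cls_sum.
exists (obj_sub P I), (obj_sub P (pcar P `\` I)).
split; try exact: map_equiv_refl.
rewrite !obj_subE; try exact: ideal_convex.
exact: disjoint_union_split.
Qed.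

(** The two copies whose union is the chosen sum are an ideal and its
    complement there, and a map of M moves them to an ideal of [P] and its
    complement. *)
Lemma pc_add_split P a b : cls P = pc_add a b -> exists I,
  [/\ splits P I, cls (obj_sub P I) = a &
      cls (obj_sub P (pcar P `\` I)) = b].
Proof.
move=> /esym/clsP; rewrite /obj_sum; case: cid => /= S [A [B [aA bB dS]]] SP.
have [hA SA SB] := disjoint_union_ideal dS.
have [hB SB' _] := disjoint_union_ideal (disjoint_union_sym dS).
have [h [hp lift]] := map_equiv_lift SP.
have [hI hIA hIB] := lift _ hA.
exists (fimage h (pcar A)); split.
- rewrite /splits hI /= -(fimageD hp hA) SB; exact: ideal_image hp hB.
- have EA : A = obj_sub S (pcar A).
    by apply: obj_eq; rewrite obj_subE //; exact: ideal_convex.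
  rewrite -[a]repK; apply/clsP/map_equiv_sym/(map_equiv_trans aA).
  by rewrite [X in map_equiv X]EA.
- have EB : B = obj_sub S (pcar S `\` pcar A).
    by apply: obj_eq; rewrite SB obj_subE //; exact: ideal_convex.
  rewrite -[b]repK; apply/clsP/map_equiv_sym/(map_equiv_trans bB).
  by rewrite [X in map_equiv X]EB.
Qed.

End Incidence.

(** * The monoid of isomorphism classes *)

#[local] Opaque ideals obj_sub.

Lemma in_fset_cond (K : choiceType) (A : {fset K}) (p : pred K) x :
  (x \in [fset y in A | p y]) = (x \in A) && p x.
Proof. by rewrite !inE. Qed.

Lemma fsubset_imp (K : choiceType) (A B : {fset K}) x :
  A `<=` B -> (x \in A) ==> (x \in B).
Proof. by move=> /fsubsetP AB; apply/implyP; exact: AB. Qed.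

Ltac fset_cases x :=
  repeat match goal with
  | H : is_true (_ `<=` _) |- _ => move: (fsubset_imp x H); clear H end;
  rewrite ?inE;
  repeat match goal with |- context [x \in ?A] => case: (x \in A) end; by [].

(** Equalities and inclusions of sets that follow pointwise from the
    inclusions in the context. *)
Ltac fset_tauto :=
  let x := fresh "x" in
  match goal with
  | |- is_true (_ `<=` _) => apply/fsubsetP => x; apply/implyP; fset_cases x
  | |- _ = _ => apply/fsetP => x; fset_cases x
  end.

Section PosetClasses.

Variables (U : choiceType) (D : incidence_data U).
Implicit Types (P Q S : obj D) (A B I J L : {fset U}).
Local Notation pclass := (pclass D).

Lemma empty_exists : exists P : obj D, pcar P = fset0.
Proof.
have [P hP] := inc_nonempty D; exists (obj_sub (Obj hP) fset0).
exact/obj_sub_car/ideal_convex/ideal0.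
Qed.

Definition pc_zero : pclass := cls (projT1 (cid empty_exists)).

Lemma pc_zeroP P : cls P = pc_zero <-> pcar P = fset0.
Proof.
rewrite /pc_zero; case: cid => Z /= Z0; split=> [/clsP/map_equiv_card|P0].
  by rewrite Z0 cardfs0 => /eqP; rewrite cardfs_eq0 => /eqP.
congr cls; apply: obj_eq; apply: fposet_eqP => [|x y]; first by rewrite P0.
by apply/idP/idP => /ple_dom[]; rewrite ?P0 ?Z0 inE.
Qed.

Definition pc_deg (k : pclass) : nat := #|` pcar (rep k)|.

Lemma pc_deg_cls P : pc_deg (cls P) = #|` pcar P|.
Proof. exact/map_equiv_card/rep_equiv. Qed.

Lemma obj_subD_sub P I L B : I \in ideals P -> L \in ideals P ->
  convex P B -> B `<=` L `\` I -> obj_sub (obj_sub P (L `\` I)) B = obj_sub P B.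
Proof. by move=> hI hL; apply: obj_sub_sub; exact: convexD. Qed.

Lemma obj_ideal_sub P L B : L \in ideals P -> convex P B -> B `<=` L ->
  obj_sub (obj_sub P L) B = obj_sub P B.
Proof. by move=> hL; apply: obj_sub_sub; exact: ideal_convex. Qed.

Lemma ideals_obj_sub P L A : L \in ideals P ->
  (A \in ideals (obj_sub P L)) = (A `<=` L) && (A \in ideals P).
Proof. by move=> hL; rewrite (obj_subE (ideal_convex hL)) ideals_psub. Qed.

Lemma pc_addC : commutative (@pc_add U D).
Proof.
move=> a b; have [P PE] := rep_exists (pc_add a b).
have [I [hI <- <-]] := pc_add_split PE.
rewrite -(cls_split hI) (cls_split (splits_compl hI)) fsetDK //.
by case/andP: hI => /ideal_sub.
Qed.

Lemma splits_sub P I A : splits P I -> splits (obj_sub P I) A -> splits P A.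
Proof.
move=> /andP[hI hJ] /andP[]; rewrite ideals_obj_sub // => /andP[AI hA].
rewrite obj_sub_car; last exact: ideal_convex.
rewrite ideals_obj_sub // => /andP[_ hB]; rewrite /splits hA /=.
have IP := ideal_sub hI.
by rewrite (_ : _ `\` _ = (I `\` A) `|` (pcar P `\` I)) ?idealU //; fset_tauto.
Qed.

(** A poset in the class of the left-hand side contains all three summands. *)
Lemma pc_addA : associative (@pc_add U D).
Proof.
move=> a b c; have [T TE] := rep_exists (pc_add (pc_add a b) c); rewrite -TE.
have [I [hI Ia Ic]] := pc_add_split TE.
have [J [hJ Ja Jb]] := pc_add_split Ia.
have hTJ := splits_sub hI hJ.
have [iI iIc] := andP hI; have [iJ iJc] := andP hTJ.
have [] := andP hJ; rewrite ideals_obj_sub // obj_sub_car; last exact: ideal_convex.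
move=> /andP[JI _]; rewrite ideals_obj_sub // => /andP[IJI hIJ].
rewrite obj_ideal_sub // in Ja; last exact: ideal_convex.
rewrite obj_sub_car in Jb; last exact: ideal_convex.
rewrite obj_ideal_sub // in Jb; last exact: ideal_convex.
rewrite (cls_split hTJ) Ja; congr pc_add.
have IT := ideal_sub iI.
have E : (pcar T `\` J) `\` (I `\` J) = pcar T `\` I by fset_tauto.
have IJT : I `\` J `<=` pcar T `\` J by fset_tauto.
have s : splits (obj_sub T (pcar T `\` J)) (I `\` J).
  rewrite /splits obj_sub_car; last exact: ideal_convex.
  by rewrite E !(ideals_obj_sub _ iJc) hIJ iIc !andbT IJT /=; fset_tauto.
rewrite (cls_split s) obj_sub_car; last exact: ideal_convex.
rewrite E !obj_ideal_sub ?Jb ?Ic //; try exact: ideal_convex.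
by fset_tauto.
Qed.

Lemma pc_add0 : left_id pc_zero (@pc_add U D).
Proof.
move=> a; have [P <-] := rep_exists a.
have s : splits P fset0 by rewrite /splits ideal0 fsetD0 idealT.
rewrite [RHS](cls_split s) fsetD0 obj_sub_full; congr pc_add.
by apply/esym/pc_zeroP/obj_sub_car/ideal_convex/ideal0.
Qed.

Lemma pc_degD a b : pc_deg (pc_add a b) = (pc_deg a + pc_deg b)%N.
Proof.
have [P PE] := rep_exists (pc_add a b); rewrite -PE pc_deg_cls.
have [I [/andP[hI hJ] <- <-]] := pc_add_split PE.
rewrite !pc_deg_cls !obj_sub_car; try exact: ideal_convex.
rewrite -(cardfsID I (pcar P)); congr (_ + _)%N; congr #|` _|.
exact/fsetIidPr/ideal_sub.
Qed.

Lemma pc_deg_eq0 a : pc_deg a = 0%N -> a = pc_zero.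
Proof.
have [P <-] := rep_exists a; rewrite pc_deg_cls => /eqP.
rewrite cardfs_eq0 => /eqP ?.
exact/pc_zeroP.
Qed.

Lemma pc_sub_deg k p : p \in pc_sub k -> (pc_deg p.1 + pc_deg p.2)%N = pc_deg k.
Proof.
move=> /mapP[I hI ->] /=; rewrite !pc_deg_cls !obj_sub_car; first last.
- exact: ideal_convex.
- exact: convexD (idealT _) hI.
rewrite /pc_deg -(cardfsID I (pcar (rep k))); congr (_ + _)%N; congr #|` _|.
exact/esym/fsetIidPr/ideal_sub.
Qed.

Lemma pc_subA k (F : pclass -> pclass -> pclass -> rat) :
  (\sum_(p <- pc_sub k) \sum_(q <- pc_sub p.1) F q.1 q.2 p.2 =
   \sum_(p <- pc_sub k) \sum_(q <- pc_sub p.2) F p.1 q.1 q.2)%R.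
Proof.
have [P <-] := rep_exists k.
rewrite (sum_pc_sub P (fun a b => \sum_(q <- pc_sub a) F q.1 q.2 b)%R).
rewrite (sum_pc_sub P (fun a b => \sum_(q <- pc_sub b) F a q.1 q.2)%R).
(* Both sides run through the chains J <= L of ideals. *)
pose G J L := F (cls (obj_sub P J)) (cls (obj_sub P (L `\` J)))
  (cls (obj_sub P (pcar P `\` L))).
transitivity (\sum_(L <- ideals P) \sum_(J <- ideals P | J `<=` L) G J L)%R.
  rewrite big_seq [RHS]big_seq; apply: eq_bigr => L hL.
  rewrite (sum_pc_sub _ (fun a b => F a b (cls (obj_sub P (pcar P `\` L))))).
  rewrite (_ : ideals (obj_sub P L) = [fset J in ideals P | J `<=` L]).
    rewrite -big_fset_condE big_seq_cond [RHS]big_seq_cond.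
    apply: eq_bigr => J /andP[hJ JL].
    rewrite obj_sub_car; last exact: ideal_convex.
    by rewrite !obj_ideal_sub ?fsubsetDl //; [exact: convexD|exact: ideal_convex].
  by apply/fsetP => J; rewrite ideals_obj_sub // in_fset_cond andbC.
rewrite (exchange_big_dep xpredT) //= big_seq [RHS]big_seq.
apply: eq_bigr => J hJ; have JP := ideal_sub hJ.
rewrite (sum_pc_sub _ (fun a b => F (cls (obj_sub P J)) a b)).
have cJ := convexD (idealT P) hJ.
rewrite obj_sub_car // big_fset_condE.
have idI A := @ideals_interval _ P J (pcar P) A hJ (idealT P) JP.
have [jp jd] : (forall L, J `<=` L -> L `\` J `|` J = L) /\
               (forall A, A `<=` pcar P `\` J -> (A `|` J) `\` J = A).
  by split=> [L JL|A AP]; fset_tauto.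
rewrite (sum_reindex (s := ideals (obj_sub P (pcar P `\` J)))
  (t := [fset L in ideals P | J `<=` L]) (h := fun A => A `|` J)) ?fset_uniq //.
- rewrite big_seq [RHS]big_seq; apply: eq_bigr => A.
  rewrite obj_subE // idI => /andP[AP hAJ].
  have EA := jd A AP; have cA : convex P A by rewrite -EA; exact: convexD.
  have EC : (pcar P `\` J) `\` A = pcar P `\` (A `|` J).
    by rewrite fsetDDl fsetUC.
  rewrite /G EA EC !obj_subD_sub ?idealT //.
  + exact: convexD (idealT P) hAJ.
  + by apply: fsetDS; exact: fsubsetUr.
- move=> A B; rewrite obj_subE // !idI => /andP[AP _] /andP[BP _] AB.
  by rewrite -(jd A AP) AB jd.
- move=> A; rewrite obj_subE // idI => /andP[AP hA].
  by rewrite in_fset_cond hA fsubsetUr.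
- move=> L; rewrite in_fset_cond => /andP[hL JL]; exists (L `\` J);
    last by rewrite jp.
  by rewrite obj_subE // idI jp // hL andbT fsetSD // ideal_sub.
Qed.

Lemma pc_sub0l k (F : pclass -> rat) :
  (\sum_(p <- pc_sub k | p.1 == pc_zero) F p.2 = F k)%R.
Proof.
have [P <-] := rep_exists k; rewrite big_mkcond.
rewrite (sum_pc_sub P (fun a b => if a == pc_zero then F b else 0)%R) /=.
rewrite (big_fsetD1 fset0) ?ideal0 //= fsetD0 obj_sub_full.
rewrite (_ : cls _ = pc_zero) ?eqxx; last first.
  exact/pc_zeroP/obj_sub_car/ideal_convex/ideal0.
rewrite big1_seq ?addr0 // => I /andP[_]; rewrite in_fsetD1 => /andP[I0 hI].
case: eqP => // /pc_zeroP; rewrite obj_sub_car; last exact: ideal_convex.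
by move=> I0'; rewrite I0' eqxx in I0.
Qed.

Lemma pc_sub0r k (F : pclass -> rat) :
  (\sum_(p <- pc_sub k | p.2 == pc_zero) F p.1 = F k)%R.
Proof.
have [P <-] := rep_exists k; rewrite big_mkcond.
rewrite (sum_pc_sub P (fun a b => if b == pc_zero then F a else 0)%R) /=.
rewrite (big_fsetD1 (pcar P)) ?idealT //= fsetDv obj_sub_full.
rewrite (_ : cls (obj_sub P fset0) = pc_zero) ?eqxx; last first.
  exact/pc_zeroP/obj_sub_car/ideal_convex/ideal0.
rewrite big1_seq ?addr0 // => I /andP[_]; rewrite in_fsetD1 => /andP[I0 hI].
case: eqP => // /pc_zeroP; rewrite obj_sub_car; last exact: convexD (idealT P) hI.
move=> /eqP; rewrite fsetD_eq0 => PI; case/negP: I0.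
by rewrite eqEfsubset PI ideal_sub.
Qed.

Lemma ideal_trace P I (C : {fset U}) : I \in ideals P -> C `<=` pcar P ->
  C `&` I \in ideals (psub P C).
Proof.
move=> hI CP; apply/idealP; rewrite psub_carE // fsubsetIl; split=> // x y.
rewrite ple_psub !inE => /andP[_ yI] /and3P[-> _ xy].
exact: ideal_le hI yI xy.
Qed.

(** The trace of a disjoint decomposition is a disjoint decomposition. *)
Lemma cls_cut P I (C : {fset U}) : splits P I -> convex P C ->
  cls (obj_sub P C) =
  pc_add (cls (obj_sub P (C `&` I))) (cls (obj_sub P (C `\` I))).
Proof.
move=> /andP[hI hJ] cC; have CP := cC.1; have IP := ideal_sub hI.
have E : C `\` (C `&` I) = C `&` (pcar P `\` I) by fset_tauto.
have E' : C `&` (pcar P `\` I) = C `\` I by fset_tauto.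
have t1 := ideal_trace hI CP; have t2 := ideal_trace hJ CP.
have conv A : A \in ideals P -> convex P (C `&` A).
  move=> hA; split=> [|x y z]; first by fset_tauto.
  rewrite !inE => /andP[xC xA] /andP[yC yA] xz zy.
  by rewrite (cC.2 _ _ _ xC yC xz zy) (ideal_le hA yA zy).
have s : splits (obj_sub P C) (C `&` I).
  by rewrite /splits obj_sub_car // obj_subE // E t1.
rewrite (cls_split s) obj_sub_car // E !obj_sub_sub ?fsubsetIl ?E' //.
- by rewrite -E'; exact: conv.
- exact: conv.
Qed.

(** The ideals of a disjoint union are the unions of ideals of its parts. *)
Lemma pc_subD k l (F : pclass -> pclass -> rat) :
  (\sum_(p <- pc_sub (pc_add k l)) F p.1 p.2 =
   \sum_(p <- pc_sub k) \sum_(q <- pc_sub l)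
      F (pc_add p.1 q.1) (pc_add p.2 q.2))%R.
Proof.
have [S SE] := rep_exists (pc_add k l); rewrite -SE.
have [I [hS <- <-]] := pc_add_split SE.
have [hI hI'] := andP hS; have IS := ideal_sub hI.
have [cI cI'] := (ideal_convex hI, ideal_convex hI').
rewrite sum_pc_sub (sum_pc_sub _ (fun a b =>
  \sum_(q <- pc_sub (cls (obj_sub S (pcar S `\` I))))
      F (pc_add a q.1) (pc_add b q.2))%R).
under [RHS]eq_bigr do rewrite (sum_pc_sub _ (fun a b =>
      F (pc_add (cls _) a) (pc_add (cls _) b))).
rewrite !obj_sub_car //.
pose G (A B A' B' : {fset U}) :=
  F (pc_add (cls (obj_sub S A)) (cls (obj_sub S B)))
    (pc_add (cls (obj_sub S A')) (cls (obj_sub S B'))).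
pose t := [seq (A, B) | A <- ideals (obj_sub S I),
  B <- ideals (obj_sub S (pcar S `\` I))].
have tP A B : (A, B) \in t -> [/\ A `<=` I, A \in ideals S,
    B `<=` pcar S `\` I & B \in ideals S].
  move=> /allpairsPdep[A' [B' [+ + [-> ->]]]].
  rewrite (ideals_obj_sub _ hI) (ideals_obj_sub _ hI').
  by move=> /andP[-> ->] /andP[-> ->].
transitivity (\sum_(p <- t)
    G p.1 p.2 (I `\` p.1) ((pcar S `\` I) `\` p.2))%R; last first.
  rewrite big_allpairs_dep big_seq [RHS]big_seq; apply: eq_bigr => A.
  rewrite (ideals_obj_sub _ hI) => /andP[AI hA].
  rewrite big_seq [RHS]big_seq; apply: eq_bigr => B.
  rewrite (ideals_obj_sub _ hI') => /andP[BI hB] /=.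
  rewrite (obj_ideal_sub hI (ideal_convex hA) AI).
  rewrite (obj_ideal_sub hI (convexD hI hA) (fsubsetDl _ _)).
  rewrite (obj_ideal_sub hI' (ideal_convex hB) BI).
  by rewrite (obj_ideal_sub hI' (convexD hI' hB) (fsubsetDl _ _)).
transitivity (\sum_(J <- ideals S) G (J `&` I) (J `\` I)
    ((pcar S `\` J) `&` I) ((pcar S `\` J) `\` I))%R.
  rewrite big_seq [RHS]big_seq; apply: eq_bigr => J hJ.
  rewrite (cls_cut hS (ideal_convex hJ)).
  by rewrite (cls_cut hS (convexD (idealT S) hJ)).
rewrite (sum_reindex (s := t) (h := fun p => p.1 `|` p.2)) ?fset_uniq //.
- rewrite big_seq [RHS]big_seq; apply: eq_bigr => -[A B] /tP[AI _ BI _] /=.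
  by congr G; fset_tauto.
- by apply: allpairs_uniq => [||[? ?] [? ?] _ _ //]; exact: fset_uniq.
- move=> [A B] [A' B'] /tP[AI _ BI _] /tP[AI' _ BI' _] /= AB; congr pair.
    transitivity ((A `|` B) `&` I); first by clear AB; fset_tauto.
    by rewrite AB; clear AB; fset_tauto.
  transitivity ((A `|` B) `\` I); first by clear AB; fset_tauto.
  by rewrite AB; clear AB; fset_tauto.
- by move=> [A B] /tP[_ hA _ hB]; exact: idealU.
- move=> J hJ; exists (J `&` I, J `\` I) => /=; last first.
    by have JS := ideal_sub hJ; fset_tauto.
  have JI : J `\` I = J `&` (pcar S `\` I).
    by have JS := ideal_sub hJ; fset_tauto.
  apply/allpairsPdep; exists (J `&` I), (J `\` I).
  rewrite (ideals_obj_sub _ hI) (ideals_obj_sub _ hI') JI.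
  by rewrite !fsubsetIr !idealI.
Qed.

Hypothesis hfin : finitary D.

Lemma pc_sub_fin a b : exists s : seq pclass,
  forall k, (a, b) \in pc_sub k -> k \in s.
Proof.
have [n [Q hQ]] := hfin (rep a) (rep b).
exists [seq cls (Q i) | i <- enum 'I_n] => k; have [P <-] := rep_exists k.
move=> /mem_pc_sub[I [hI Ia Ib]]; rewrite !obj_isoE in hQ.
have [||i PQ] := hQ _ _ hI; try by apply/clsP; rewrite repK.
by apply/mapP; exists i; [rewrite mem_enum | exact/clsP].
Qed.

Definition pc_monoid : hall_monoid :=
  HallMonoid pc_addA pc_addC pc_add0 pc_degD pc_deg_eq0 pc_sub_deg pc_sub_fin
    pc_subA pc_sub0l pc_sub0r pc_subD.

End PosetClasses.

(** * The lattices of order ideals *)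

Section IdealLattices.

Variables (U : choiceType) (D : incidence_data U).
Implicit Types (P Q S : obj D) (A B I J L : {fset U}).

Lemma ple_lattice (P : fposet U) I L : ple (ideal_lattice P) I L =
  [&& I \in ideals P, L \in ideals P & I `<=` L].
Proof. exact: ple_mk. Qed.

Lemma ple_pprod (V W : choiceType) (P : fposet V) (Q : fposet W) p q :
  ple (pprod P Q) p q = ple P p.1 q.1 && ple Q p.2 q.2.
Proof.
rewrite /pprod ple_mk !inE andbA andb_idl // => /andP[hP hQ].
have [-> ->] := prel_dom hP.
by have [-> ->] := prel_dom hQ.
Qed.

Lemma unique_minimal_lattice (P : fposet U) :
  unique_minimal (ideal_lattice P) fset0.
Proof.
move=> I; split=> [[hI Imin]|->].
  by apply/esym/Imin; rewrite ple_lattice ideal0 fsub0set andbT.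
split=> [|J]; first exact: ideal0.
by rewrite ple_lattice fsubset0 => /and3P[_ _ /eqP].
Qed.

Lemma unique_maximal_lattice (P : fposet U) :
  unique_maximal (ideal_lattice P) (pcar P).
Proof.
move=> I; split=> [[hI Imax]|->].
  by apply/esym/Imax; rewrite ple_lattice hI idealT (ideal_sub hI).
split=> [|J]; first exact: idealT.
rewrite ple_lattice => /and3P[_ hJ PJ].
by apply/eqP; rewrite eqEfsubset PJ ideal_sub.
Qed.

Lemma lattice_interval P I L : ple (ideal_lattice P) I L ->
  poset_isomorphic (ideal_lattice (obj_sub P (L `\` I)))
    (psub (ideal_lattice P) [fset J in pcar (ideal_lattice P) |
       ple (ideal_lattice P) I J && ple (ideal_lattice P) J L]).
Proof.
rewrite ple_lattice => /and3P[hI hL IL].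
have cLI := convexD hL hI.
have idE A := ideals_interval A hI hL IL.
have inB J : (J \in [fset J in pcar (ideal_lattice P) |
    ple (ideal_lattice P) I J && ple (ideal_lattice P) J L]) =
    [&& J \in ideals P, I `<=` J & J `<=` L].
  rewrite in_fset_cond !ple_lattice hI hL /=.
  by case: (J \in ideals P); rewrite ?andbF.
have jd A : A `<=` L `\` I -> (A `|` I) `\` I = A by move=> AL; fset_tauto.
have inA A : A \in ideals (obj_sub P (L `\` I)) ->
    A `<=` L `\` I /\ A `|` I \in ideals P.
  by rewrite (obj_subE cLI) idE => /andP.
exists (fun A => A `|` I); split.
- move=> A B /inA[AL _] /inA[BL _] AB.
  by rewrite -(jd A AL) AB jd.
- apply/fsetP => J; rewrite psub_carE; last exact: fset_sub.
  rewrite inB; apply/imfsetP/and3P => /= [[A /inA[AL hA] ->]|[hJ IJ JL]].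
    by split; [exact: hA | exact: fsubsetUr | fset_tauto].
  exists (J `\` I); last by fset_tauto.
  rewrite (obj_subE cLI) idE fsetSD // (_ : _ `|` _ = J) //; fset_tauto.
- move=> A B hA hB; have [AL hAI] := inA _ hA; have [BL hBI] := inA _ hB.
  rewrite ple_psub !inB !ple_lattice hAI hBI hA hB !fsubsetUr /=.
  have -> : A `|` I `<=` L by fset_tauto.
  have -> : B `|` I `<=` L by fset_tauto.
  rewrite /=; apply/idP/idP => h; last exact: fsetSU.
  rewrite -(jd A AL) -(jd B BL); exact: fsetSD.
Qed.

Lemma lattice_sum P Q : poset_isomorphic (ideal_lattice (obj_sum P Q))
  (pprod (ideal_lattice P) (ideal_lattice Q)).
Proof.
have [I [hI /clsP IP /clsP JQ]] := pc_add_split (cls_obj_sum P Q).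
have [h [hp hl]] := map_equiv_lift IP; have [g [gp gl]] := map_equiv_lift JQ.
set S := obj_sum P Q in hI IP JQ h g hp hl gp gl *.
have [iI iJ] := andP hI; have IS := ideal_sub iI.
have [hi _ _] := hp; have [gi _ _] := gp.
rewrite obj_sub_car in hi; last exact: ideal_convex.
rewrite obj_sub_car in gi; last exact: ideal_convex.
have tr J : J \in ideals S -> J `&` I \in ideals (obj_sub S I) /\
    J `\` I \in ideals (obj_sub S (pcar S `\` I)).
  move=> hJ; have JS := ideal_sub hJ.
  rewrite (ideals_obj_sub _ iI) (ideals_obj_sub _ iJ) fsubsetIr (idealI hJ iI).
  rewrite (fsetSD _ JS) (_ : J `\` I = J `&` (pcar S `\` I)); last by fset_tauto.
  by rewrite (idealI hJ iJ).
have DS J : J \in ideals S -> J `\` I `<=` pcar S `\` I.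
  by move=> hJ; rewrite fsetSD // ideal_sub.
exists (fun J => (fimage h (J `&` I), fimage g (J `\` I))); split.
- move=> J J' hJ hJ' [].
  move=> /(fimage_inj hi (fsubsetIr _ _) (fsubsetIr _ _)) E1.
  move=> /(fimage_inj gi (DS _ hJ) (DS _ hJ')) E2.
  by rewrite -(fsetID I J) E1 E2 fsetID.
- apply/fsetP => -[A B].
  rewrite -[pcar (pprod _ _)]/(ideals P `*` ideals Q) in_fsetM.
  apply/imfsetP/andP => /= [[J /tr[hJ1 hJ2] [-> ->]]|[hA hB]].
    by have [? _ _] := hl _ hJ1; have [? _ _] := gl _ hJ2.
  have [A' hA' ->] := ideal_preimage hp hA.
  have [B' hB' ->] := ideal_preimage gp hB.
  move: hA' hB'; rewrite (ideals_obj_sub _ iI) (ideals_obj_sub _ iJ).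
  move=> /andP[AI hA'] /andP[BI hB'].
  exists (A' `|` B'); first exact: idealU.
  by congr (fimage _ _, fimage _ _); clear hp hl gp gl; fset_tauto.
- move=> J J' hJ hJ'; have [h1 h2] := tr _ hJ; have [h1' h2'] := tr _ hJ'.
  rewrite ple_pprod !ple_lattice /=.
  have [-> _ _] := hl _ h1; have [-> _ _] := hl _ h1'.
  have [-> _ _] := gl _ h2; have [-> _ _] := gl _ h2'.
  rewrite hJ hJ' /= (fimageSE hi) ?fsubsetIr // (fimageSE gi) ?DS //.
  apply/andP/idP => [[J1 J2]|JJ]; last by split; fset_tauto.
  by rewrite -(fsetID I J) -(fsetID I J') fsetUSS.
Qed.

Lemma ideal_lattices_family : is_interval_family (ideal_lattices D).
Proof.
split.
- by have [P hP] := inc_nonempty D; constructor; exact: (Obj hP).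
- by move=> P; split; [exact: unique_minimal_lattice|exact: unique_maximal_lattice].
- by move=> P I L; exact: lattice_interval.
- exact: lattice_sum.
Qed.

Lemma lattice_equiv_hopf : is_hopf_relation (@lattice_equiv U D).
Proof.
have sumE P Q P' Q' : map_equiv P P' -> map_equiv Q Q' ->
    map_equiv (obj_sum P Q) (obj_sum P' Q').
  by move=> /clsP PP /clsP QQ; apply/clsP; rewrite !cls_obj_sum PP QQ.
split.
- split; [exact: map_equiv_refl|exact: map_equiv_sym|exact: map_equiv_trans].
- move=> P Q /map_equiv_lift[h [hp hl]]; have [hi _ _] := hp.
  exists (fimage h); split.
  + by move=> I J /ideal_sub IP /ideal_sub JP; exact: fimage_inj hi IP JP.
  + apply/fsetP => J; apply/imfsetP/idP => /= [[I /hl[hI _ _] ->] //|].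
    by move=> /(ideal_preimage hp)[I hI ->]; exists I.
  + by move=> I /hl[_ ? ?]; rewrite /= !fsetD0.
- by move=> P Q S PQ; split; apply: sumE => //; exact: map_equiv_refl.
- move=> P Q /eqP cQ.
  have Q0 : pcar Q = fset0.
    move: cQ => /cardfs1P[I QI].
    have := ideal0 Q; have := idealT Q.
    rewrite -[ideals Q]/(pcar (ideal_lattice Q)) QI !inE.
    by move=> /eqP -> /eqP.
  have Q1 := (pc_zeroP Q).2 Q0.
  split; apply/clsP; rewrite !cls_obj_sum Q1; first exact: pc_addC.
  exact: pc_add0.
Qed.

End IdealLattices.

(** * The Ringel-Hall algebra and the incidence Hopf algebra *)

Lemma hopf_isomorphic_refl (V : lmodType rat) (A : hopf_algebra V) :
  hopf_isomorphic A A.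
Proof.
exists idfun; split=> //; first by exists id.
have tl := tmap_linear (@lin_id V) (@lin_id V).
move=> x; rewrite -[RHS]/(tmap id id (comul A x)).
by move: (comul A x); apply: tensor_ext => // u v; rewrite tmap_tens.
Qed.

Section HallAlgebraOfPosets.

Variables (U : choiceType) (D : incidence_data U) (hfin : finitary D).
Local Notation R := (@map_equiv U D).
Local Notation K := (pc_monoid hfin).
Local Notation RH := (hall_hopf K : hopf_algebra {malg rat[classes R]}).

Lemma order_componentE : @order_component U D R = @hall_component K.
Proof.
apply/funext => n; apply/funext => f; apply/propext; split=> fn.
  by move=> k; have [P <-] := rep_exists k => /fn <-; exact: pc_deg_cls.
by move=> P /fn <-; exact/esym/pc_deg_cls.
Qed.

Lemma poset_connected_grading : connected_grading RH (@order_component U D R).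
Proof. by rewrite order_componentE; exact: hall_connected_grading. Qed.

Lemma order_component_delta (P : obj D) :
  @order_component U D R #|` pcar P| << class_of R P >>%R.
Proof.
rewrite order_componentE -pc_deg_cls.
exact: (@delta_component K (cls P)).
Qed.

Lemma poset_product (f g : {malg rat[classes R]}) (P : obj D) :
  ((hmul RH f g)@_(class_of R P) = \sum_(I <- ideals P)
     f@_(class_of R (obj_sub P I)) * g@_(class_of R (obj_sub P (pcar P `\` I))))%R.
Proof.
rewrite [LHS](@hall_mulE K f g (cls P)).
exact: (sum_pc_sub P (fun a b => (f@_a * g@_b)%R)).
Qed.

Lemma poset_coproduct (f : {malg rat[classes R]}) (P Q : obj D) :
  tcoeff (comul RH f) (class_of R P) (class_of R Q) =
  f@_(class_of R (obj_sum P Q)).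
Proof.
rewrite [LHS](@hall_comulE K f (cls P) (cls Q)).
by rewrite -[class_of R _]/(cls (obj_sum P Q)) cls_obj_sum.
Qed.

End HallAlgebraOfPosets.

Theorem theorem1 (U : choiceType) (D : incidence_data U) (hfin : finitary D) :
  [/\ is_interval_family (ideal_lattices D),
      is_hopf_relation (@lattice_equiv U D) &
  exists (RH : hopf_algebra {malg rat[iso_class D]})
         (IH : hopf_algebra {malg rat[classes (@lattice_equiv U D)]}),
    [/\ is_ringel_hall RH,
        is_incidence_hopf IH,
        hopf_isomorphic RH IH,
        [/\ connected_grading RH (@order_component U D (@obj_iso U D)),
            connected_grading IH (@order_component U D (@lattice_equiv U D)),
            (forall P : obj D, @order_component U D (@obj_iso U D)
               #|` pcar P|%fset << class_of (@obj_iso U D) P >>%R) &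
            (forall P : obj D, @order_component U D (@lattice_equiv U D)
               #|` pcar P|%fset << class_of (@lattice_equiv U D) P >>%R)] &
        is_enveloping_of_primitives RH /\ is_enveloping_of_primitives IH]].
Proof.
split; [exact: ideal_lattices_family | exact: lattice_equiv_hopf |].
rewrite /is_ringel_hall /iso_class obj_isoE.
exists (hall_hopf (pc_monoid hfin)), (hall_hopf (pc_monoid hfin)); split.
- by split; [exact: poset_product | exact: poset_coproduct].
- split; last exact: poset_coproduct.
  move=> f g P /=; rewrite [LHS](poset_product hfin).
  by apply: eq_bigr => I _; rewrite fsetD0.
- exact: hopf_isomorphic_refl.
- split.
  + exact: poset_connected_grading.
  + exact: poset_connected_grading.
  + exact: order_component_delta.
  + exact: order_component_delta.
- split; exact (hall_enveloping (pc_monoid hfin)).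
Qed.
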